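(* Let $(A,R)$ be a semisimple factorizable Hopf algebra over $\Bbbk$, with irreducible characters $\chi_1,\dots,\chi_s$, associated central primitive idempotents $e_1,\dots,e_s\in Z(A)$, and $E_j:=\phi_A^{-1}(e_j)\in C(A)$. Let $d\in\mathrm{Irr}(A^* )$. Then $$\mathrm{Rep}\bigl(\mathrm{HKer}_{A^*}(d)^*\bigr)'=\langle \chi_j \mid E_j(d)\neq 0\rangle ,$$ where $'$ denotes the Müger centralizer in $\mathrm{Rep}(A)$.
   Context: $\Bbbk$ is an algebraically closed field of characteristic zero; $\mathrm{Rep}(H)$ is the category of finite dimensional representations of $H$. $C(A)\subseteq A^*$ is the character ring of $A$, i.e. the $\Bbbk$-span of the set $\mathrm{Irr}(A)$ of irreducible characters of $A$. Dually, $\mathrm{Irr}(A^* )\subseteq A$ is the set of irreducible characters of $A^*$, viewed as elements of $A=A^{**}$ (characters of irreducible $A$-comodules). For $f\in A^*$ and $d\in A$, $f(d)$ is evaluation. A quasitriangular Hopf algebra $(A,R)$ is factorizable if $\phi_A:A^*\to A$, $f\mapsto(\mathrm{id}\otimes f)(R_{21}R)$, is a linear isomorphism; in that case $\phi_A$ restricts to an algebra isomorphism $C(A)\to Z(A)$ onto the center. $\mathrm{Rep}(A)$ is a modular fusion category with braiding $c_{M,N}(m\otimes n)=R_{21}(n\otimes m)$. For $d\in\mathrm{Irr}(A^* )$, the Hopf kernel $\mathrm{HKer}_{A^*}(d)$ is the Hopf subalgebra of $A^*$ generated by all $\chi\in\mathrm{Irr}(A)$ with $\chi(d)=\chi(1)\epsilon(d)$,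 meaning generated by the simple subcoalgebras of $A^*$ corresponding to these $\chi$; equivalently, it is the largest Hopf subalgebra of $A^*$ acting trivially (through the counit) on the $A^*$-module with character $d$. For a Hopf subalgebra $P\subseteq A^*$, $\mathrm{Rep}(P^* )$ is regarded as a fusion subcategory of $\mathrm{Rep}(A)$ via the canonical projection $A=A^{**}\to P^*$. For a subset $X\subseteq\mathrm{Irr}(A)$, $\langle\chi\mid\chi\in X\rangle$ is the fusion subcategory of $\mathrm{Rep}(A)$ generated by the irreducible modules with characters in $X$. The Müger centralizer $\mathcal{K}'$ of a fusion subcategory $\mathcal{K}$ is the fusion subcategory generated by all simple objects $X$ such that $c_{Y,X}\circ c_{X,Y}=\mathrm{id}_{X\otimes Y}$ for all objects $Y$ of $\mathcal{K}$. *)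

(* Defs.v *)
From HB Require Import structures.
From mathcomp Require Import all_boot all_algebra all_field.
From mathcomp Require boolp.

Set Implicit Arguments.
Unset Strict Implicit.
Unset Printing Implicit Defensive.

Import GRing.Theory VectorInternalTheory.
Local Open Scope ring_scope.

(* A tensor of U (x) V is the matrix of its coefficients on the elementary
   tensors b_i (x) b_j, where (b_i) and (b_j) are the bases of U and V provided
   by the coordinates v2r. *)
Definition tens (k : fieldType) (U V : vectType k) : Type :=
  'M[k]_(dim U, dim V).

HB.instance Definition _ (k : fieldType) (U V : vectType k) :=
  Vector.copy (tens U V) 'M[k]_(dim U, dim V).

Definition bas (k : fieldType) (U : vectType k) (i : 'I_(dim U)) : U :=
  r2v (delta_mx 0 i).

Definition pure (k : fieldType) (U V : vectType k) (u : U) (v : V) : tens U V :=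
  \matrix_(i, j) (v2r u 0 i * v2r v 0 j).

(* The linear extension of b along the universal property of U (x) V; by tliftE
   below, it maps pure u v to b u v whenever b is bilinear. *)
Definition tlift (k : fieldType) (U V : vectType k) (W : lmodType k)
    (b : U -> V -> W) (t : tens U V) : W :=
  \sum_i \sum_j (t : 'M_(_, _)) i j *: b (bas i) (bas j).

(* Sweedler notation: the sum of F(x, y) over t = \sum x (x) y. *)
Notation "\tsum_ ( x , y <- t ) F" := (tlift (fun x y => F) t)
  (at level 41, x name, y name, t at level 41, F at level 41,
   format "'[' \tsum_ ( x ,  y  <-  t ) '/  '  F ']'") : ring_scope.
Notation "u '\ox' v" := (pure u v) (at level 38, left associativity) : ring_scope.

Section TensTheory.
Variable k : fieldType.
Implicit Types (U V X Y : vectType k) (W Z : lmodType k).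

Definition bilin U V W (b : U -> V -> W) :=
  (forall v, linear (b^~ v)) /\ (forall u, linear (b u)).

Lemma tlift_is_linear U V W (b : U -> V -> W) : linear (tlift b).
Proof.
move=> c s t; rewrite /tlift scaler_sumr -big_split; apply: eq_bigr => i _ /=.
rewrite scaler_sumr -big_split; apply: eq_bigr => j _ /=.
by rewrite !mxE scalerDl scalerA.
Qed.

HB.instance Definition _ U V W (b : U -> V -> W) :=
  GRing.isLinear.Build k (tens U V) W _ (tlift b) (tlift_is_linear b).

Lemma bas_sum U (u : U) : u = \sum_i v2r u 0 i *: bas i.
Proof.
rewrite -{1}[u]v2rK {1}[v2r u]row_sum_delta linear_sum.
by apply: eq_bigr => i _; rewrite linearZ.
Qed.

Lemma v2r_bas U (i j : 'I_(dim U)) : v2r (bas i) 0 j = (i == j)%:R.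
Proof. by rewrite r2vK mxE eqxx eq_sym. Qed.

Lemma pureDl U V c (u u' : U) (v : V) :
  (c *: u + u') \ox v = c *: (u \ox v) + u' \ox v.
Proof. by apply/matrixP=> i j; rewrite !mxE linearP !mxE mulrDl mulrA. Qed.

Lemma pureDr U V c (u : U) (v v' : V) :
  u \ox (c *: v + v') = c *: (u \ox v) + u \ox v'.
Proof. by apply/matrixP=> i j; rewrite !mxE linearP !mxE mulrDr mulrCA. Qed.

Lemma linf0 W Z (f : W -> Z) : linear f -> f 0 = 0.
Proof. by move=> lf; have := lf (-1) 0 0; rewrite scaler0 add0r scaleN1r addNr. Qed.

Lemma linfZ W Z (f : W -> Z) c x : linear f -> f (c *: x) = c *: f x.
Proof. by move=> lf; rewrite -[c *: x]addr0 lf linf0 // addr0. Qed.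

Lemma linf_sum W Z (f : W -> Z) (lf : linear f) I (r : seq I) (F : I -> W) :
  f (\sum_(i <- r) F i) = \sum_(i <- r) f (F i).
Proof.
elim/big_rec2: _ => [|i y1 y2 _ <-]; first exact: linf0.
by have := lf 1 (F i) y2; rewrite !scale1r.
Qed.

Lemma scale_linear W (c : k) : linear (fun x : W => c *: x).
Proof. by move=> d x y; rewrite scalerDr !scalerA mulrC. Qed.

Lemma scale_linearl W (x : W) : linear (fun c : k^o => c *: x).
Proof. by move=> d c c'; rewrite scalerDl -scalerA. Qed.

Lemma tliftE U V W (b : U -> V -> W) u v :
  bilin b -> \tsum_(x, y <- u \ox v) b x y = b u v.
Proof.
case=> bl br; rewrite [in RHS](bas_sum u) [in RHS](bas_sum v).
rewrite (linf_sum (bl _)); apply: eq_bigr => i _.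
rewrite (linf_sum (br _)); apply: eq_bigr => j _.
by rewrite (linfZ _ _ (bl _)) (linfZ _ _ (br _)) mxE scalerA.
Qed.

Lemma tens_sum U V (t : tens U V) : \tsum_(x, y <- t) (x \ox y) = t.
Proof.
apply/matrixP=> i j; rewrite summxE (bigD1 i) //= summxE (bigD1 j) //=.
rewrite !mxE !v2r_bas !eqxx !mulr1 big1 => [|j' /negPf nj]; last first.
  by rewrite !mxE !v2r_bas nj mulr0 mulr0.
rewrite addr0 big1 ?addr0 // => i' /negPf ni; rewrite summxE big1 // => j' _.
by rewrite !mxE !v2r_bas ni mul0r mulr0.
Qed.

Lemma tlift_lin U V W Z (f : W -> Z) (b : U -> V -> W) t :
  linear f -> f (\tsum_(x, y <- t) b x y) = \tsum_(x, y <- t) f (b x y).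
Proof.
move=> lf; rewrite [LHS](linf_sum lf); apply: eq_bigr => i _.
by rewrite (linf_sum lf); apply: eq_bigr => j _; rewrite linfZ.
Qed.

Lemma eq_tlift U V W (b b' : U -> V -> W) t :
  (forall x y, b x y = b' x y) ->
  \tsum_(x, y <- t) b x y = \tsum_(x, y <- t) b' x y.
Proof. by move=> E; apply: eq_bigr => i _; apply: eq_bigr => j _; rewrite E. Qed.

Lemma tliftD U V W c (b b' : U -> V -> W) t :
  \tsum_(x, y <- t) (c *: b x y + b' x y)
  = c *: (\tsum_(x, y <- t) b x y) + \tsum_(x, y <- t) b' x y.
Proof.
rewrite scaler_sumr -big_split; apply: eq_bigr => i _ /=.
rewrite scaler_sumr -big_split; apply: eq_bigr => j _ /=.
by rewrite scalerDr scalerA mulrC -scalerA.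
Qed.

Lemma tlift_pair U V W (b : U -> V -> W) t :
  \tsum_(x, y <- t) b x y = \sum_p (t : 'M_(_, _)) p.1 p.2 *: b (bas p.1) (bas p.2).
Proof. by rewrite /tlift pair_big. Qed.

Lemma tlift_exch U V X Y W (F : U -> V -> X -> Y -> W) s t :
  \tsum_(u, v <- s) \tsum_(x, y <- t) F u v x y
  = \tsum_(x, y <- t) \tsum_(u, v <- s) F u v x y.
Proof.
rewrite !tlift_pair; under eq_bigr do rewrite tlift_pair scaler_sumr.
rewrite exchange_big; apply: eq_bigr => p _; rewrite tlift_pair scaler_sumr.
by apply: eq_bigr => q _; rewrite !scalerA mulrC.
Qed.

Lemma tens_ext U V Z (f g : tens U V -> Z) : linear f -> linear g ->
  (forall u v, f (u \ox v) = g (u \ox v)) -> f =1 g.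
Proof.
move=> lf lg fg t; rewrite -[t]tens_sum !tlift_lin //.
by apply: eq_tlift => x y; rewrite fg.
Qed.

Lemma bilin_pure U V : bilin (@pure k U V).
Proof. by split=> [v c u u'|u c v v']; rewrite ?pureDl ?pureDr. Qed.

Lemma linear_tlift U V W (b : U -> V -> W) : linear (tlift b).
Proof. exact: linearP. Qed.

Lemma linear_in_tlift U V W Z (b : Z -> U -> V -> W) t :
  (forall x y, linear (b^~ x ^~ y)) -> linear (fun z => \tsum_(x, y <- t) b z x y).
Proof. by move=> lb c z z'; rewrite -tliftD; apply: eq_tlift => x y; rewrite lb. Qed.

Lemma linear_comp W W' Z (f : W' -> Z) (g : W -> W') :
  linear f -> linear g -> linear (f \o g).
Proof. by move=> lf lg c x y /=; rewrite lg lf. Qed.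

End TensTheory.

Section TensAlgebra.
Variable k : fieldType.
Implicit Types A B : falgType k.

Definition tone A B : tens A B := 1 \ox 1.
Definition tmul A B (s t : tens A B) : tens A B :=
  \tsum_(a, b <- s) \tsum_(a', b' <- t) ((a * a') \ox (b * b')).

Lemma tmul_pure A B (a a' : A) (b b' : B) :
  tmul (a \ox b) (a' \ox b') = (a * a') \ox (b * b').
Proof.
rewrite /tmul tliftE.
  rewrite tliftE //; split=> [y c x x'|x c y y'].
    by rewrite mulrDr -scalerAr pureDl.
  by rewrite mulrDr -scalerAr pureDr.
split=> [y c x x'|x c y y']; rewrite -tliftD; apply: eq_tlift => u v.
  by rewrite mulrDl -scalerAl pureDl.
by rewrite mulrDl -scalerAl pureDr.
Qed.

Lemma linear_tmull A B (t : tens A B) : linear (fun s : tens A B => tmul s t).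
Proof. exact: linear_tlift. Qed.

Lemma linear_tmulr A B (s : tens A B) : linear (fun t : tens A B => tmul s t).
Proof. by apply: linear_in_tlift => x y; apply: linear_tlift. Qed.

Lemma tmulA A B : associative (@tmul A B).
Proof.
move=> r s t; move: r.
apply: (@tens_ext _ A B _ (fun r => tmul r (tmul s t))
  (fun r => tmul (tmul r s) t)) => [||u v].
- exact: linear_tmull.
- exact: linear_comp (linear_tmull t) (linear_tmull s).
move: s; apply: (@tens_ext _ A B _ (fun s => tmul _ (tmul s t))
  (fun s => tmul (tmul _ s) t)) => [||x y].
- exact: linear_comp (linear_tmulr _) (linear_tmull t).
- exact: linear_comp (linear_tmull t) (linear_tmulr _).
move: t; apply: (@tens_ext _ A B _ (fun t => tmul _ (tmul _ t)) (tmul _)) => [||x' y'].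
- exact: linear_comp (linear_tmulr _) (linear_tmulr _).
- exact: linear_tmulr.
by rewrite !tmul_pure !mulrA.
Qed.

Lemma tmul1r A B : left_id (tone A B) (@tmul A B).
Proof.
apply: (@tens_ext _ A B _ (tmul _) id); [exact: linear_tmulr | by [] |] => u v.
by rewrite tmul_pure !mul1r.
Qed.

Lemma tmulr1 A B : right_id (tone A B) (@tmul A B).
Proof.
apply: (@tens_ext _ A B _ (fun t => tmul t _) id); [exact: linear_tmull | by [] |].
by move=> u v; rewrite tmul_pure !mulr1.
Qed.

Lemma tmulDl A B : left_distributive (@tmul A B) +%R.
Proof.
by move=> r s t; have := linear_tmull t 1 r s; rewrite !scale1r.
Qed.

Lemma tmulDr A B : right_distributive (@tmul A B) +%R.
Proof.
by move=> t r s; have := linear_tmulr t 1 r s; rewrite !scale1r.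
Qed.

Lemma tone_neq0 A B : tone A B != 0.
Proof.
apply/eqP=> /matrixP E.
have [i iP] : exists i, v2r (1 : A) 0 i != 0.
  by apply/rV0Pn; rewrite raddf_eq0 ?oner_eq0 //; apply: v2r_inj.
have [j jP] : exists j, v2r (1 : B) 0 j != 0.
  by apply/rV0Pn; rewrite raddf_eq0 ?oner_eq0 //; apply: v2r_inj.
by have := E i j; rewrite !mxE => /eqP; rewrite mulf_eq0 (negPf iP) (negPf jP).
Qed.

HB.instance Definition _ A B := GRing.Zmodule_isNzRing.Build (tens A B)
  (@tmulA A B) (@tmul1r A B) (@tmulr1 A B) (@tmulDl A B) (@tmulDr A B)
  (tone_neq0 A B).

Fact tmulZl A B c (s t : tens A B) : c *: (s * t) = (c *: s) * t.
Proof. exact: esym (linfZ c s (linear_tmull t)). Qed.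

Fact tmulZr A B c (s t : tens A B) : c *: (s * t) = s * (c *: t).
Proof. exact: esym (linfZ c t (linear_tmulr s)). Qed.

HB.instance Definition _ A B :=
  GRing.Lmodule_isLalgebra.Build k (tens A B) (@tmulZl A B).
HB.instance Definition _ A B :=
  GRing.Lalgebra_isAlgebra.Build k (tens A B) (@tmulZr A B).
HB.instance Definition _ A B := Algebra_isFalgebra.Build k (tens A B).

Lemma pureM A B (a a' : A) (b b' : B) :
  (a \ox b) * (a' \ox b') = (a * a') \ox (b * b').
Proof. exact: tmul_pure. Qed.

Lemma tmulE A B (s t : tens A B) :
  s * t = \tsum_(a, b <- s) \tsum_(a', b' <- t) ((a * a') \ox (b * b')).
Proof. by []. Qed.

Lemma pure11 A B : 1 \ox 1 = 1 :> tens A B.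
Proof. by []. Qed.

End TensAlgebra.

(* Since falgType is finite dimensional, so are the Hopf algebras below. *)
HB.mixin Record isHopf (k : fieldType) A of Falgebra k A := {
  comul : {linear A -> tens A A};
  counit : {scalar A};
  antipode : {linear A -> A};
  comul_coassoc : forall a,
    \tsum_(x, y <- comul a) \tsum_(x1, x2 <- comul x) (x1 \ox (x2 \ox y))
    = \tsum_(x, y <- comul a) (x \ox comul y) :> tens A (tens A A);
  counitl : forall a, \tsum_(x, y <- comul a) (counit x *: y) = a;
  counitr : forall a, \tsum_(x, y <- comul a) (counit y *: x) = a;
  comul_monoid_morphism : monoid_morphism comul;
  counit_monoid_morphism : monoid_morphism counit;
  antipodel : forall a, \tsum_(x, y <- comul a) (antipode x * y) = (counit a)%:A;
  antipoder : forall a, \tsum_(x, y <- comul a) (x * antipode y) = (counit a)%:A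
}.

#[short(type="hopfType")]
HB.structure Definition Hopf (k : fieldType) := {A of isHopf k A & Falgebra k A}.

Section HopfTheory.
Variables (k : fieldType) (H : hopfType k).
Implicit Types a b : H.

Lemma comul1 : comul (1 : H) = 1. Proof. exact: comul_monoid_morphism.1. Qed.
Lemma comulM a b : comul (a * b) = comul a * comul b.
Proof. exact: comul_monoid_morphism.2. Qed.
Lemma counit1 : counit (1 : H) = 1. Proof. exact: counit_monoid_morphism.1. Qed.
Lemma counitM a b : counit (a * b) = counit a * counit b.
Proof. exact: counit_monoid_morphism.2. Qed.

Lemma antipode1 : antipode (1 : H) = 1.
Proof.
have := antipodel (1 : H); rewrite comul1 -pure11 tliftE.
  by rewrite mulr1 counit1 scale1r.
split=> [y c x x'|x c y y']; first by rewrite linearP mulrDl -scalerAl.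
by rewrite mulrDr -scalerAr.
Qed.

Lemma comulME (W : lmodType k) (F : H -> H -> W) a b : bilin F ->
  \tsum_(x, y <- comul (a * b)) F x y
  = \tsum_(x, y <- comul a) \tsum_(u, v <- comul b) F (x * u) (y * v).
Proof.
move=> bF; rewrite comulM tmulE (tlift_lin _ _ (linear_tlift F)).
apply: eq_tlift => x y; rewrite (tlift_lin _ _ (linear_tlift F)).
by apply: eq_tlift => u v; rewrite tliftE.
Qed.

Lemma comul_coassocE (W : lmodType k) (F : H -> H -> H -> W) a :
  (forall y z, linear (fun x => F x y z)) ->
  (forall x z, linear (fun y => F x y z)) ->
  (forall x y, linear (fun z => F x y z)) ->
  \tsum_(x, y <- comul a) \tsum_(x1, x2 <- comul x) F x1 x2 y
  = \tsum_(x, y <- comul a) \tsum_(y1, y2 <- comul y) F x y1 y2.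
Proof.
move=> F1 F2 F3.
pose G x (t : tens H H) := \tsum_(y, z <- t) F x y z.
have bG : bilin G.
  split=> [t|x]; last exact: linear_tlift.
  by apply: (linear_in_tlift (b := F)).
have := congr1 (tlift G) (comul_coassoc a).
rewrite !(tlift_lin _ _ (linear_tlift G)) => E.
transitivity (\tsum_(x, y <- comul a) tlift G (x \ox comul y)); last first.
  by apply: eq_tlift => x y; rewrite tliftE.
rewrite -{}E; apply: eq_tlift => x y; rewrite (tlift_lin _ _ (linear_tlift G)).
apply: eq_tlift => x1 x2; rewrite tliftE // /G tliftE //.
Qed.

Lemma counitlE (W : lmodType k) (F : H -> W) a : linear F ->
  \tsum_(x, y <- comul a) (counit x *: F y) = F a.
Proof.
move=> lF; rewrite -[in RHS](counitl a) (tlift_lin _ _ lF).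
by apply: eq_tlift => x y; rewrite linfZ.
Qed.

Lemma counitrE (W : lmodType k) (F : H -> W) a : linear F ->
  \tsum_(x, y <- comul a) (counit y *: F x) = F a.
Proof.
move=> lF; rewrite -[in RHS](counitr a) (tlift_lin _ _ lF).
by apply: eq_tlift => x y; rewrite linfZ.
Qed.

End HopfTheory.

Section Dual.
Variable k : fieldType.

Definition dualv (V : vectType k) : Type := 'Hom(V, k^o).
HB.instance Definition _ (V : vectType k) := Vector.copy (dualv V) 'Hom(V, k^o).

Definition dual_of (V : vectType k) (f : V -> k) : dualv V :=
  linfun (f : V -> k^o).

Lemma linear_dual (V : vectType k) (f : dualv V) : linear (f : V -> k^o).
Proof. exact: linearP. Qed.

Lemma dual_ext (V : vectType k) (f g : dualv V) : f =1 g -> f = g.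
Proof. by move=> E; apply/lfunP. Qed.

Lemma dual_ofE (V : vectType k) (f : V -> k) :
  linear (f : V -> k^o) -> dual_of f =1 f.
Proof.
move=> lf; pose fM := GRing.isLinear.Build k V k^o _ f lf.
pose fL : {linear V -> k^o} := HB.pack (f : V -> k^o) fM.
exact: (lfunE fL).
Qed.

Lemma dualD (V : vectType k) c (f g : dualv V) v :
  (c *: f + g) v = c * f v + g v.
Proof. by rewrite add_lfunE scale_lfunE. Qed.

Lemma linear_eval (V : vectType k) (v : V) :
  linear (fun f : dualv V => f v : k^o).
Proof. by move=> c f g /=; rewrite dualD. Qed.

Definition dual_bas (V : vectType k) (i : 'I_(dim V)) : dualv V :=
  dual_of (fun v => v2r v 0 i).

Lemma dual_basE (V : vectType k) (i : 'I_(dim V)) v : dual_bas i v = v2r v 0 i.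
Proof. by apply: (dual_ofE _ v) => c u u'; rewrite linearP !mxE. Qed.

Lemma dual_sep (V : vectType k) (u v : V) :
  (forall f : dualv V, f u = f v) -> u = v.
Proof.
move=> E; apply: v2r_inj; apply/rowP=> i.
by have := E (dual_bas i); rewrite !dual_basE.
Qed.

Lemma dual_sum (V : vectType k) (f : dualv V) :
  f = \sum_i f (bas i) *: dual_bas i.
Proof.
apply: dual_ext => v; rewrite [v in LHS]bas_sum (linf_sum (linear_dual f)).
rewrite (linf_sum (linear_eval v)); apply: eq_bigr => i _.
rewrite (linfZ _ _ (linear_dual f)) (linfZ _ _ (linear_eval v)) dual_basE; exact: mulrC.
Qed.

Lemma bilin_contract (U V : vectType k) u :
  bilin (fun (f : dualv U) (v : V) => f u *: v).
Proof.
split=> [v c f g|f c v v']; first by rewrite dualD scalerDl scalerA.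
by rewrite scalerDr !scalerA mulrC.
Qed.

Lemma tens_sep (U V : vectType k) (s t : tens (dualv U) V) :
  (forall u, \tsum_(f, v <- s) ((f : dualv U) u *: v) = \tsum_(f, v <- t) ((f : dualv U) u *: v)) -> s = t.
Proof.
suff D (r : tens (dualv U) V) :
  r = \sum_i (dual_bas i \ox \tsum_(f, v <- r) ((f : dualv U) (bas i) *: v)).
  by move=> E; rewrite (D s) (D t); apply: eq_bigr => i _; rewrite E.
move: r; apply: (@tens_ext _ _ _ _ id
  (fun r => \sum_i (dual_bas i \ox \tsum_(f, v <- r) ((f : dualv U) (bas i) *: v)))) => //.
  move=> c s' t'; rewrite scaler_sumr -big_split; apply: eq_bigr => i _ /=.
  by rewrite -pureDr linear_tlift.
move=> f v; rewrite [f in LHS]dual_sum (linf_sum ((bilin_pure _ _).1 v)).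
apply: eq_bigr => i _; rewrite tliftE; last exact: bilin_contract.
by rewrite (linfZ _ _ ((bilin_pure _ _).1 v)) (linfZ _ _ ((bilin_pure _ _).2 _)).
Qed.

End Dual.

Section DualHopf.
Variables (k : fieldType) (H : hopfType k).
Implicit Types (f g h : dualv H) (a b : H).

(* The algebra structure of H* is the convolution product, with unit the counit. *)
Definition conv f g : dualv H := dual_of (fun a => \tsum_(x, y <- comul a) (f x * g y : k^o)).
Definition dual_one : dualv H := dual_of counit.

Lemma linear_comul : linear (@comul k H). Proof. exact: linearP. Qed.

Lemma convE f g a : conv f g a = \tsum_(x, y <- comul a) (f x * g y : k^o).
Proof.
by apply: (dual_ofE _ a); apply: (linear_comp (linear_tlift _) linear_comul).
Qed.

Lemma dual_oneE a : dual_one a = counit a.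
Proof. by apply: (dual_ofE _ a) => c x y; rewrite linearP. Qed.

Lemma bilin_conv f g : bilin (fun x y => f x * g y : k^o).
Proof.
split=> [y c x x'|x c y y']; rewrite (linear_dual _ c).
  by rewrite mulrDl -mulrA.
by rewrite mulrDr mulrCA.
Qed.

Lemma linear_mull (A : falgType k) (c : A) : linear (fun x : A => c * x).
Proof. by move=> d x y; rewrite mulrDr scalerAr. Qed.

Lemma linear_mulr (A : falgType k) (c : A) : linear (fun x : A => x * c).
Proof. by move=> d x y; rewrite mulrDl scalerAl. Qed.

Lemma convA : associative conv.
Proof.
move=> f g h; apply: dual_ext => a; rewrite !convE.
transitivity (\tsum_(x, y <- comul a) \tsum_(y1, y2 <- comul y)
   (f x * (g y1 * h y2) : k^o)).
  apply: eq_tlift => x y; rewrite convE.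
  by rewrite (tlift_lin _ _ (linear_mull (A := k^o) (f x))).
rewrite -(comul_coassocE (F := fun x y z => f x * (g y * h z) : k^o)).
- apply: eq_tlift => x y; rewrite convE.
  rewrite (tlift_lin _ _ (linear_mulr (A := k^o) (h y))).
  by apply: eq_tlift => x1 x2; rewrite mulrA.
- by move=> y z; apply: linear_comp (linear_mulr (A := k^o) _) (linear_dual f).
- move=> x z; apply: linear_comp (linear_mull (A := k^o) _) _.
  by apply: linear_comp (linear_mulr (A := k^o) _) (linear_dual g).
- move=> x y; apply: linear_comp (linear_mull (A := k^o) _) _.
  by apply: linear_comp (linear_mull (A := k^o) _) (linear_dual h).
Qed.

Lemma conv1r : left_id dual_one conv.
Proof.
move=> f; apply: dual_ext => a; rewrite convE.
rewrite -[RHS](counitlE _ (linear_dual f)).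
by apply: eq_tlift => x y; rewrite dual_oneE.
Qed.

Lemma convr1 : right_id dual_one conv.
Proof.
move=> f; apply: dual_ext => a; rewrite convE.
rewrite -[RHS](counitrE _ (linear_dual f)).
by apply: eq_tlift => x y; rewrite dual_oneE mulrC.
Qed.

Lemma linear_convl g : linear (fun f : dualv H => conv f g).
Proof.
move=> c f f'; apply: dual_ext => a; rewrite dualD !convE.
apply: (etrans _ (@tliftD k H H k^o c (fun x y => f x * g y) (fun x y => f' x * g y) _)).
by apply: eq_tlift => x y; rewrite dualD mulrDl -mulrA.
Qed.

Lemma linear_convr f : linear (fun g : dualv H => conv f g).
Proof.
move=> c g g'; apply: dual_ext => a; rewrite dualD !convE.
apply: (etrans _ (@tliftD k H H k^o c (fun x y => f x * g y) (fun x y => f x * g' y) _)).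
by apply: eq_tlift => x y; rewrite dualD mulrDr mulrCA.
Qed.

Lemma convDl : left_distributive conv +%R.
Proof. by move=> f g h; have := linear_convl h 1 f g; rewrite !scale1r. Qed.

Lemma convDr : right_distributive conv +%R.
Proof. by move=> h f g; have := linear_convr h 1 f g; rewrite !scale1r. Qed.

Lemma dual_one_neq0 : dual_one != 0.
Proof.
apply/eqP=> E; have := dual_oneE 1; rewrite E zero_lfunE counit1 => /eqP.
by rewrite eq_sym oner_eq0.
Qed.

HB.instance Definition _ := GRing.Zmodule_isNzRing.Build (dualv H)
  convA conv1r convr1 convDl convDr dual_one_neq0.

Fact convZl c f g : c *: (f * g) = (c *: f) * g.
Proof. exact: esym (linfZ c f (linear_convl g)). Qed.

Fact convZr c f g : c *: (f * g) = f * (c *: g).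
Proof. exact: esym (linfZ c g (linear_convr f)). Qed.

HB.instance Definition _ := GRing.Lmodule_isLalgebra.Build k (dualv H) convZl.
HB.instance Definition _ := GRing.Lalgebra_isAlgebra.Build k (dualv H) convZr.
HB.instance Definition _ := Algebra_isFalgebra.Build k (dualv H).

Lemma dualM f g a : (f * g) a = \tsum_(x, y <- comul a) (f x * g y : k^o).
Proof. exact: convE. Qed.

Lemma dual1 a : (1 : dualv H) a = counit a.
Proof. exact: dual_oneE. Qed.

(* The comultiplication dual to the product; see dual_comulE. *)
Definition dual_comul f : tens (dualv H) (dualv H) :=
  \sum_i \sum_j f (bas i * bas j) *: (dual_bas i \ox dual_bas j).
Definition dual_counit f : k := f 1.
Definition dual_antipode f : dualv H := dual_of (fun a => f (antipode a)).

Fact dual_comul_is_linear : linear dual_comul.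
Proof.
move=> c f g; rewrite /dual_comul scaler_sumr -big_split; apply: eq_bigr => i _ /=.
rewrite scaler_sumr -big_split; apply: eq_bigr => j _ /=.
by rewrite dualD scalerDl -scalerA.
Qed.

Fact dual_counit_is_linear : scalar dual_counit.
Proof. by move=> c f g; rewrite /dual_counit dualD. Qed.

Lemma dual_antipodeE f a : dual_antipode f a = f (antipode a).
Proof.
by apply: (dual_ofE _ a); apply: (linear_comp (linear_dual f)); apply: linearP.
Qed.

Fact dual_antipode_is_linear : linear dual_antipode.
Proof.
by move=> c f g; apply: dual_ext => a; rewrite dualD !dual_antipodeE dualD.
Qed.

HB.instance Definition _ := GRing.isLinear.Build k _ _ _ dual_comul dual_comul_is_linear.
HB.instance Definition _ := GRing.isLinear.Build k _ k *%R dual_counit dual_counit_is_linear.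
HB.instance Definition _ := GRing.isLinear.Build k _ _ _ dual_antipode dual_antipode_is_linear.

Definition shl a f : dualv H := dual_of (fun b => f (a * b)).

Lemma shlE a f b : shl a f b = f (a * b).
Proof.
by apply: (dual_ofE _ b); apply: (linear_comp (linear_dual f) (linear_mull a)).
Qed.

Lemma dual_comul_contract (W : lmodType k) (F : dualv H -> W) f a : linear F ->
  \tsum_(g, h <- dual_comul f) ((g : dualv H) a *: F h) = F (shl a f).
Proof.
move=> lF.
have bF : bilin (fun g h => (g : dualv H) a *: F h).
  split=> [h c g g'|g c h h']; first by rewrite dualD scalerDl scalerA.
  by rewrite lF scalerDr !scalerA mulrC.
have -> : shl a f = \sum_j f (a * bas j) *: dual_bas j.
  by rewrite [LHS]dual_sum; apply: eq_bigr => j _; rewrite shlE.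
rewrite (linf_sum lF).
transitivity (\sum_i \sum_j f (bas i * bas j) *: (dual_bas i a *: F (dual_bas j))).
  rewrite /dual_comul (linf_sum (linear_tlift _)); apply: eq_bigr => i _.
  rewrite (linf_sum (linear_tlift _)); apply: eq_bigr => j _.
  by rewrite (linfZ _ _ (linear_tlift _)) tliftE.
rewrite exchange_big; apply: eq_bigr => j _ /=.
rewrite (linfZ _ _ lF) [a in RHS]bas_sum mulr_suml (linf_sum (linear_dual f)).
rewrite scaler_suml; apply: eq_bigr => i _.
by rewrite -scalerAl (linfZ _ _ (linear_dual f)) dual_basE scalerA mulrC.
Qed.

Lemma dual_comulE f a b :
  \tsum_(g, h <- dual_comul f) ((g : dualv H) a * (h : dualv H) b : k^o) = f (a * b).
Proof. by rewrite (dual_comul_contract _ _ (linear_eval b)) shlE. Qed.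

Lemma linear_contract (U V : vectType k) (u : U) :
  linear (fun t : tens (dualv U) V => \tsum_(f, v <- t) ((f : dualv U) u *: v)).
Proof. exact: linear_tlift. Qed.

Lemma linear_purel (U V : vectType k) (v : V) : linear (fun u : U => u \ox v).
Proof. exact: (bilin_pure U V).1. Qed.

Lemma linear_purer (U V : vectType k) (u : U) : linear (fun v : V => u \ox v).
Proof. exact: (bilin_pure U V).2. Qed.

Lemma dual_comul_shl f a :
  \tsum_(x, y <- dual_comul f) (shl a x \ox y) = dual_comul (shl a f).
Proof.
apply: tens_sep => b; rewrite (tlift_lin _ _ (linear_contract b)).
rewrite (dual_comul_contract _ _ (fun _ _ _ => erefl)).
transitivity (\tsum_(x, y <- dual_comul f) ((x : dualv H) (a * b) *: y)).
  by apply: eq_tlift => x y; rewrite tliftE ?shlE //; apply: bilin_contract.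
rewrite (dual_comul_contract _ _ (fun _ _ _ => erefl)).
by apply: dual_ext => c; rewrite !shlE mulrA.
Qed.

Fact dual_coassoc f :
  \tsum_(x, y <- dual_comul f) \tsum_(x1, x2 <- dual_comul x) (x1 \ox (x2 \ox y))
  = \tsum_(x, y <- dual_comul f) (x \ox dual_comul y).
Proof.
apply: tens_sep => a; rewrite !(tlift_lin _ _ (linear_contract a)).
transitivity (dual_comul (shl a f)); last first.
  rewrite -(dual_comul_contract _ _ dual_comul_is_linear).
  by apply: eq_tlift => x y; rewrite tliftE //; apply: bilin_contract.
rewrite -dual_comul_shl; apply: eq_tlift => x y.
rewrite (tlift_lin _ _ (linear_contract a)).
rewrite -(dual_comul_contract _ _ (linear_purel y)).
by apply: eq_tlift => x1 x2; rewrite tliftE //; apply: bilin_contract.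
Qed.

Fact dual_counitl f : \tsum_(x, y <- dual_comul f) (dual_counit x *: y) = f.
Proof.
rewrite (dual_comul_contract _ _ (fun _ _ _ => erefl)).
by apply: dual_ext => a; rewrite shlE mul1r.
Qed.

Fact dual_counitr f : \tsum_(x, y <- dual_comul f) (dual_counit y *: x) = f.
Proof.
apply: dual_ext => a; rewrite (tlift_lin _ _ (linear_eval a)).
rewrite -[a in RHS]mulr1 -dual_comulE; apply: eq_tlift => x y.
by rewrite scale_lfunE; apply: mulrC.
Qed.

Fact dual_comul_morphism : monoid_morphism dual_comul.
Proof.
split=> [|f g].
  apply: tens_sep => a; rewrite (dual_comul_contract _ _ (fun _ _ _ => erefl)).
  rewrite -pure11 tliftE; last exact: bilin_contract.
  by apply: dual_ext => b; rewrite shlE scale_lfunE !dual1 counitM.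
apply: tens_sep => a; rewrite (dual_comul_contract _ _ (fun _ _ _ => erefl)).
transitivity (\tsum_(x, y <- comul a) (shl x f * shl y g)).
  apply: dual_ext => b; rewrite shlE dualM comulME; last exact: bilin_conv.
  rewrite (tlift_lin _ _ (linear_eval b)); apply: eq_tlift => x y.
  by rewrite dualM; apply: eq_tlift => u v; rewrite !shlE.
rewrite tmulE (tlift_lin _ _ (linear_contract a)).
transitivity (\tsum_(x, y <- comul a) \tsum_(f1, f2 <- dual_comul f)
   \tsum_(g1, g2 <- dual_comul g)
     (((f1 : dualv H) x * (g1 : dualv H) y) *: (f2 * g2))).
  apply: eq_tlift => x y.
  rewrite -[LHS](dual_comul_contract _ _ (linear_mulr (shl y g))).
  apply: eq_tlift => f1 f2.
  rewrite -[f2 * _](dual_comul_contract _ _ (linear_mull f2)).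
  rewrite (tlift_lin _ _ (scale_linear _)).
  by apply: eq_tlift => g1 g2; rewrite scalerA.
rewrite tlift_exch; apply: eq_tlift => f1 f2.
rewrite tlift_exch (tlift_lin _ _ (linear_contract a)); apply: eq_tlift => g1 g2.
rewrite tliftE; last exact: bilin_contract.
by rewrite dualM (tlift_lin _ _ (scale_linearl _)).
Qed.

Fact dual_counit_morphism : monoid_morphism dual_counit.
Proof.
split=> [|f g]; first by rewrite /dual_counit dual1 counit1.
by rewrite /dual_counit dualM comul1 -pure11 tliftE //; apply: bilin_conv.
Qed.

Fact dual_antipodel f :
  \tsum_(x, y <- dual_comul f) (dual_antipode x * y) = (dual_counit f)%:A.
Proof.
apply: dual_ext => a; rewrite (tlift_lin _ _ (linear_eval a)).
transitivity (\tsum_(x, y <- comul a) (f (antipode x * y) : k^o)); last first.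
  rewrite -(tlift_lin _ _ (linear_dual f)) antipodel (linfZ _ _ (linear_dual f)).
  by rewrite scale_lfunE dual1; apply: mulrC.
transitivity (\tsum_(g, h <- dual_comul f) \tsum_(x, y <- comul a)
    ((g : dualv H) (antipode x) * (h : dualv H) y : k^o)).
  apply: eq_tlift => g h; rewrite dualM; apply: eq_tlift => x y.
  by rewrite dual_antipodeE.
by rewrite tlift_exch; apply: eq_tlift => x y; rewrite dual_comulE.
Qed.

Fact dual_antipoder f :
  \tsum_(x, y <- dual_comul f) (x * dual_antipode y) = (dual_counit f)%:A.
Proof.
apply: dual_ext => a; rewrite (tlift_lin _ _ (linear_eval a)).
transitivity (\tsum_(x, y <- comul a) (f (x * antipode y) : k^o)); last first.
  rewrite -(tlift_lin _ _ (linear_dual f)) antipoder (linfZ _ _ (linear_dual f)).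
  by rewrite scale_lfunE dual1; apply: mulrC.
transitivity (\tsum_(g, h <- dual_comul f) \tsum_(x, y <- comul a)
    ((g : dualv H) x * (h : dualv H) (antipode y) : k^o)).
  apply: eq_tlift => g h; rewrite dualM; apply: eq_tlift => x y.
  by rewrite dual_antipodeE.
by rewrite tlift_exch; apply: eq_tlift => x y; rewrite dual_comulE.
Qed.


HB.instance Definition _ := isHopf.Build k (dualv H) dual_coassoc dual_counitl
  dual_counitr dual_comul_morphism dual_counit_morphism dual_antipodel dual_antipoder.

End DualHopf.

Section Antipode.
Variables (k : fieldType) (H : hopfType k).
Implicit Types a b : H.

Lemma linear_antipode : linear (@antipode k H). Proof. exact: linearP. Qed.

Lemma linear_counitZ (W : lmodType k) (w : W) : linear (fun a => counit a *: w).
Proof. by move=> c x y; rewrite linearP scalerDl scalerA. Qed.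

(* Both sides equal \sum S(a1 b1) (a2 b2) (S(b3) S(a3)). *)
Lemma antipodeM a b : antipode (a * b) = antipode b * antipode a.
Proof.
pose T x1 u1 x2 u2 x3 u3 : H :=
  antipode (x1 * u1) * (x2 * u2) * (antipode u3 * antipode x3).
have lT1 u1 x2 u2 x3 u3 : linear (fun x1 => T x1 u1 x2 u2 x3 u3).
  by move=> c z z'; rewrite /T mulrDl -scalerAl linearP !mulrDl -!scalerAl.
have lT2 x1 x2 u2 x3 u3 : linear (fun u1 => T x1 u1 x2 u2 x3 u3).
  by move=> c z z'; rewrite /T mulrDr -scalerAr linearP !mulrDl -!scalerAl.
have lT3 x1 u1 u2 x3 u3 : linear (fun x2 => T x1 u1 x2 u2 x3 u3).
  by move=> c z z'; rewrite /T mulrDl -scalerAl mulrDr -scalerAr mulrDl -scalerAl.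
have lT4 x1 u1 x2 x3 u3 : linear (fun u2 => T x1 u1 x2 u2 x3 u3).
  by move=> c z z'; rewrite /T !mulrDr -!scalerAr mulrDl -scalerAl.
have lT5 x1 u1 x2 u2 u3 : linear (fun x3 => T x1 u1 x2 u2 x3 u3).
  by move=> c z z'; rewrite /T linearP !mulrDr -!scalerAr.
have lT6 x1 u1 x2 u2 x3 : linear (fun u3 => T x1 u1 x2 u2 x3 u3).
  by move=> c z z'; rewrite /T linearP mulrDl mulrDr -scalerAl -scalerAr.
transitivity (\tsum_(x, y <- comul a) \tsum_(y1, y2 <- comul y)
    \tsum_(u, v <- comul b) \tsum_(v1, v2 <- comul v) T x u y1 v1 y2 v2).
  rewrite -[LHS](counitrE a (F := fun x => antipode (x * b))); last first.
    by move=> c x x'; rewrite mulrDl -scalerAl linearP.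
  apply: eq_tlift => x y; rewrite tlift_exch.
  rewrite -[antipode _](counitrE b (F := fun u => antipode (x * u))); last first.
    by move=> c u u'; rewrite mulrDr -scalerAr linearP.
  rewrite (tlift_lin _ _ (scale_linear _)); apply: eq_tlift => u v.
  transitivity (\tsum_(y1, y2 <- comul y)
      (antipode (x * u) * (y1 * (counit v)%:A * antipode y2))).
    under eq_tlift => y1 y2 do rewrite mulr_algr -scalerAl -scalerAr.
    rewrite -(tlift_lin _ _ (scale_linear _)) -(tlift_lin _ _ (linear_mull _)).
    by rewrite antipoder mulr_algr !scalerA mulrC.
  apply: eq_tlift => y1 y2; rewrite -antipoder.
  rewrite (tlift_lin _ _ (linear_mull _)) (tlift_lin _ _ (linear_mulr _)).
  rewrite (tlift_lin _ _ (linear_mull _)).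
  by apply: eq_tlift => v1 v2; rewrite /T !mulrA.
rewrite -(comul_coassocE (F := fun x y1 y2 =>
    \tsum_(u, v <- comul b) \tsum_(v1, v2 <- comul v) T x u y1 v1 y2 v2));
  try by move=> ? ?; do 2![apply: linear_in_tlift => ? ?].
transitivity (\tsum_(x, y <- comul a) (counit x *: (antipode b * antipode y))).
  apply: eq_tlift => x y.
  transitivity (\tsum_(u, v <- comul b) (counit (x * u) *: (antipode v * antipode y))).
    under eq_tlift => x1 x2 do rewrite -comul_coassocE //.
    rewrite tlift_exch; apply: eq_tlift => u v.
    rewrite -mulr_algl -antipodel comulME; last first.
      split=> [q c p p'|p c q q']; first by rewrite linearP mulrDl -scalerAl.
      by rewrite mulrDr -scalerAr.
    rewrite (tlift_lin _ _ (linear_mulr _)); apply: eq_tlift => x1 x2.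
    by rewrite (tlift_lin _ _ (linear_mulr _)).
  under eq_tlift => u v do rewrite counitM -scalerA.
  rewrite -(tlift_lin _ _ (scale_linear _)); congr (_ *: _).
  rewrite (counitlE (F := fun v => antipode v * antipode y)) //.
  by move=> c v v'; rewrite linearP mulrDl -scalerAl.
rewrite (counitlE (F := fun y => antipode b * antipode y)) //.
by move=> c v v'; rewrite linearP mulrDr -scalerAr.
Qed.
End Antipode.

Section HopfSubalgebra.
Variable k : fieldType.

Definition tensv (U V : vectType k) (P : {vspace U}) (Q : {vspace V}) :
  {vspace tens U V} := <<[seq x \ox y | x <- vbasis P, y <- vbasis Q]>>%VS.

Lemma tensv_ext (U V : vectType k) (P : {vspace U}) (Q : {vspace V})
    (Z : lmodType k) (f g : tens U V -> Z) :
  linear f -> linear g -> {in P & Q, forall u v, f (u \ox v) = g (u \ox v)} ->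
  {in tensv P Q, f =1 g}.
Proof.
move=> lf lg E t; rewrite /tensv; set s := [seq _ | x <- _, y <- _].
move=> /(coord_span (X := in_tuple s)) ->; rewrite !linf_sum //.
apply: eq_bigr => i _; rewrite !linfZ //; congr (_ *: _).
have /allpairsP[[u v] /= [uP vQ ->]] : s`_i \in s by rewrite mem_nth.
by apply: E; rewrite vbasis_mem.
Qed.

Lemma tensv_pure (U V : vectType k) (P : {vspace U}) (Q : {vspace V}) :
  {in P & Q, forall u v, u \ox v \in tensv P Q}.
Proof.
move=> u v /coord_vbasis-> /coord_vbasis->.
rewrite (linf_sum ((bilin_pure _ _).1 _)); apply: memv_suml => i _.
rewrite (linf_sum ((bilin_pure _ _).2 _)); apply: memv_suml => j _.
rewrite (linfZ _ _ ((bilin_pure _ _).1 _)) (linfZ _ _ ((bilin_pure _ _).2 _)).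
rewrite !memvZ // memv_span //; apply/allpairsP.
by exists ((vbasis P)`_i, (vbasis Q)`_j); rewrite !memt_nth.
Qed.

Record hopfsub (H : hopfType k) := HopfSub {
  hopfsub_aspace :> {aspace H};
  hopfsub1 : 1 \in hopfsub_aspace;
  hopfsub_comul : {in hopfsub_aspace, forall a,
    comul a \in tensv hopfsub_aspace hopfsub_aspace};
  hopfsub_antipode : {in hopfsub_aspace, forall a, antipode a \in hopfsub_aspace}
}.

Section Instance.
Variables (H : hopfType k) (P : hopfsub H).

Definition hsub : Type := subvs_of P.
HB.instance Definition _ := Falgebra.copy hsub (subvs_of P).
Definition hval (x : hsub) : H := vsval x.
Definition hproj (a : H) : hsub := vsproj P a.

Lemma linear_hval : linear hval. Proof. by []. Qed.
Lemma linear_hproj : linear hproj. Proof. exact: linearP. Qed.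
Lemma hvalK : cancel hval hproj. Proof. exact: vsvalK. Qed.
Lemma hprojK : {in P, cancel hproj hval}. Proof. exact: vsprojK. Qed.
Lemma hval_inj : injective hval. Proof. exact: subvs_inj. Qed.
Lemma hvalP x : hval x \in P. Proof. exact: subvsP. Qed.
Lemma hvalM x y : hval (x * y) = hval x * hval y. Proof. by []. Qed.
Lemma hval1 : hval 1 = 1.
Proof. by apply/eqP; rewrite /hval /= algid_eq1 hopfsub1. Qed.

Definition sub_comul (x : hsub) : tens hsub hsub :=
  \tsum_(a, b <- comul (hval x)) (hproj a \ox hproj b).
Definition sub_counit (x : hsub) : k := counit (hval x).
Definition sub_antipode (x : hsub) : hsub := hproj (antipode (hval x)).

Fact sub_comul_is_linear : linear sub_comul.
Proof.
exact: linear_comp (linear_tlift _) (linear_comp (@linear_comul k H) linear_hval).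
Qed.
Fact sub_counit_is_linear : scalar sub_counit.
Proof. by move=> c x y; rewrite /sub_counit linear_hval linearP. Qed.
Fact sub_antipode_is_linear : linear sub_antipode.
Proof.
exact: linear_comp linear_hproj (linear_comp (@linear_antipode k H) linear_hval).
Qed.

HB.instance Definition _ := GRing.isLinear.Build k _ _ _ sub_comul sub_comul_is_linear.
HB.instance Definition _ := GRing.isLinear.Build k _ k *%R sub_counit sub_counit_is_linear.
HB.instance Definition _ := GRing.isLinear.Build k _ _ _ sub_antipode sub_antipode_is_linear.

Lemma hval_antipode x : hval (sub_antipode x) = antipode (hval x).
Proof. by rewrite hprojK // hopfsub_antipode ?hvalP. Qed.

Lemma sub_comulE (W : lmodType k) (F : hsub -> hsub -> W) x : bilin F ->
  \tsum_(y, z <- sub_comul x) F y z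
  = \tsum_(a, b <- comul (hval x)) F (hproj a) (hproj b).
Proof.
move=> bF; rewrite (tlift_lin _ _ (linear_tlift _)).
by apply: eq_tlift => a b; rewrite tliftE.
Qed.

Lemma comul_proj (W : lmodType k) (F : H -> H -> W) a : bilin F -> a \in P ->
  \tsum_(x, y <- comul a) F (hval (hproj x)) (hval (hproj y))
  = \tsum_(x, y <- comul a) F x y.
Proof.
move=> bF aP; have [F1 F2] := bF.
apply: (tensv_ext (f := tlift _) (g := tlift _)) (hopfsub_comul aP).
- exact: linear_tlift.
- exact: linear_tlift.
move=> x y xP yP; rewrite !tliftE ?hprojK //.
split=> [v|u]; first exact: linear_comp (F1 _) (linear_comp linear_hval linear_hproj).
exact: linear_comp (F2 _) (linear_comp linear_hval linear_hproj).
Qed.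

Lemma sub_comul_val (W : lmodType k) (F : H -> H -> W) x : bilin F ->
  \tsum_(y, z <- sub_comul x) F (hval y) (hval z) = \tsum_(a, b <- comul (hval x)) F a b.
Proof.
move=> bF; rewrite sub_comulE ?comul_proj ?hvalP //.
by split=> [v|u]; [apply: linear_comp (bF.1 _) linear_hval
                 | apply: linear_comp (bF.2 _) linear_hval].
Qed.

Fact sub_coassoc a :
  \tsum_(x, y <- sub_comul a) \tsum_(x1, x2 <- sub_comul x) (x1 \ox (x2 \ox y))
  = \tsum_(x, y <- sub_comul a) (x \ox sub_comul y).
Proof.
pose F x1 x2 y : tens hsub (tens hsub hsub) := hproj x1 \ox (hproj x2 \ox hproj y).
have F1 x2 y : linear (fun x1 => F x1 x2 y).
  exact: linear_comp (linear_purel _) linear_hproj.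
have F2 x1 y : linear (fun x2 => F x1 x2 y).
  by move=> c z z'; rewrite /F linear_hproj pureDl pureDr.
have F3 x1 x2 : linear (fun y => F x1 x2 y).
  by move=> c z z'; rewrite /F linear_hproj !pureDr.
transitivity (\tsum_(x, y <- comul (hval a)) \tsum_(x1, x2 <- comul x) F x1 x2 y).
  rewrite -[RHS]sub_comul_val; last first.
    split=> [y|x]; first exact: linear_comp (linear_tlift _) (@linear_comul k H).
    by apply: linear_in_tlift => x1 x2; apply: F3.
  apply: eq_tlift => x y; rewrite sub_comulE.
    by apply: eq_tlift => x1 x2; rewrite /F hvalK.
  by split=> [x2 c z z'|x1 c z z']; rewrite pureDl ?pureDr.
rewrite comul_coassocE // -[LHS]sub_comul_val; last first.
  split=> [y|x]; first by apply: linear_in_tlift => x1 x2; apply: F1.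
  exact: linear_comp (linear_tlift _) (@linear_comul k H).
apply: eq_tlift => x y; rewrite (tlift_lin _ _ (linear_purer x)).
by apply: eq_tlift => y1 y2; rewrite /F hvalK.
Qed.

Lemma bilinl (F : H -> k) : linear (F : H -> k^o) -> bilin (fun x y : H => F x *: y).
Proof.
move=> lF; split=> [y c x x'|x c y y']; first by rewrite lF scalerDl -scalerA.
by rewrite scalerDr !scalerA mulrC.
Qed.

Lemma bilinr (F : H -> k) : linear (F : H -> k^o) -> bilin (fun x y : H => F y *: x).
Proof. by move=> /bilinl[]; split. Qed.

Fact sub_counitl a : \tsum_(x, y <- sub_comul a) (sub_counit x *: y) = a.
Proof.
apply: hval_inj; rewrite (tlift_lin _ _ linear_hval) -[RHS]counitl.
rewrite -(sub_comul_val (F := fun x y : H => counit x *: y)).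
  by apply: eq_tlift.
by apply: bilinl; apply: linearP.
Qed.

Fact sub_counitr a : \tsum_(x, y <- sub_comul a) (sub_counit y *: x) = a.
Proof.
apply: hval_inj; rewrite (tlift_lin _ _ linear_hval) -[RHS]counitr.
rewrite -(sub_comul_val (F := fun x y : H => counit y *: x)).
  by apply: eq_tlift.
by apply: bilinr; apply: linearP.
Qed.

Lemma hproj1 : hproj 1 = 1. Proof. by rewrite -hval1 hvalK. Qed.

Fact sub_comul_morphism : monoid_morphism sub_comul.
Proof.
split=> [|a b].
  rewrite /sub_comul hval1 comul1 -pure11 tliftE ?hproj1 //.
  split=> [v|u]; first exact: linear_comp (linear_purel _) linear_hproj.
  exact: linear_comp (linear_purer _) linear_hproj.
have bF : bilin (fun x y : H => hproj x \ox hproj y).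
  split=> [v|u]; first exact: linear_comp (linear_purel _) linear_hproj.
  exact: linear_comp (linear_purer _) linear_hproj.
rewrite {1}/sub_comul hvalM comulME // tmulE.
pose F (x y u v : H) : tens hsub hsub := hproj (x * u) \ox hproj (y * v).
rewrite -(sub_comul_val (F := fun x y => \tsum_(u, v <- comul (hval b)) F x y u v)).
  apply: eq_tlift => x y.
  rewrite -(sub_comul_val (F := fun u v => F (hval x) (hval y) u v)).
    by apply: eq_tlift => u v; rewrite /F -!hvalM !hvalK.
  by split=> z; rewrite /F; [apply: linear_comp (bF.1 _) (linear_mull _)
                            | apply: linear_comp (bF.2 _) (linear_mull _)].
by split=> z; apply: linear_in_tlift => u v; rewrite /F;
  [apply: linear_comp (bF.1 _) (linear_mulr _)
  | apply: linear_comp (bF.2 _) (linear_mulr _)].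
Qed.

Fact sub_counit_morphism : monoid_morphism sub_counit.
Proof.
by split=> [|a b]; rewrite /sub_counit ?hval1 ?counit1 // hvalM counitM.
Qed.

Fact sub_antipodel a :
  \tsum_(x, y <- sub_comul a) (sub_antipode x * y) = (sub_counit a)%:A.
Proof.
apply: hval_inj; rewrite (tlift_lin _ _ linear_hval) (linfZ _ _ linear_hval) hval1.
rewrite -antipodel -(sub_comul_val (F := fun x y : H => antipode x * y)).
  by apply: eq_tlift => x y; rewrite hvalM hval_antipode.
split=> [y|x]; last exact: linear_mull.
exact: linear_comp (linear_mulr _) (@linear_antipode k H).
Qed.

Fact sub_antipoder a :
  \tsum_(x, y <- sub_comul a) (x * sub_antipode y) = (sub_counit a)%:A.
Proof.
apply: hval_inj; rewrite (tlift_lin _ _ linear_hval) (linfZ _ _ linear_hval) hval1.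
rewrite -antipoder -(sub_comul_val (F := fun x y : H => x * antipode y)).
  by apply: eq_tlift => x y; rewrite hvalM hval_antipode.
split=> [y|x]; first exact: linear_mulr.
exact: linear_comp (linear_mull _) (@linear_antipode k H).
Qed.

HB.instance Definition _ := isHopf.Build k hsub sub_coassoc sub_counitl
  sub_counitr sub_comul_morphism sub_counit_morphism sub_antipodel sub_antipoder.

End Instance.
End HopfSubalgebra.

Section HopfGenerated.
Variables (k : fieldType) (H : hopfType k).
Implicit Types P Q : hopfsub H.

Lemma full_hopfsub_proof : [/\ 1 \in {:H}%AS,
  {in {:H}%AS, forall a, comul a \in tensv {:H}%AS {:H}%AS} &
  {in {:H}%AS, forall a : H, antipode a \in {:H}%AS}].
Proof.
split=> [|a _|a _]; rewrite ?memvf //.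
rewrite -[comul a]tens_sum; apply: rpred_sum => i _; apply: rpred_sum => j _.
by rewrite rpredZ // tensv_pure ?memvf.
Qed.

Definition full_hopfsub : hopfsub H :=
  let: And3 h1 h2 h3 := full_hopfsub_proof in HopfSub h1 h2 h3.

Lemma mem_full_hopfsub a : a \in full_hopfsub.
Proof. by rewrite /full_hopfsub; case: full_hopfsub_proof => *; apply: memvf. Qed.

Lemma linear_v2r (U : vectType k) i : linear (fun u : U => v2r u 0 i : k^o).
Proof. by move=> c x y; rewrite linearP !mxE. Qed.

Lemma tens_basl (U V : vectType k) (t : tens U V) :
  t = \sum_i (bas i \ox \tsum_(x, y <- t) (v2r x 0 i *: y)).
Proof.
move: t; apply: (@tens_ext _ _ _ _ id
  (fun t => \sum_i (bas i \ox \tsum_(x, y <- t) (v2r x 0 i *: y)))) => //.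
  move=> c s' t'; rewrite scaler_sumr -big_split; apply: eq_bigr => i _ /=.
  by rewrite -pureDr linear_tlift.
move=> u v; rewrite [u in LHS]bas_sum (linf_sum (linear_purel v)).
apply: eq_bigr => i _; rewrite tliftE.
  by rewrite (linfZ _ _ (linear_purel v)) (linfZ _ _ (linear_purer _)).
split=> [y c x x'|x c y y']; first by rewrite linear_v2r scalerDl -scalerA.
by rewrite scalerDr !scalerA mulrC.
Qed.

Lemma tens_basr (U V : vectType k) (t : tens U V) :
  t = \sum_i ((\tsum_(x, y <- t) (v2r y 0 i *: x)) \ox bas i).
Proof.
move: t; apply: (@tens_ext _ _ _ _ id
  (fun t => \sum_i ((\tsum_(x, y <- t) (v2r y 0 i *: x)) \ox bas i))) => //.
  move=> c s' t'; rewrite scaler_sumr -big_split; apply: eq_bigr => i _ /=.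
  by rewrite -pureDl linear_tlift.
move=> u v; rewrite [v in LHS]bas_sum (linf_sum (linear_purer u)).
apply: eq_bigr => i _; rewrite tliftE.
  by rewrite (linfZ _ _ (linear_purel _)) (linfZ _ _ (linear_purer _)).
split=> [y c x x'|x c y y']; last by rewrite linear_v2r scalerDl -scalerA.
by rewrite scalerDr !scalerA mulrC.
Qed.

Lemma tensv_contractl (U V : vectType k) (P : {vspace U}) (Q : {vspace V})
    (t : tens U V) (F : U -> k) :
  linear (F : U -> k^o) -> t \in tensv P Q -> \tsum_(x, y <- t) (F x *: y) \in Q.
Proof.
move=> lF tP; set w := tlift _ t; suff -> : w = projv Q w by apply: memv_proj.
apply: (tensv_ext (f := tlift _) (g := fun t => projv Q (tlift _ t))) tP.
- exact: linear_tlift.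
- by apply: linear_comp (linear_tlift _); apply: linearP.
move=> u v uP vQ; rewrite tliftE ?linearZ /= ?projv_id //.
split=> [y c x x'|x c y y']; first by rewrite lF scalerDl -scalerA.
by rewrite scalerDr !scalerA mulrC.
Qed.

Lemma tensv_contractr (U V : vectType k) (P : {vspace U}) (Q : {vspace V})
    (t : tens U V) (F : V -> k) :
  linear (F : V -> k^o) -> t \in tensv P Q -> \tsum_(x, y <- t) (F y *: x) \in P.
Proof.
move=> lF tP; set w := tlift _ t; suff -> : w = projv P w by apply: memv_proj.
apply: (tensv_ext (f := tlift _) (g := fun t => projv P (tlift _ t))) tP.
- exact: linear_tlift.
- by apply: linear_comp (linear_tlift _); apply: linearP.
move=> u v uP vQ; rewrite tliftE ?linearZ /= ?projv_id //.
split=> [y c x x'|x c y y']; last by rewrite lF scalerDl -scalerA.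
by rewrite scalerDr !scalerA mulrC.
Qed.

Lemma tensv_cap (U V : vectType k) (P P' : {vspace U}) (Q Q' : {vspace V}) t :
  t \in tensv P Q -> t \in tensv P' Q' -> t \in tensv (P :&: P') (Q :&: Q').
Proof.
move=> tP tP'; set R := (P :&: P')%VS; set S := (Q :&: Q')%VS.
have tl : t = \tsum_(x, y <- t) (projv R x \ox y).
  rewrite [t in LHS]tens_basr [t in RHS]tens_basr (linf_sum (linear_tlift _)).
  apply: eq_bigr => i _; rewrite tliftE.
    rewrite projv_id // memv_cap.
    by rewrite !(tensv_contractr (linear_v2r i) tP, tensv_contractr (linear_v2r i) tP').
  by split=> [y c x x'|x c y y']; rewrite ?linearP ?pureDl ?pureDr.
have tr : t = \tsum_(x, y <- t) (x \ox projv S y).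
  rewrite [t in LHS]tens_basl [t in RHS]tens_basl (linf_sum (linear_tlift _)).
  apply: eq_bigr => i _; rewrite tliftE.
    rewrite projv_id // memv_cap.
    by rewrite !(tensv_contractl (linear_v2r i) tP, tensv_contractl (linear_v2r i) tP').
  by split=> [y c x x'|x c y y']; rewrite ?linearP ?pureDl ?pureDr.
rewrite tl tr (tlift_lin _ _ (linear_tlift _)); apply: rpred_sum => i _.
apply: rpred_sum => j _; rewrite rpredZ // tliftE.
  by rewrite tensv_pure ?memv_proj.
by split=> [y c x x'|x c y y']; rewrite ?linearP ?pureDl ?pureDr.
Qed.

Lemma cap_hopfsub_proof P Q : exists R : hopfsub H, (R : {vspace H}) = (P :&: Q)%VS.
Proof.
have PQ1 : algid P \in Q.
  have P1 : algid P = 1 by apply/eqP; rewrite algid_eq1 hopfsub1.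
  by rewrite P1 hopfsub1.
have h1 : 1 \in (aspace_cap PQ1 : {aspace H}) by rewrite memv_cap !hopfsub1.
have h2 : {in (aspace_cap PQ1 : {aspace H}), forall a,
    comul a \in tensv (aspace_cap PQ1) (aspace_cap PQ1)}.
  by move=> a; rewrite memv_cap => /andP[aP aQ]; apply: tensv_cap; apply: hopfsub_comul.
have h3 : {in (aspace_cap PQ1 : {aspace H}), forall a, antipode a \in aspace_cap PQ1}.
  by move=> a; rewrite !memv_cap => /andP[aP aQ]; rewrite !hopfsub_antipode.
by exists (HopfSub h1 h2 h3).
Qed.

(* P is the smallest Hopf subalgebra containing all the subspaces in X. *)
Definition hopf_generated (X : {vspace H} -> Prop) P :=
  (forall U, X U -> (U <= P)%VS) /\
  (forall Q, (forall U, X U -> (U <= Q)%VS) -> (P <= Q)%VS).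

Lemma hopf_generated_exists X : exists P, hopf_generated X P.
Proof.
pose good P := forall U, X U -> (U <= P)%VS.
suff [P [gP minP]] : exists P, good P /\ forall Q, good Q -> (\dim P <= \dim Q)%N.
  exists P; split=> // Q gQ; have [R ER] := cap_hopfsub_proof P Q.
  have gR : good R by move=> U XU; rewrite ER subv_cap gP ?gQ.
  have := minP R gR; rewrite ER.
  by move=> le_d; apply/capv_idPl/eqP; rewrite eqEdim capvSl.
have good_full : good full_hopfsub.
  by move=> U _; apply/subvP=> a _; apply: mem_full_hopfsub.
have ex : exists n, boolp.asbool (exists2 P, good P & \dim P = n).
  by exists (\dim full_hopfsub); apply/boolp.asboolP; exists full_hopfsub.
case: (ex_minnP ex) => n /boolp.asboolP[P gP <-] minP.
by exists P; split=> // Q gQ; apply: minP; apply/boolp.asboolP; exists Q.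
Qed.

Definition hopf_gen X : hopfsub H := sval (boolp.cid (hopf_generated_exists X)).

Lemma hopf_genP X : hopf_generated X (hopf_gen X).
Proof. exact: svalP (boolp.cid (hopf_generated_exists X)). Qed.

End HopfGenerated.

Record repn (k : fieldType) (A : falgType k) := Repn {
  repn_sort :> vectType k;
  act : A -> repn_sort -> repn_sort;
  act_linl : forall m, linear (act^~ m);
  act_linr : forall a, linear (act a);
  act1m : forall m, act 1 m = m;
  actMm : forall a b m, act (a * b) m = act a (act b m)
}.
Arguments act {k A r} a m.

Section Representations.
Variables (k : fieldType) (A : falgType k).
Implicit Types M N : repn A.

Definition stable M (U : {vspace M}) := forall a, {in U, forall m, act a m \in U}.

Definition irreducible M :=
  {:M}%VS != 0%VS /\
  forall U : {vspace M}, stable U -> U = 0%VS \/ U = {:M}%VS.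

Definition semisimple_alg := forall M (U : {vspace M}), stable U ->
  exists W : {vspace M}, [/\ stable W, (U + W = {:M})%VS & (U :&: W = 0)%VS].

Definition repn_iso M N := exists f : M -> N,
  [/\ linear f, bijective f & forall a m, f (act a m) = act a (f m)].

Definition character M : dualv A := dual_of (fun a =>
  \sum_i coord (vbasis {:M}) i (act a (vbasis {:M})`_i)).

Definition irr_char (chi : dualv A) := exists2 M, irreducible M & chi = character M.

Definition mcoef M (f : dualv M) (m : M) : dualv A := dual_of (fun a => f (act a m)).

(* The subcoalgebra of A* spanned by the matrix coefficients of M; it is simple
   when M is irreducible. *)
Definition coef_space M : {vspace dualv A} :=
  <<[seq mcoef f m | f <- vbasis {:dualv M}, m <- vbasis {:M}]>>%VS.

Definition central (a : A) := forall b, a * b = b * a.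

Definition central_idem (e : A) := central e /\ e * e = e.

Definition central_primitive_idem (e : A) :=
  [/\ central_idem e, e != 0 & forall f g, central_idem f -> central_idem g ->
      f * g = 0 -> f + g = e -> f = 0 \/ g = 0].

(* The central primitive idempotent attached to the irreducible character chi is
   the one that acts as the identity on the modules affording chi. *)
Definition central_idem_of (chi : dualv A) (e : A) :=
  central_primitive_idem e /\
  forall M, irreducible M -> character M = chi -> forall m : M, act e m = m.

Lemma characterE M a :
  character M a = \sum_i coord (vbasis {:M}) i (act a (vbasis {:M})`_i).
Proof.
apply: (dual_ofE _ a) => c x y; rewrite scaler_sumr -big_split.
by apply: eq_bigr => i _ /=; rewrite act_linl linearP.
Qed.

Lemma mcoefE M (f : dualv M) m a : mcoef f m a = f (act a m).
Proof.
by apply: (dual_ofE _ a); apply: linear_comp (linear_dual f) (act_linl m).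
Qed.

Fact dsum_linl M N (p : M * N) : linear (fun a => (act a p.1, act a p.2)).
Proof. by move=> c a b; congr (_, _); rewrite act_linl. Qed.

Fact dsum_linr M N a : linear (fun p : M * N => (act a p.1, act a p.2)).
Proof. by move=> c p q; congr (_, _); rewrite act_linr. Qed.

Fact dsum_act1 M N (p : M * N) : (act 1 p.1, act 1 p.2) = p.
Proof. by case: p => m n; rewrite !act1m. Qed.

Fact dsum_actM M N a b (p : M * N) :
  (act (a * b) p.1, act (a * b) p.2) = (act a (act b p.1), act a (act b p.2)).
Proof. by rewrite !actMm. Qed.

Definition dsum M N : repn A :=
  Repn (repn_sort := (M * N)%type) (@dsum_linl M N) (@dsum_linr M N)
    (@dsum_act1 M N) (@dsum_actM M N).

End Representations.

Section TensorReps.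
Variables (k : fieldType) (H : hopfType k).
Implicit Types M N : repn H.

Fact unit_linl (x : k^o) : linear (fun a : H => counit a *: x).
Proof. exact: linear_counitZ. Qed.

Fact unit_linr (a : H) : linear (fun x : k^o => counit a *: x).
Proof. exact: scale_linear. Qed.

Fact unit_act1 (x : k^o) : counit (1 : H) *: x = x.
Proof. by rewrite counit1 scale1r. Qed.

Fact unit_actM (a b : H) (x : k^o) : counit (a * b) *: x = counit a *: (counit b *: x).
Proof. by rewrite counitM scalerA. Qed.

Definition unit_repn : repn H :=
  Repn (repn_sort := k^o) unit_linl unit_linr unit_act1 unit_actM.

(* The action of H (x) H on M (x) N. *)
Definition tact M N (s : tens H H) (t : tens M N) : tens M N :=
  \tsum_(a, b <- s) \tsum_(m, n <- t) (act a m \ox act b n).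

Lemma bilin_act M N a b : bilin (fun (m : M) (n : N) => act (a : H) m \ox act (b : H) n).
Proof. by split=> [n c m m'|m c n n']; rewrite act_linr ?pureDl ?pureDr. Qed.

Lemma linear_tactl M N (t : tens M N) : linear (fun s => tact s t).
Proof. exact: linear_tlift. Qed.

Lemma linear_tactr M N s : linear (fun t : tens M N => tact s t).
Proof. by apply: linear_in_tlift => a b; apply: linear_tlift. Qed.

Lemma tact_pure M N a b (m : M) (n : N) :
  tact (a \ox b) (m \ox n) = act a m \ox act b n.
Proof.
rewrite /tact tliftE; first by rewrite tliftE //; apply: bilin_act.
by split=> [y c x x'|x c y y']; rewrite -tliftD; apply: eq_tlift => u v;
  rewrite act_linl ?pureDl ?pureDr.
Qed.

Lemma tact1 M N (t : tens M N) : tact 1 t = t.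
Proof.
move: t; apply: (@tens_ext _ _ _ _ (tact 1) id) => //; first exact: linear_tactr.
by move=> m n; rewrite -pure11 tact_pure !act1m.
Qed.

Lemma tactM M N s s' (t : tens M N) : tact (s * s') t = tact s (tact s' t).
Proof.
move: t; apply: (@tens_ext _ _ _ _ (tact (s * s')) (fun t => tact s (tact s' t))).
- exact: linear_tactr.
- exact: linear_comp (linear_tactr s) (linear_tactr s').
move=> m n; move: s; apply: (@tens_ext _ _ _ _ (fun s => tact (s * s') _)
  (fun s => tact s (tact s' _))).
- exact: linear_comp (linear_tactl _) (linear_mulr _).
- exact: linear_tactl.
move=> a b; move: s'; apply: (@tens_ext _ _ _ _ (fun s' => tact (_ * s') _)
  (fun s' => tact _ (tact s' _))).
- exact: linear_comp (linear_tactl _) (linear_mull _).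
- exact: linear_comp (linear_tactr _) (linear_tactl _).
by move=> a' b'; rewrite pureM !tact_pure !actMm.
Qed.

Fact tensor_linl M N (t : tens M N) : linear (fun a => tact (comul a) t).
Proof. exact: linear_comp (linear_tactl t) (@linear_comul k H). Qed.

Fact tensor_linr M N a : linear (fun t : tens M N => tact (comul a) t).
Proof. exact: linear_tactr. Qed.

Fact tensor_act1 M N (t : tens M N) : tact (comul 1) t = t.
Proof. by rewrite comul1 tact1. Qed.

Fact tensor_actM M N a b (t : tens M N) :
  tact (comul (a * b)) t = tact (comul a) (tact (comul b) t).
Proof. by rewrite comulM tactM. Qed.

Definition tensor M N : repn H :=
  Repn (repn_sort := tens M N) (@tensor_linl M N) (@tensor_linr M N)
    (@tensor_act1 M N) (@tensor_actM M N).

Definition dual_act M (a : H) (f : dualv M) : dualv M :=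
  dual_of (fun m => f (act (antipode a) m)).

Lemma dual_actE M a (f : dualv M) m : dual_act a f m = f (act (antipode a) m).
Proof. exact: (dual_ofE (linear_comp (linear_dual f) (act_linr _)) m). Qed.

Fact dual_linl M (f : dualv M) : linear (fun a => dual_act a f).
Proof.
move=> c a b; apply: dual_ext => m; rewrite dualD !dual_actE linearP act_linl.
exact: (linear_dual f).
Qed.

Fact dual_linr M a : linear (fun f : dualv M => dual_act a f).
Proof. by move=> c f g; apply: dual_ext => m; rewrite dualD !dual_actE dualD. Qed.

Fact dual_act1 M (f : dualv M) : dual_act 1 f = f.
Proof. by apply: dual_ext => m; rewrite dual_actE antipode1 act1m. Qed.

Fact dual_actM M a b (f : dualv M) : dual_act (a * b) f = dual_act a (dual_act b f).
Proof. by apply: dual_ext => m; rewrite !dual_actE antipodeM actMm. Qed.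

Definition dual_repn M : repn H :=
  Repn (repn_sort := dualv M) (@dual_linl M) (@dual_linr M)
    (@dual_act1 M) (@dual_actM M).

(* A full subcategory of Rep(H) is given by the class of its objects. A fusion
   subcategory is replete, closed under direct sums and direct summands (hence it
   contains the zero module), tensor products and duals, and contains the unit. *)
Definition fusion_subcat (K : repn H -> Prop) :=
  [/\ forall M N, repn_iso M N -> K M -> K N,
      forall M N, K (dsum M N) <-> K M /\ K N,
      K unit_repn,
      forall M N, K M -> K N -> K (tensor M N) &
      forall M, K M -> K (dual_repn M)].

Definition fusion_gen (S : repn H -> Prop) (M : repn H) :=
  forall K, fusion_subcat K -> (forall X, S X -> K X) -> K M.

Definition tswap (U V : vectType k) (t : tens U V) : tens V U :=
  \tsum_(x, y <- t) (y \ox x).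

(* The last two axioms read (D (x) id)(R) = R13 R23 and (id (x) D)(R) = R13 R12. *)
Definition quasitriangular (R : tens H H) :=
  [/\ R \is a GRing.unit,
      forall a, tswap (comul a) * R = R * comul a,
      \tsum_(x, y <- R) (comul x \ox y)
      = (\tsum_(x, y <- R) ((x \ox 1) \ox y)) * (\tsum_(x, y <- R) ((1 \ox x) \ox y))
        :> tens (tens H H) H &
      \tsum_(x, y <- R) (x \ox comul y)
      = (\tsum_(x, y <- R) (x \ox (1 \ox y))) * (\tsum_(x, y <- R) (x \ox (y \ox 1)))
        :> tens H (tens H H)].

(* f |-> (id (x) f)(R21 R) *)
Definition drinfeld_fun (R : tens H H) (f : dualv H) : H :=
  \tsum_(x, y <- tswap R * R) (f y *: x).

Definition drinfeld (R : tens H H) : 'Hom(dualv H, H) := linfun (drinfeld_fun R).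

Definition factorizable (R : tens H H) :=
  quasitriangular R /\ bijective (drinfeld R).

Lemma linear_drinfeld_fun (R : tens H H) : linear (drinfeld_fun R).
Proof.
move=> c f g; rewrite /drinfeld_fun -tliftD; apply: eq_tlift => x y.
by rewrite dualD scalerDl scalerA.
Qed.

Lemma drinfeldE (R : tens H H) f : drinfeld R f = drinfeld_fun R f.
Proof.
pose fM := GRing.isLinear.Build k (dualv H) H _ _ (linear_drinfeld_fun R).
pose fL : {linear dualv H -> H} := HB.pack (drinfeld_fun R) fM.
exact: (lfunE fL).
Qed.

(* c_{M,N}(m (x) n) = R21 (n (x) m) *)
Definition braiding (R : tens H H) M N (t : tens M N) : tens N M :=
  tact (tswap R) (tswap t).

Definition mueger_centralizer (R : tens H H) (K : repn H -> Prop) : repn H -> Prop :=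
  fusion_gen (fun X => irreducible X /\
    forall Y, K Y -> forall t : tens X Y, braiding R (braiding R t) = t).

(* The generators are the simple subcoalgebras of H* attached to the irreducible
   characters chi with chi(d) = chi(1) epsilon(d). *)
Definition hker (d : H) : hopfsub (dualv H) := hopf_gen (fun U =>
  exists M : repn H, [/\ irreducible M,
    character M d = character M 1 * counit d & U = coef_space M]).

(* The canonical projection H = H** -> P*. *)
Definition bidual_proj (P : hopfsub (dualv H)) (a : H) : dualv (hsub P) :=
  dual_of (fun f : hsub P => (hval f : dualv H) a).

Lemma bidual_projE P a f : bidual_proj P a f = (hval f : dualv H) a.
Proof. exact: (dual_ofE (linear_comp (linear_eval a) (@linear_hval _ _ P)) f). Qed.

Lemma bidual_projM P a b : bidual_proj P (a * b) = bidual_proj P a * bidual_proj P b.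
Proof.
apply: dual_ext => f; rewrite dualM bidual_projE -dual_comulE.
rewrite -(sub_comul_val (F := fun g h : dualv H => g a * h b : k^o)).
  by apply: eq_tlift => g h; rewrite !bidual_projE.
split=> [h c g g'|g c h h']; rewrite dualD.
  by rewrite mulrDl -mulrA.
by rewrite mulrDr mulrCA.
Qed.

Lemma bidual_proj1 P : bidual_proj P 1 = 1.
Proof. by apply: dual_ext => f; rewrite bidual_projE. Qed.

(* Rep(P^* ) inside Rep(H): the H-modules isomorphic to the restriction of a
   P*-module along the projection H -> P*. *)
Definition rep_dual_sub (P : hopfsub (dualv H)) (M : repn H) :=
  exists (N : repn (dualv (hsub P))) (f : N -> M),
    [/\ linear f, bijective f &
        forall a n, f (act (bidual_proj P a) n) = act a (f n)].

(* d is an irreducible character of H*, under the identification H = H**. *)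
Definition irr_dual_char (d : H) := exists2 chi : dualv (dualv H),
  irr_char chi & forall f, chi f = f d.

End TensorReps.

(* Main.v *)
(* Write phi for the Drinfeld map, L for the normalized integral of A and r for the
   regular character of A. The element phi^-1(L) is an integral of A*, and a trace
   computation with the two integrals gives S^2 = 1 (Larson-Radford). Hence phi maps
   characters to central elements, and chi E_j = psi_j(chi) E_j for characters chi,
   where psi_j(chi) is an eigenvalue of a nonnegative integer matrix with
   Perron-Frobenius eigenvalue chi(1). As d is a character of A* and E_j an
   idempotent, E_j(d) is a natural number; thus chi(d) = \sum_j psi_j(chi) E_j(d)
   equals chi(1) eps(d) exactly when psi_j(chi) = chi(1) whenever E_j(d) <> 0.
   If e is the central idempotent of a set of simple modules closed under tensor
   products, then f r(e .) = f(1) r(e .) for all f supported on e, which shows that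
   psi_j(chi) = chi(1) forces the double braiding of the two modules to be trivial.
   Hence the Hopf kernel of d is the centralizer of the modules chi_j with
   E_j(d) <> 0, and the theorem is the double centralizer theorem for the
   subcategory they generate. *)
From HB Require Import structures.
Require Import Defs.
From mathcomp Require Import all_boot all_order all_algebra all_field.
From mathcomp Require Import zify.
From mathcomp Require boolp.

Set Implicit Arguments.
Unset Strict Implicit.
Unset Printing Implicit Defensive.

Import GRing.Theory VectorInternalTheory.
Local Open Scope ring_scope.

(** * Traces of linear endomorphisms *)

(** The field [k] carries no order and no absolute value, so the maximality argument for [chi d]
    takes place in [algC], after embedding the subfield generated by the finitely many eigenvalues
    involved. A fusion subcategory enters through its central idempotent [e], subject only to
    [counit e = 1] and [comul e * (e \ox e) = e \ox e]; closure under duals is then a consequence of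
    a trace computation, because in characteristic zero an idempotent of trace zero vanishes. Two
    properties of the Drinfeld map carry the argument. It sends trace-like functionals to central
    elements, which is where the involutivity of the antipode enters. It satisfies
    [phi (f * g) = phi f * phi g] for arbitrary [f] as soon as [phi g] is central; with [g] a
    character or an [E j], this passes from statements about characters to statements about all
    matrix coefficients, and only the latter detect the double braiding. The double centralizer is
    reached without counting dimensions of subcategories: a single number is computed in two
    ways. *)

Section Trace.
Variable k : fieldType.
Implicit Types U V W : vectType k.

(** Defined on bare functions, so that traces of actions and of composites can be taken without
    packing them as linear maps. *)
Definition ltr V (F : V -> V) : k := \sum_i v2r (F (bas i)) 0 i.

(** The families [g] and [v] are arbitrary, which allows traces to be computed from the dual bases
    that integrals provide. *)
Lemma ltrE V (I : finType) (g : I -> V -> k) (v : I -> V) (F : V -> V) :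
  (forall i, linear (g i : V -> k^o)) ->
  (forall x, F x = \sum_i g i x *: v i) -> ltr F = \sum_i g i (v i).
Proof.
move=> lg EF; rewrite /ltr; under eq_bigr => b _.
  rewrite EF linear_sum summxE; under eq_bigr do rewrite linearZ mxE.
over.
rewrite exchange_big; apply: eq_bigr => i _ /=.
rewrite [v i in RHS]bas_sum (linf_sum (lg i)).
by apply: eq_bigr => b _; rewrite (linfZ _ _ (lg i)) mulrC.
Qed.

Lemma eq_ltr V (F G : V -> V) : F =1 G -> ltr F = ltr G.
Proof. by move=> E; apply: eq_bigr => i _; rewrite E. Qed.

Lemma ltrC V W (F : V -> W) (G : W -> V) : linear F -> linear G ->
  ltr (F \o G) = ltr (G \o F).
Proof.
move=> lF lG; rewrite (@ltrE W _ (fun i y => v2r (G y) 0 i) (fun i => F (bas i))) //.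
  by move=> i c x y; rewrite lG linearP !mxE.
move=> y /=; rewrite {1}[G y]bas_sum (linf_sum lF).
by apply: eq_bigr => i _; rewrite (linfZ _ _ lF).
Qed.

Lemma ltrP V c (F G : V -> V) : ltr (fun x => c *: F x + G x) = c * ltr F + ltr G.
Proof.
rewrite mulr_sumr -big_split; apply: eq_bigr => i _ /=.
by rewrite linearP !mxE.
Qed.

Lemma ltr0 V : ltr (fun _ : V => 0) = 0.
Proof. by apply: big1 => i _; rewrite linear0 mxE. Qed.

Lemma ltrZ V c (F : V -> V) : ltr (fun x => c *: F x) = c * ltr F.
Proof. by rewrite mulr_sumr; apply: eq_bigr => i _ /=; rewrite linearZ mxE. Qed.

Lemma ltrD V (F G : V -> V) : ltr (fun x => F x + G x) = ltr F + ltr G.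
Proof. by rewrite -[ltr F]mul1r -ltrP; apply: eq_ltr => x; rewrite scale1r. Qed.

Lemma ltrN V (F : V -> V) : ltr (fun x => - F x) = - ltr F.
Proof. by rewrite -mulN1r -ltrZ; apply: eq_ltr => x; rewrite scaleN1r. Qed.

Lemma ltr_id V : ltr (@id V) = (dim V)%:R.
Proof.
rewrite /ltr (eq_bigr (fun=> 1)); first by rewrite sumr_const card_ord.
by move=> i _; rewrite v2r_bas eqxx.
Qed.

Lemma ltr_scalar V c : ltr (fun x : V => c *: x) = c * (dim V)%:R.
Proof. by rewrite ltrZ ltr_id. Qed.

(** The natural number is the rank: a basis of the image, with its coordinate functions composed
    with [F], is a rank-one decomposition to which [ltrE] applies. *)
Lemma ltr_idem V (F : V -> V) : linear F -> (forall x, F (F x) = F x) ->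
  exists2 n, ltr F = n%:R & n = 0%N -> forall x, F x = 0.
Proof.
move=> lF FF; pose fM := GRing.isLinear.Build k V V _ F lF.
pose fL : {linear V -> V} := HB.pack F fM.
pose h := linfun fL; have hE x : h x = F x by rewrite lfunE.
exists (\dim (limg h)) => [|/eqP]; last first.
  by rewrite dimv_eq0 => /eqP h0 x; apply/eqP; rewrite -hE -memv0 -h0 memv_img ?memvf.
rewrite (@ltrE V _ (fun i x => coord (vbasis (limg h)) i (F x))
  (fun i => (vbasis (limg h))`_i)).
- rewrite (eq_bigr (fun=> 1)) ?sumr_const ?card_ord // => i _.
  have: (vbasis (limg h))`_i \in limg h by rewrite vbasis_mem ?memt_nth.
  case/memv_imgP=> x _ xE; rewrite xE hE FF -hE -xE coord_free ?eqxx //.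
  exact: basis_free (vbasisP _).
- by move=> i c x y; rewrite lF linearP.
- by move=> x; apply: coord_vbasis; rewrite -hE memv_img ?memvf.
Qed.

Lemma ltr_idem_eq0 V (F : V -> V) : [pchar k] =i pred0 -> linear F ->
  (forall x, F (F x) = F x) -> ltr F = 0 -> forall x, F x = 0.
Proof.
move=> c0 lF FF tF; have [n En n0] := ltr_idem lF FF.
by apply: n0; move/eqP: En; rewrite tF eq_sym ((pcharf0P k).1 c0) => /eqP.
Qed.

Lemma bas_pair U V (t : tens U V) : 
  t = \sum_(p : 'I_(dim U) * 'I_(dim V)) (t : 'M_(_, _)) p.1 p.2 *: (bas p.1 \ox bas p.2).
Proof. by rewrite -[LHS]tens_sum tlift_pair. Qed.

Lemma ltr_tens U V (F : tens U V -> tens U V) : linear F ->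
  ltr F = \sum_i \sum_j (F (bas i \ox bas j) : 'M_(_, _)) i j.
Proof.
move=> lF; rewrite (@ltrE _ ('I_(dim U) * 'I_(dim V))%type
  (fun p (t : tens U V) => (t : 'M_(_, _)) p.1 p.2)
    (fun p => F (bas p.1 \ox bas p.2))) ?pair_big //=.
- by move=> i c x y; rewrite !mxE.
- by move=> t; rewrite {1}[t]bas_pair (linf_sum lF); apply: eq_bigr => p _; rewrite (linfZ _ _ lF).
Qed.

Lemma ltr_pure U V (F : U -> U) (G : V -> V) (FG : tens U V -> tens U V) :
  linear FG -> (forall u v, FG (u \ox v) = F u \ox G v) ->
  ltr FG = ltr F * ltr G.
Proof.
move=> lFG E; rewrite ltr_tens // mulr_suml; apply: eq_bigr => i _.
by rewrite mulr_sumr; apply: eq_bigr => j _; rewrite E mxE.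
Qed.

Lemma ltr_pair U V (F : U -> U) (G : V -> V) (H : (U * V)%type -> (U * V)%type) :
  linear F -> linear G -> (forall p, H p = (F p.1, G p.2)) ->
  ltr H = ltr F + ltr G.
Proof.
move=> lF lG E.
pose g (s : 'I_(dim U) + 'I_(dim V)) (p : (U * V)%type) : k :=
  match s with inl i => v2r p.1 0 i | inr j => v2r p.2 0 j end.
pose v (s : 'I_(dim U) + 'I_(dim V)) : (U * V)%type :=
  match s with inl i => (F (bas i), 0) | inr j => (0, G (bas j)) end.
rewrite (@ltrE _ _ g v) //.
- by rewrite big_sumType.
- by case=> i c x y /=; rewrite linearP !mxE.
move=> [x y]; rewrite E big_sumType /= {1}[x]bas_sum {1}[y]bas_sum.
rewrite (linf_sum lF) (linf_sum lG).
have -> : forall (a : U) (b : V), (a, b) = (a, 0) + (0, b).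
  by move=> a b; congr (_, _); rewrite /= ?addr0 ?add0r.
have l1 : linear (fun a : U => (a, 0) : (U * V)%type).
  by move=> c a b; congr (_, _); rewrite /= scaler0 addr0.
have l2 : linear (fun b : V => (0, b) : (U * V)%type).
  by move=> c a b; congr (_, _); rewrite /= scaler0 addr0.
rewrite (linf_sum l1) (linf_sum l2); congr (_ + _); apply: eq_bigr => i _.
  by rewrite (linfZ _ _ lF) (linfZ _ _ l1).
by rewrite (linfZ _ _ lG) (linfZ _ _ l2).
Qed.

End Trace.

(** * Modules over a semisimple algebra *)

Lemma inj_surj_bij (X Y : Type) (f : X -> Y) :
  injective f -> (forall y, exists x, f x = y) -> bijective f.
Proof.
move=> fI fS; pose g y := sval (boolp.cid (fS y)).
have gK y : f (g y) = y := svalP (boolp.cid (fS y)).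
by exists g => // x; apply: fI; rewrite gK.
Qed.

Section Reps.
Variables (k : fieldType) (A : falgType k).
Implicit Types (M N : repn A) (a b : A).

Definition repn_hom M N (f : M -> N) :=
  linear f /\ forall a m, f (act a m) = act a (f m).

Lemma act0 M a : act a (0 : M) = 0.
Proof. by have := linfZ 0 (0 : M) (act_linr a); rewrite !scale0r. Qed.

Lemma act0l M (m : M) : act (0 : A) m = 0.
Proof. by have := linfZ 0 (0 : A) (act_linl m); rewrite !scale0r. Qed.

Lemma actDl M a b (m : M) : act (a + b) m = act a m + act b m.
Proof. by have := act_linl m 1 a b; rewrite !scale1r. Qed.

Lemma actDr M a (m n : M) : act a (m + n) = act a m + act a n.
Proof. by have := act_linr a 1 m n; rewrite !scale1r. Qed.

Lemma actZl M c a (m : M) : act (c *: a) m = c *: act a m.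
Proof. exact: linfZ (act_linl m). Qed.

Lemma actZr M c a (m : M) : act a (c *: m) = c *: act a m.
Proof. exact: linfZ (act_linr a). Qed.

Lemma actBl M a b (m : M) : act (a - b) m = act a m - act b m.
Proof. by rewrite actDl -scaleN1r actZl scaleN1r. Qed.

Lemma act_suml M I (r : seq I) (P : pred I) (F : I -> A) (m : M) :
  act (\sum_(i <- r | P i) F i) m = \sum_(i <- r | P i) act (F i) m.
Proof. by elim/big_rec2: _ => [|i x y _ <-]; rewrite ?act0l ?actDl. Qed.

Lemma char_ltr M a : character M a = ltr (act a : M -> M).
Proof.
rewrite characterE; symmetry.
apply: (ltrE (g := fun i => coord (vbasis {:M}) i)) => [i c x y|x].
  by rewrite linearP.
rewrite {1}(coord_vbasis (memvf x)) (linf_sum (act_linr a)).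
by apply: eq_bigr => i _; rewrite actZr.
Qed.

Lemma charM M a b : character M (a * b) = character M (b * a).
Proof.
rewrite !char_ltr (eq_ltr (actMm a b)) (eq_ltr (actMm b a)).
by apply: (ltrC (F := act a) (G := act b)); apply: act_linr.
Qed.

Lemma char1 M : character M 1 = (dim M)%:R.
Proof. by rewrite char_ltr (eq_ltr (@act1m _ _ M)) ltr_id. Qed.

Lemma char_id M a : (forall m : M, act a m = m) -> character M a = (dim M)%:R.
Proof. by move=> E; rewrite char_ltr (eq_ltr E) ltr_id. Qed.

Lemma char_eq0 M a : (forall m : M, act a m = 0) -> character M a = 0.
Proof. by move=> E; rewrite char_ltr (eq_ltr E) ltr0. Qed.

Lemma char_scalar M a c : (forall m : M, act a m = c *: m) ->
  character M a = c * (dim M)%:R.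
Proof. by move=> E; rewrite char_ltr (eq_ltr E) ltr_scalar. Qed.

Lemma char_dsum M N : character (dsum M N) = character M + character N.
Proof.
apply: dual_ext => a; rewrite add_lfunE !char_ltr.
by apply: (ltr_pair (F := act a) (G := act a)) => //; apply: act_linr.
Qed.

Lemma linear_can (U V : vectType k) (f : U -> V) (g : V -> U) :
  linear f -> cancel f g -> cancel g f -> linear g.
Proof. by move=> lf fK gK c x y; rewrite -{1}[x]gK -{1}[y]gK -lf fK. Qed.

Lemma char_iso M N : repn_iso M N -> character M = character N.
Proof.
case=> f [lf [g fK gK] E]; apply: dual_ext => a; rewrite !char_ltr.
have lg := linear_can lf fK gK.
rewrite [RHS](eq_ltr (G := f \o (act a \o g))); last by move=> n /=; rewrite E gK.
rewrite ltrC //; last exact: linear_comp (act_linr a) lg.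
by apply: eq_ltr => m /=; rewrite fK.
Qed.

Lemma repn_iso_sym M N : repn_iso M N -> repn_iso N M.
Proof.
case=> f [lf [g fK gK] E]; exists g; split; first exact: linear_can lf fK gK.
  by exists f.
by move=> a n; rewrite -{1}[n]gK -E fK.
Qed.

Section Sub.
Variables (M : repn A) (U : {vspace M}) (sU : stable U).
Definition sub_act a (x : subvs_of U) : subvs_of U := vsproj U (act a (vsval x)).

Lemma sub_actE a x : vsval (sub_act a x) = act a (vsval x).
Proof. by rewrite vsprojK // sU ?subvsP. Qed.

Fact sub_linl x : linear (fun a => sub_act a x).
Proof. by move=> c a b; rewrite /sub_act act_linl linearP. Qed.
Fact sub_linr a : linear (sub_act a).
Proof. by move=> c x y; rewrite /sub_act linearP act_linr linearP. Qed.
Fact sub_act1 x : sub_act 1 x = x.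
Proof. by rewrite /sub_act act1m vsvalK. Qed.
Fact sub_actM a b x : sub_act (a * b) x = sub_act a (sub_act b x).
Proof. by apply: subvs_inj; rewrite !sub_actE actMm. Qed.

Definition sub_repn : repn A :=
  Repn (repn_sort := subvs_of U) sub_linl sub_linr sub_act1 sub_actM.
End Sub.

Lemma dsum_decomp M (U W : {vspace M}) (sU : stable U) (sW : stable W) :
  (U + W = {:M})%VS -> (U :&: W = 0)%VS -> 
  repn_iso (dsum (sub_repn sU) (sub_repn sW)) M.
Proof.
move=> UW1 UW0; exists (fun p => vsval p.1 + vsval p.2); split.
- by move=> c p q /=; rewrite scalerDr addrACA.
- apply: inj_surj_bij => [[x y] [x' y'] /= /eqP|m].
    rewrite -subr_eq0 opprD addrACA addr_eq0 => /eqP E.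
    have: vsval x - vsval x' \in (U :&: W)%VS.
      by rewrite memv_cap {2}E memvN !memvB ?subvsP.
    rewrite UW0 memv0 subr_eq0 => /eqP/subvs_inj Ex.
    by move/eqP: E; rewrite Ex subrr eq_sym oppr_eq0 subr_eq0 => /eqP/subvs_inj->.
  have: m \in (U + W)%VS by rewrite UW1 memvf.
  case/memv_addP=> u uU [w wW ->].
  by exists (vsproj U u, vsproj W w); rewrite /= !vsprojK.
- by move=> a [x y] /=; rewrite (sub_actE sU) (sub_actE sW) actDr.
Qed.

Lemma dim_sub (M : repn A) (U : {vspace M}) : dim (subvs_of U) = \dim U.
Proof. by []. Qed.

(** Complete reducibility as an induction on the dimension. A reducible module is only isomorphic to
    a direct sum of two submodules, hence the hypothesis on isomorphisms. *)
Lemma repn_ind (K : repn A -> Prop) : semisimple_alg A ->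
  (forall M N, repn_iso M N -> K M -> K N) ->
  (forall M, dim M = 0%N -> K M) -> (forall M, irreducible M -> K M) ->
  (forall M N, K M -> K N -> K (dsum M N)) -> forall M, K M.
Proof.
move=> ssA Kiso K0 Kirr Kd M; have [n] := ubnP (dim M); elim: n M => // n IHn M.
have [/eqP d0 _|d0 dM] := boolP (dim M == 0%N); first exact: K0.
have [irrM|redM] := boolp.EM (irreducible M); first exact: Kirr.
have [U [sU [U0 U1]]] : exists U : {vspace M}, stable U /\ (U <> 0%VS /\ U <> {:M}%VS).
  apply: boolp.contrapT => noU; apply: redM; split.
    by rewrite -dimv_eq0 dimvf.
  move=> U sU; apply: boolp.contrapT => nU; apply: noU; exists U; split=> //.
  by split=> E; apply: nU; [left | right].
have [W [sW UW1 UW0]] := ssA M U sU.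
have dUW : (dim (sub_repn sU) + dim (sub_repn sW) = dim M)%N.
  by rewrite /= !dim_sub -[RHS]dimvf -UW1 dimv_disjoint_sum.
have dU : (0 < \dim U)%N by rewrite lt0n dimv_eq0; apply/eqP.
have dW : (0 < \dim W)%N.
  rewrite lt0n dimv_eq0; apply/eqP=> W0; apply: U1.
  by rewrite -UW1 W0 addv0.
apply: Kiso (dsum_decomp sU sW UW1 UW0) _; apply: Kd; apply: IHn.
  by rewrite -ltnS; apply: leq_trans dM; rewrite ltnS -dUW -[X in (X <= _)%N]addn1 leq_add2l.
by rewrite -ltnS; apply: leq_trans dM; rewrite ltnS -dUW -[X in (X <= _)%N]add1n leq_add2r.
Qed.

Definition reg_repn : repn A :=
  Repn (repn_sort := A) (@linear_mulr k A) (@linear_mull k A) (@mul1r A)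
   (fun a b m => esym (mulrA a b m)).

Lemma dim0_eq0 (V : vectType k) (v : V) : dim V = 0%N -> v = 0.
Proof.
move=> d0; have := memvf v; rewrite (_ : fullv = 0%VS) ?memv0 => [/eqP //|].
by apply/eqP; rewrite -dimv_eq0 dimvf d0.
Qed.

Lemma act_eq0 : semisimple_alg A -> forall a,
  (forall M, irreducible M -> forall m : M, act a m = 0) -> a = 0.
Proof.
move=> ssA a E; rewrite -[a]mulr1.
suff H M : forall m : M, act a m = 0 by exact: (H reg_repn 1).
move: M; apply: (@repn_ind (fun M => forall m : M, act a m = 0) ssA) => //.
- by move=> M N [f [lf [g fK gK] fE]] E0 n; rewrite -[n]gK -fE E0 linf0.
- by move=> M d0 m; apply: dim0_eq0.
- by move=> M N EM EN [m n] /=; rewrite EM EN.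
Qed.

End Reps.

(** A subspace of maximal dimension among those contained in [P] absorbs every vector satisfying
    [P]. *)
Lemma vspace_of_pred (k : fieldType) (V : vectType k) (P : V -> Prop) :
  P 0 -> (forall c x y, P x -> P y -> P (c *: x + y)) ->
  exists U : {vspace V}, forall x, x \in U <-> P x.
Proof.
move=> P0 PD; pose good (U : {vspace V}) := forall x, x \in U -> P x.
have ex : exists n, boolp.asbool (exists2 U, good U & \dim U = n).
  exists 0%N; apply/boolp.asboolP; exists 0%VS; last exact: dimv0.
  by move=> x; rewrite memv0 => /eqP->.
have ub n : boolp.asbool (exists2 U, good U & \dim U = n) -> (n <= dim V)%N.
  by case/boolp.asboolP => U _ <-; rewrite -dimvf dimvS ?subvf.
case: (ex_maxnP ex ub) => n /boolp.asboolP[U gU <-] maxU.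
exists U => x; split=> [/gU//|Px].
have gUx : good (U + <[x]>)%VS.
  move=> y /memv_addP[u uU [w /vlineP[c ->] ->]].
  by rewrite addrC; apply: PD => //; apply: gU.
have: (U + <[x]> <= U)%VS.
  rewrite -(geq_leqif (dimv_leqif_sup (addvSl U <[x]>))).
  by apply: maxU; apply/boolp.asboolP; exists (U + <[x]>)%VS.
by rewrite subv_add -memvE => /andP[].
Qed.

(** * Schur's lemma and primitive central idempotents *)

Section Schur.
Variables (k : fieldType) (A : falgType k).
Implicit Types (M N : repn A) (a b : A).

Lemma irr_dim M : irreducible M -> (0 < dim M)%N.
Proof. by case=> M0 _; rewrite lt0n -dimvf dimv_eq0. Qed.

Lemma irr_neq0 M : irreducible M -> exists m : M, m != 0.
Proof.
by case=> M0 _; exists (vpick {:M}); rewrite vpick0.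
Qed.

(** The vectors satisfying [P] form a nonzero submodule. *)
Lemma irr_full M (P : M -> Prop) m0 : irreducible M -> P 0 ->
  (forall c x y, P x -> P y -> P (c *: x + y)) ->
  (forall a m, P m -> P (act a m)) -> P m0 -> m0 != 0 -> forall m, P m.
Proof.
move=> [_ irrM] P0 PD Pa Pm0 m00 m; have [U UP] := vspace_of_pred P0 PD.
have sU : stable U by move=> a x /UP Px; apply/UP; apply: Pa.
case: (irrM U sU) => EU; last by apply/UP; rewrite EU memvf.
by have /UP := Pm0; rewrite EU memv0 (negPf m00).
Qed.

Lemma schur_bij M N (f : M -> N) m0 : irreducible M -> irreducible N ->
  repn_hom f -> f m0 != 0 -> bijective f.
Proof.
move=> irrM irrN [lf fE] fm0; apply: inj_surj_bij => [x y /eqP|y].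
  rewrite -subr_eq0 -[_ - _]addrC -scaleN1r -lf => /eqP Exy.
  apply/eqP; rewrite -subr_eq0 -[_ - _]addrC -scaleN1r; apply: contraNT fm0 => nxy.
  apply/eqP.
  apply: (irr_full (P := fun m => f m = 0) irrM _ _ _ Exy nxy m0) => //.
  - exact: linf0.
  - by move=> c u v fu fv; rewrite lf fu fv scaler0 addr0.
  - by move=> a m E; rewrite fE E act0.
apply: (irr_full (P := fun y => exists x, f x = y) (m0 := f m0) irrN) => //.
- by exists (0 : M); apply: linf0.
- by move=> c _ _ [u <-] [v <-]; exists (c *: u + v); apply: lf.
- by move=> a _ [m <-]; exists (act a m).
- by exists m0.
Qed.

Lemma schur_iso M N (f : M -> N) m0 : irreducible M -> irreducible N ->
  repn_hom f -> f m0 != 0 -> repn_iso M N.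
Proof.
move=> irrM irrN hf fm0; exists f; split; [exact: hf.1 | | exact: hf.2].
exact: schur_bij hf fm0.
Qed.

Lemma central_sub a b : central a -> central b -> central (a - b).
Proof. by move=> ca cb x; rewrite mulrBl mulrBr ca cb. Qed.

Lemma central1 : central (1 : A).
Proof. by move=> x; rewrite mul1r mulr1. Qed.

Lemma centralM a b : central a -> central b -> central (a * b).
Proof. by move=> ca cb x; rewrite -mulrA cb mulrA ca mulrA. Qed.

Lemma central_idem_compl f : central_idem f -> central_idem (1 - f : A).
Proof.
move=> [cf ff]; split; first exact: central_sub central1 cf.
by rewrite mulrBl mul1r mulrBr mulr1 ff subrr subr0.
Qed.

Lemma central_idemM f g : central_idem f -> central_idem g -> central_idem (f * g : A).
Proof.
move=> [cf ff] [cg gg]; split; first exact: centralM.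
by rewrite -mulrA (mulrA g) cg -mulrA gg mulrA ff.
Qed.

(* The annihilator [I] of [M] is generated by a central idempotent: as left ideal
   it is [A u] with [u] right identity of [I], and [{x in I | I x = 0}] has
   square zero, hence vanishes, so that [u] is also a left identity. *)
Lemma ann_central_idem M : semisimple_alg A ->
  exists2 f, central_idem f & forall x, (forall m : M, act x m = 0) <-> x * f = 0.
Proof.
move=> ssA.
have split_ideal (P : A -> Prop) : P 0 ->
    (forall c x y, P x -> P y -> P (c *: x + y)) -> (forall a x, P x -> P (a * x)) ->
    (forall a x, P x -> P (x * a)) ->
    exists2 u, P u & forall x, P x -> x = x * u.
  move=> P0 PD Pl Pr; have [U UP] := vspace_of_pred P0 PD.
  have sU : stable (M := reg_repn A) U by move=> a x /UP Px; apply/UP; apply: Pl.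
  have [W [sW UW1 UW0]] := ssA _ _ sU.
  have: (1 : A) \in (U + W)%VS by rewrite UW1 memvf.
  case/memv_addP=> u uU [w wW E]; exists u; first exact/UP.
  move=> x Px; have: x * w \in (U :&: W)%VS.
    rewrite memv_cap; apply/andP; split; last exact: sW.
    by apply/UP; apply: Pr.
  by rewrite UW0 memv0 => /eqP xw; rewrite -[LHS]mulr1 E mulrDr xw addr0.
pose P x := forall m : M, act x m = 0.
have P0 : P 0 by move=> m; rewrite act0l.
have PD c x y : P x -> P y -> P (c *: x + y).
  by move=> Px Py m; rewrite act_linl Px Py scaler0 addr0.
have Pl a x : P x -> P (a * x) by move=> Px m; rewrite actMm Px act0.
have Pr a x : P x -> P (x * a) by move=> Px m; rewrite actMm Px.
have [u Pu uR] := split_ideal P P0 PD Pl Pr.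
pose Q x := P x /\ forall y, P y -> y * x = 0.
have [|c x y [Px xP] [Py yP]|a x [Px xP]|a x [Px xP]|v [Pv vP] vR] := split_ideal Q.
- by split=> // y _; rewrite mulr0.
- split=> [|z Pz]; first exact: PD.
  by rewrite mulrDr -scalerAr xP // yP // scaler0 addr0.
- by split=> [|z Pz]; [apply: Pl | rewrite mulrA xP //; apply: Pr].
- by split=> [|z Pz]; [apply: Pr | rewrite mulrA xP // mul0r].
have Q0 x : Q x -> x = 0 by move=> Qx; rewrite (vR x Qx) vP //; case: Qx.
have uL x : P x -> u * x = x.
  move=> Px; apply/eqP; rewrite -subr_eq0; apply/eqP/Q0; split=> [|y Py].
    by rewrite -scaleN1r addrC; apply: PD => //; apply: Pl.
  by rewrite mulrBr mulrA -(uR y Py) subrr.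
have cu : central_idem u.
  split; last by rewrite -uR.
  by move=> a; rewrite (uR _ (Pr a u Pu)) -[RHS](uL _ (Pl a u Pu)) mulrA.
exists (1 - u); first exact: central_idem_compl.
move=> x; split=> [Px|E m]; first by rewrite mulrBr mulr1 -(uR x Px) subrr.
move/eqP: E; rewrite mulrBr mulr1 subr_eq0 => /eqP->.
exact: Pl.
Qed.

(** Primitivity makes the annihilator of [M] kill [N]. Since [N] is isomorphic to a left ideal [W]
    generated away from the annihilator of a vector [n0], some element of [W] moves a vector [m0] of
    [M], and evaluation at [m0] is a nonzero morphism from [N] to [M]. *)
Lemma prim_idem_iso e M N : semisimple_alg A -> central_primitive_idem e ->
  irreducible M -> irreducible N -> (forall m : M, act e m = m) ->
  (forall n : N, act e n = n) -> repn_iso N M.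
Proof.
move=> ssA [[ce ee] e0 prim] irrM irrN eM eN.
have [f [cf ff] fP] := ann_central_idem M ssA.
have cf' := central_idem_compl (conj cf ff).
(* One of [e * f] and [e * (1 - f)] vanishes by primitivity; the first does not, since [e] would
   then annihilate [M]. *)
have e1f : e * (1 - f) = 0.
  have [||||//|E] := prim (e * f) (e * (1 - f)).
  - exact: central_idemM.
  - exact: central_idemM.
  - by rewrite mulrA -(mulrA e) cf mulrA ee -mulrA mulrBr mulr1 ff subrr mulr0.
  - by rewrite -mulrDr addrC subrK mulr1.
  move=> ef0; have [m mE] := irr_neq0 irrM.
  by have/fP/(_ m) := ef0; rewrite eM => m0; rewrite m0 eqxx in mE.
  by [].
have annN x : (forall m : M, act x m = 0) -> forall n : N, act x n = 0.
  move=> /fP xf n; rewrite -[n]eN -actMm -[x]mulr1 -[1](subrK f) addrC mulrDr xf add0r.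
  by rewrite -mulrA -ce e1f mulr0 act0l.
have [n0 nE] := irr_neq0 irrN.
have [|c x y|U UP] := @vspace_of_pred _ A (fun x => act x n0 = 0).
- exact: act0l.
- by move=> Ex Ey; rewrite act_linl Ex Ey scaler0 addr0.
have sU : stable (M := reg_repn A) U.
  by move=> a x /UP Ex; apply/UP; rewrite /= actMm Ex act0.
have [W [sW UW1 UW0]] := ssA _ _ sU.
have Wsurj n : exists2 w, w \in W & act w n0 = n.
  have [a <-] : exists a, act a n0 = n.
    apply: (irr_full (P := fun y => exists x, act x n0 = y) (m0 := n0) irrN) => //.
    - by exists (0 : A); apply: act0l.
    - by move=> c _ _ [u <-] [v <-]; exists (c *: u + v); rewrite act_linl.
    - by move=> a _ [b <-]; exists (a * b); rewrite actMm.
    - by exists (1 : A); rewrite act1m.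
  have: a \in (U + W)%VS by rewrite UW1 memvf.
  case/memv_addP=> u /UP uU [w wW ->]; exists w => //.
  by rewrite actDl uU add0r.
have Winj w : w \in W -> act w n0 = 0 -> w = 0.
  move=> wW /UP wU; apply/eqP; rewrite -memv0 -UW0 memv_cap wW andbT.
  exact: wU.
(* [g] inverts the bijection [w |-> act w n0] from [W] onto [N]; uniqueness of preimages ([gU])
   makes it a morphism. *)
pose g n := sval (boolp.cid2 (Wsurj n)).
have gW n : g n \in W := s2valP (boolp.cid2 (Wsurj n)).
have gE n : act (g n) n0 = n := s2valP' (boolp.cid2 (Wsurj n)).
have gU w n : w \in W -> act w n0 = n -> g n = w.
  move=> wW E; apply/eqP; rewrite -subr_eq0; apply/eqP/Winj.
    by rewrite memvB.
  by rewrite actBl gE E subrr.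
have [m0 m0E] : exists m0 : M, act (g n0) m0 != 0.
  apply: boolp.contrapT => H; have := annN (g n0); move=> /(_ _ n0).
  rewrite gE => E; move/negP: nE; apply; apply/eqP/E => m.
  by apply/eqP/negPn/negP => Hm; apply: H; exists m.
apply: (schur_iso (f := fun n => act (g n) m0) (m0 := n0)) => //; split.
  move=> c x y; rewrite -act_linl; congr (act _ m0); apply: gU; last by rewrite act_linl !gE.
  by rewrite memvD ?memvZ.
move=> a n; rewrite -actMm; congr (act _ m0); apply: gU; last by rewrite actMm gE.
exact: sW.
Qed.
End Schur.

Lemma linear_eigen (k : closedFieldType) (V : vectType k) (F : V -> V) :
  linear F -> (0 < dim V)%N -> exists c, exists2 v, v != 0 & F v = c *: v.
Proof.
move=> lF dV; pose Z : 'M[k]_(dim V) := lin1_mx (v2r \o F \o r2v).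
have ZE (r : 'rV[k]_(dim V)) : r *m Z = v2r (F (r2v r)).
  pose gM := GRing.isLinear.Build k _ _ _ (v2r \o F \o @r2v k V)
    (linear_comp (linear_comp (@linearP _ _ _ _ _) lF) (@linearP _ _ _ _ _)).
  pose gL : {linear 'rV[k]_(dim V) -> 'rV[k]_(dim V)} := HB.pack (v2r \o F \o @r2v k V) gM.
  exact: (mul_rV_lin1 gL).
have [c] : exists c, root (char_poly Z) c.
  by apply/closed_rootP; rewrite size_char_poly; case: (dim V) dV.
rewrite -eigenvalue_root_char => /eigenvalueP[r Er r0]; exists c.
exists (r2v r); last by apply: v2r_inj; rewrite -ZE Er [RHS]linearZ /= r2vK.
by apply: contraNneq r0 => /(congr1 v2r); rewrite r2vK linear0 => ->.
Qed.

(** * Characters of a semisimple algebra *)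

Section Characters.
Variables (k : closedFieldType) (char0 : [pchar k] =i pred0) (A : falgType k).
Variable ssA : semisimple_alg A.
Implicit Types (M N : repn A) (a b z : A).

Lemma natr_eq0 n : (n%:R == 0 :> k) = (n == 0)%N.
Proof. exact: ((pcharf0P k).1 char0). Qed.

Lemma irr_char1_neq0 M : irreducible M -> character M 1 != 0.
Proof. by move=> /irr_dim d0; rewrite char1 natr_eq0 -lt0n. Qed.

(** The scalar is an eigenvalue, recovered from the trace by dividing by the dimension, which is
    invertible in characteristic zero. *)
Lemma schur_scalar M z : irreducible M -> central z ->
  forall m : M, act z m = (character M z / character M 1) *: m.
Proof.
move=> irrM cz; have [c [v v0 Ev]] := linear_eigen (act_linr (r := M) z) (irr_dim irrM).
have E (m : M) : act z m = c *: m.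
  apply: (irr_full (P := fun m : M => act z m = c *: m) irrM _ _ _ Ev v0 m).
  - by rewrite act0 scaler0.
  - by move=> d x y Ex Ey; rewrite act_linr Ex Ey scalerDr !scalerA mulrC.
  - by move=> a x Ex; rewrite -actMm cz actMm Ex actZr.
move=> m; rewrite (char_scalar E) char1 mulfK ?E // natr_eq0 -lt0n.
exact: irr_dim.
Qed.

Lemma central_idem_act M f : irreducible M -> central_idem f ->
  (forall m : M, act f m = 0) \/ (forall m : M, act f m = m).
Proof.
move=> irrM [cf ff]; have E := schur_scalar irrM cf; set c := _ / _ in E.
have [m m0] := irr_neq0 irrM; have: act (f * f) m = act f m by rewrite ff.
rewrite actMm !E scalerA => /eqP; rewrite -subr_eq0 -scalerBl scaler_eq0 (negPf m0) orbF.
rewrite -[X in _ - X]mulr1 -mulrBr mulf_eq0 subr_eq0 => /orP[]/eqP c0.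
  by left=> x; rewrite E c0 scale0r.
by right=> x; rewrite E c0 scale1r.
Qed.

Variables (s : nat) (chi : 'I_s -> dualv A) (chi_inj : injective chi).
Hypothesis chi_irr : forall x : dualv A, irr_char x <-> exists j, x = chi j.
Variables (e : 'I_s -> A) (e_chi : forall j, central_idem_of (chi j) (e j)).

Lemma chiP j : exists2 M, irreducible M & character M = chi j.
Proof. by have [M irrM ->] := (chi_irr (chi j)).2 (ex_intro _ j erefl); exists M. Qed.

Lemma irr_chi M : irreducible M -> exists j, character M = chi j.
Proof. by move=> irrM; have [|j ->] := (chi_irr (character M)).1; [exists M | exists j]. Qed.

Lemma e_idem j : central_idem (e j).
Proof. by case: (e_chi j) => [[]]. Qed.

Lemma chi1_neq0 j : chi j 1 != 0.
Proof. by have [M irrM <-] := chiP j; apply: irr_char1_neq0. Qed.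

(** The primitive idempotent attached to the common character acts as the identity on both
    modules. *)
Lemma irr_iso M N : irreducible M -> irreducible N -> character M = character N ->
  repn_iso M N.
Proof.
move=> irrM irrN EMN; have [j Ej] := irr_chi irrM; have [pj eid] := e_chi j.
by apply: (prim_idem_iso ssA pj) => //; apply: eid => //; rewrite -EMN.
Qed.

Lemma e_act M i j : irreducible M -> character M = chi j ->
  forall m : M, act (e i) m = if i == j then m else 0.
Proof.
move=> irrM Ej m; have [Eij|ij] := eqVneq i j; first by apply: (e_chi i).2; rewrite // Eij.
have [//|eid] := central_idem_act irrM (e_idem i).
have [N irrN Ei] := chiP i; have [pi eN] := e_chi i.
have /char_iso EMN : repn_iso M N by apply: (prim_idem_iso ssA pi) => //; apply: eN.
by case/eqP: ij; apply: chi_inj; rewrite -Ei -EMN.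
Qed.

Lemma sum_e_act M j (P : pred 'I_s) : irreducible M -> character M = chi j ->
  forall m : M, act (\sum_(i | P i) e i) m = if P j then m else 0.
Proof.
move=> irrM Ej m; rewrite act_suml big_mkcond (bigD1 j) //= (e_act _ irrM Ej) eqxx.
rewrite big1 ?addr0 //= => i ij; rewrite (e_act _ irrM Ej) (negPf ij).
by case: ifP.
Qed.

Lemma act_inj a b : (forall M, irreducible M -> forall m : M, act a m = act b m) -> a = b.
Proof.
move=> E; apply/eqP; rewrite -subr_eq0; apply/eqP; apply: (act_eq0 ssA) => M irrM m.
by rewrite actBl E // subrr.
Qed.

Lemma sum_e : \sum_i e i = 1.
Proof.
apply: act_inj => M irrM m; have [j Ej] := irr_chi irrM.
by rewrite (sum_e_act _ irrM Ej) act1m.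
Qed.

Lemma e_neq0 j : e j != 0.
Proof. by case: (e_chi j) => [[]]. Qed.

Lemma central_e z j : central z -> z * e j = (chi j z / chi j 1) *: e j.
Proof.
move=> cz; apply: act_inj => M irrM m; have [l El] := irr_chi irrM.
rewrite actMm actZl (e_act _ irrM El) (schur_scalar irrM cz) El.
by have [->|] := eqVneq j l; rewrite ?scaler0.
Qed.

Lemma central_sum_e (P : pred 'I_s) : central_idem (\sum_(i | P i) e i).
Proof.
split=> [b|]; first by rewrite mulr_suml mulr_sumr; apply: eq_bigr => i _; case: (e_idem i).
apply: act_inj => M irrM m; have [l El] := irr_chi irrM.
rewrite actMm !(sum_e_act _ irrM El).
by case: (P l).
Qed.

Lemma char_decomp M : exists n : 'I_s -> nat, character M = \sum_i (n i)%:R *: chi i.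
Proof.
move: M; apply: (repn_ind ssA).
- by move=> M N /char_iso <-.
- move=> M d0; exists (fun=> 0%N); rewrite big1 => [|i _]; last by rewrite scale0r.
  apply: dual_ext => a; rewrite zero_lfunE char_ltr /ltr; apply: big1 => i _.
  by exfalso; move: (leq_ltn_trans (leq0n i) (ltn_ord i)); rewrite d0.
- move=> M irrM; have [j ->] := irr_chi irrM; exists (fun i => (i == j) : nat).
  rewrite (bigD1 j) //= eqxx scale1r big1 ?addr0 // => i /negPf->.
  by rewrite scale0r.
move=> M N [m Em] [n En]; exists (fun i => (m i + n i)%N); rewrite char_dsum Em En.
by rewrite -big_split; apply: eq_bigr => i _; rewrite natrD scalerDl.
Qed.

End Characters.

(** * The Perron-Frobenius bound in characteristic zero *)

Section RatEmbedding.
Import Order.TTheory Num.Theory.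
Variables (k : fieldType) (char0 : [pchar k] =i pred0).

Lemma intr_char0_eq0 (z : int) : (z%:~R == 0 :> k) = (z == 0).
Proof.
have n0 n : (n%:R == 0 :> k) = (n == 0)%N := (pcharf0P k).1 char0 n.
by case: z => n; rewrite ?NegzE ?rmorphN ?oppr_eq0 ?pmulrn ?n0.
Qed.

Lemma ratr_div_char0 (m n : int) : n != 0 -> ratr (m%:~R / n%:~R) = m%:~R / n%:~R :> k.
Proof.
move=> n0; set x := _ / _ : rat.
have E : numq x * n = m * denq x.
  apply: (@intr_inj rat); rewrite !rmorphM /= numqE mulrAC {1}/x divfK //.
  by rewrite intr_eq0.
rewrite /ratr; apply/eqP; rewrite eqr_div ?intr_char0_eq0 ?denq_neq0 //.
by rewrite -!rmorphM /= E.
Qed.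

Fact ratr_char0_zmod_morphism : zmod_morphism (@ratr k).
Proof.
move=> x y; have dx := denq_neq0 x; have dy := denq_neq0 y.
have -> : x - y = (numq x * denq y - numq y * denq x)%:~R / (denq x * denq y)%:~R.
  rewrite -[x in LHS]divq_num_den -[y in LHS]divq_num_den.
  by rewrite -[in LHS]mulNr addf_div ?intr_eq0 // !rmorphM rmorphB !rmorphM /= mulNr.
rewrite ratr_div_char0 ?mulf_neq0 // /ratr -[in RHS]mulNr addf_div ?intr_char0_eq0 //.
by rewrite !rmorphM rmorphB !rmorphM /= mulNr.
Qed.

Fact ratr_char0_monoid_morphism : monoid_morphism (@ratr k).
Proof.
split=> [|x y]; first by rewrite (ratr_int k 1).
have dx := denq_neq0 x; have dy := denq_neq0 y.
have -> : x * y = (numq x * numq y)%:~R / (denq x * denq y)%:~R.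
  rewrite -[x in LHS]divq_num_den -[y in LHS]divq_num_den.
  by rewrite mulf_div !rmorphM.
by rewrite ratr_div_char0 ?mulf_neq0 // /ratr mulf_div !rmorphM.
Qed.

Definition rat_embedding : {rmorphism rat -> k} :=
  HB.pack (@ratr k)
    (GRing.isZmodMorphism.Build rat k (@ratr k) ratr_char0_zmod_morphism)
    (GRing.isMonoidMorphism.Build rat k (@ratr k) ratr_char0_monoid_morphism).

Local Notation iota := rat_embedding.

(** Membership of [w] in the ring generated by [z] over the rationals. *)
Definition in_gen (z w : k) := exists q, (map_poly iota q).[z] = w.

Lemma in_gen_trans z z' w : in_gen z z' -> in_gen z' w -> in_gen z w.
Proof.
by move=> [q <-] [q' <-]; exists (q' \Po q); rewrite map_comp_poly horner_comp.
Qed.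

Lemma primitive_element (xs : seq k) : (forall x, x \in xs -> algebraicOver iota x) ->
  exists2 z, algebraicOver iota z & forall x, x \in xs -> in_gen z x.
Proof.
elim: xs => [|x xs IHxs] algx; first by exists 0 => //; apply: algebraic0.
have [|y algy yP] := IHxs; first by move=> w wxs; apply: algx; rewrite inE wxs orbT.
have [p p0 px] := algx x (mem_head _ _); have [q q0 qy] := algy.
have c0 : [pchar rat] =i pred0 by apply: pchar_num.
have [n [zx zy]] := pchar0_PET p0 px q0 qy c0.
exists (y *+ n - x).
  apply: algebraic_sub; last by apply: algx; rewrite mem_head.
  rewrite -mulr_natl; apply: algebraic_mul => //.
  by rewrite -(rmorph_nat iota); apply: algebraic_id.
move=> w; rewrite inE => /orP[/eqP->|/yP]; first exact: zx.
exact: in_gen_trans.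
Qed.

(* A field generated by one algebraic element embeds into [algC]. *)
Lemma algC_conjugate z : algebraicOver iota z ->
  exists z' : algC, forall f : {poly rat},
    root (map_poly iota f) z = root (map_poly (@ratr algC) f) z'.
Proof.
move=> algz; pose good n := boolp.asbool (exists2 p : {poly rat}, p != 0 &
  root (map_poly iota p) z /\ size p = n).
have ex : exists n, good n.
  by have [p p0 pz] := algz; exists (size p); apply/boolp.asboolP; exists p.
case: (ex_minnP ex) => _ /boolp.asboolP[p p0 [pz <-]] minp.
have {}minp q : q != 0 -> root (map_poly iota q) z -> (size p <= size q)%N.
  by move=> q0 qz; apply: minp; apply/boolp.asboolP; exists q.
have sp : size (map_poly (@ratr algC) p) != 1.
  rewrite size_map_poly; apply: contraTneq pz => /eqP/size_poly1P[c c0 ->].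
  by rewrite map_polyC rootC fmorph_eq0.
have [z' pz'] := closed_rootP _ sp; exists z' => f.
have dvd_root (K : fieldType) (j : {rmorphism rat -> K}) (x : K) (u v : {poly rat}) :
    u %| v -> root (map_poly j u) x -> root (map_poly j v) x.
  by rewrite -(dvdp_map j); apply: root_dvdp.
have pf : root (map_poly iota f) z -> p %| f.
  move=> fz; apply: contraT => npf; have := minp (f %% p) npf.
  rewrite leqNgt ltn_modp p0; apply.
  rewrite (_ : f %% p = f - f %/ p * p); last by rewrite {2}(divp_eq f p) addrAC subrr add0r.
  rewrite rmorphB rmorphM /= /root hornerD hornerN hornerM (rootP pz) mulr0 subr0.
  by rewrite (rootP fz).
apply/idP/idP=> [/pf pdf|fz']; first exact: dvd_root pz'.
(* The gcd is not constant, since it vanishes at [z']. With [p = h * gcdp p f], minimality of the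
   degree of [p] prevents [h] from vanishing at [z], so the gcd does, and with it [f]. *)
have gz' : root (map_poly (@ratr algC) (gcdp p f)) z'.
  by rewrite gcdp_map root_gcd pz'.
have [h Eh] := dvdpP _ _ (dvdp_gcdl p f).
have : root (map_poly iota p) z := pz.
rewrite {1}Eh rmorphM rootM => /orP[hz|]; last exact/dvd_root/dvdp_gcdr.
have h0 : h != 0 by apply: contraNneq p0 => h0; rewrite Eh h0 mul0r.
have g0 : gcdp p f != 0 by rewrite gcdp_eq0 negb_and p0.
have := minp h h0 hz; rewrite {1}Eh size_mul // -subn1 leq_subLR addnC leq_add2r.
case sg: (size (gcdp p f)) => [|[|m]] //= _.
  by move/eqP: sg; rewrite size_poly_eq0 (negPf g0).
move/eqP/size_poly1P: sg => [c c0 Ec]; move: gz'.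
by rewrite Ec map_polyC rootC fmorph_eq0 (negPf c0).
Qed.

(** A certificate, meaningful over any field, that every complex conjugate of [x] has modulus at
    most [n]: [x] is an eigenvalue of a nonnegative integer matrix with a positive eigenvector [w]
    for [n]. *)
Definition dominated (n : nat) (x : k) :=
  exists (r : nat) (N : 'I_r -> 'I_r -> nat) (w : 'I_r -> nat) (v : 'I_r -> k),
  [/\ exists l, v l != 0, forall l, (0 < w l)%N,
      forall l, (\sum_m N l m * w m = n * w l)%N &
      forall l, x * v l = \sum_m (N l m)%:R * v m].

(** The polynomial is the characteristic polynomial of [N]. A complex root [c] has a left
    eigenvector [u], and the triangle inequality applied to the norm of [u] weighted by [w] gives
    the bound. *)
Lemma dominated_poly n x : dominated n x ->
  exists2 p : {poly rat}, p != 0 & root (map_poly iota p) x /\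
    forall c : algC, root (map_poly (@ratr algC) p) c -> `|c| <= n%:R.
Proof.
case=> r [N [w [v [[l0 vl0] w0 Nw Nv]]]].
pose NM (F : nzRingType) : 'M[F]_r := \matrix_(i, j) (N i j)%:R.
have mapN (F : fieldType) (j : {rmorphism rat -> F}) :
    map_poly j (char_poly (NM _)) = char_poly (NM F).
  rewrite map_char_poly; congr char_poly; apply/matrixP=> i l.
  by rewrite !mxE rmorph_nat.
exists (char_poly (NM _)); first by rewrite -size_poly_eq0 size_char_poly.
rewrite !mapN; split.
  (* [eigenvalue] refers to row vectors, whereas [v] is a column eigenvector. *)
  have -> : char_poly (NM k) = char_poly (NM k)^T.
    rewrite /char_poly -[in LHS]det_tr; congr (\det _); apply/matrixP=> i l.
    by rewrite !mxE eq_sym.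
  rewrite -eigenvalue_root_char; apply/eigenvalueP.
  exists (\row_i v i); last by apply: contraNneq vl0 => /rowP/(_ l0); rewrite !mxE => ->.
  apply/rowP=> l; rewrite !mxE Nv; apply: eq_bigr => m _.
  by rewrite !mxE mulrC.
move=> c; rewrite -eigenvalue_root_char => /eigenvalueP[u Eu u0].
pose S := \sum_m `|u 0 m| * (w m)%:R.
have S0 : 0 < S.
  have [m um] : exists m, u 0 m != 0 by apply/rV0Pn.
  rewrite /S (bigD1 m) //= ltr_pwDl ?mulr_gt0 ?normr_gt0 ?ltr0n //.
  by apply: sumr_ge0 => i _; rewrite mulr_ge0.
rewrite -(ler_pM2r S0) /S mulr_sumr.
apply: le_trans (_ : \sum_m \sum_l `|u 0 l| * (N l m)%:R * (w m)%:R <= _).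
  apply: ler_sum => m _; rewrite -mulr_suml mulrA ler_wpM2r //.
  have := congr1 (fun A : 'rV__ => A 0 m) Eu; rewrite !mxE -normrM => <-.
  apply: le_trans (ler_norm_sum _ _ _) _; apply: ler_sum => l _.
  by rewrite mxE normrM [`|_%:R|]ger0_norm.
rewrite exchange_big mulr_sumr; apply: ler_sum => l _ /=.
under eq_bigr do rewrite -mulrA -natrM.
by rewrite -mulr_sumr -natr_sum Nw natrM mulrCA.
Qed.

(* The [x t] generate a field embedded in [algC], where [|x t| <= n t] by the
   Perron-Frobenius bound. *)
Lemma dominated_rigid (I : finType) (x : I -> k) (n m : I -> nat) :
  (forall t, dominated (n t) (x t)) ->
  \sum_t (m t)%:R * ((n t)%:R - x t) = 0 -> forall t, m t != 0%N -> x t = (n t)%:R.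
Proof.
move=> dom sum0 t0 mt0.
have [|z algz zP] := @primitive_element (codom x).
  by move=> _ /codomP[t ->]; have [p p0 [px _]] := dominated_poly (dom t); exists p.
have {zP} zP t : in_gen z (x t) by apply: zP; apply: codom_f.
pose q t := sval (boolp.cid (zP t)).
have qE t : (map_poly iota (q t)).[z] = x t := svalP (boolp.cid (zP t)).
have [z' conj_z] := algC_conjugate algz.
pose x' t := (map_poly (@ratr algC) (q t)).[z'].
have le_x' t : `|x' t| <= (n t)%:R.
  have [p p0 [px bp]] := dominated_poly (dom t); apply: bp.
  have := conj_z (p \Po q t); rewrite !map_comp_poly /root !horner_comp qE => <-.
  exact: px.
have sum0' : \sum_t (m t)%:R * ((n t)%:R - x' t) = 0.
  pose f := \sum_t (m t)%:R * ((n t)%:R - q t).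
  have fE (F : fieldType) (j : {rmorphism rat -> F}) y : (map_poly j f).[y] =
      \sum_t (m t)%:R * ((n t)%:R - (map_poly j (q t)).[y]).
    rewrite /f rmorph_sum /= horner_sum; apply: eq_bigr => t _.
    by rewrite rmorphM rmorphB /= !rmorph_nat hornerM hornerD hornerN -!polyC_natr !hornerC.
  have := conj_z f; rewrite /root !fE.
  under eq_bigr do rewrite qE.
  by rewrite sum0 eqxx => /esym/eqP.
(* The real parts of the summands are nonnegative and add up to zero, so the summand of [t0] has
   zero real part; the bound on the modulus then leaves no room for an imaginary part. *)
have Re_le t : 'Re (x' t) <= (n t)%:R.
  apply: le_trans (le_x' t); apply: le_trans (leif_normC_Re_Creal (x' t)).
  by apply: real_ler_norm; apply: Creal_Re.
have Re_sum : \sum_t (m t)%:R * ((n t)%:R - 'Re (x' t)) = 0.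
  have /(congr1 (fun z : algC => 'Re z)) := sum0'; rewrite raddf0 raddf_sum => Re0.
  rewrite -[RHS]Re0; apply: eq_bigr => t _ /=.
  rewrite ReMl ?realn // raddfB /=; congr (_ * (_ - _)).
  by rewrite (Creal_ReP _ _) ?realn.
have Re_eq : 'Re (x' t0) = (n t0)%:R.
  move/eqP: Re_sum; rewrite psumr_eq0 => [/allP/(_ t0 (mem_index_enum _))|t _].
    by rewrite mulf_eq0 pnatr_eq0 (negPf mt0) subr_eq0 => /eqP<-.
  by rewrite mulr_ge0 // subr_ge0.
have x'E : x' t0 = (n t0)%:R.
  have [_ E] := leif_normC_Re_Creal (x' t0).
  rewrite -Re_eq; apply/esym/Creal_ReP; rewrite -E eq_le leif_normC_Re_Creal /=.
  by apply: le_trans (le_x' t0) _; rewrite Re_eq; apply/real_ler_norm/realn.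
(* The equality for [x' t0] is the vanishing at [z'] of a rational polynomial, hence it holds at [z]
   as well. *)
have gE (F : fieldType) (j : {rmorphism rat -> F}) y :
    (map_poly j ((n t0)%:R%:P - q t0)).[y] = (n t0)%:R - (map_poly j (q t0)).[y].
  by rewrite rmorphB /= map_polyC /= rmorph_nat hornerD hornerN hornerC.
have := conj_z ((n t0)%:R%:P - q t0).
by rewrite /root !gE qE -/(x' t0) x'E subrr eqxx subr_eq0 => /eqP->.
Qed.

End RatEmbedding.

(** * Characters of tensor products *)

Section HopfCharacters.
Variables (k : fieldType) (H : hopfType k).
Implicit Types (M N : repn H) (f g : dualv H) (a b : H).

(** The functional f (x) g. Through it, values of convolution products are computed by multiplying
    tensors, in place of nested Sweedler sums. *)
Definition ev2 f g (s : tens H H) : k := \tsum_(a, b <- s) (f a * g b : k^o).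

Lemma linear_ev2 f g : linear (ev2 f g : tens H H -> k^o).
Proof. exact: linear_tlift. Qed.

Lemma ev2_pure f g a b : ev2 f g (a \ox b) = f a * g b.
Proof. by rewrite /ev2 tliftE //; apply: bilin_conv. Qed.

Lemma dualM_ev2 f g a : (f * g) a = ev2 f g (comul a).
Proof. exact: dualM. Qed.

Lemma ltr_linear (U V : vectType k) (F : U -> V -> V) :
  (forall v, linear (F^~ v)) -> linear (fun u => ltr (F u) : k^o).
Proof.
move=> lF c u u'; rewrite (eq_ltr (G := fun v => c *: F u v + F u' v)) ?ltrP //.
by move=> v; apply: lF.
Qed.

Lemma ltr_tact M N s :
  ltr (tact s : tens M N -> tens M N) = ev2 (character M) (character N) s.
Proof.
move: s; apply: (tens_ext (Z := k^o) (f := fun s => ltr (tact s : tens M N -> tens M N))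
  (g := ev2 _ _)) => [||a b].
- by apply: ltr_linear => t; apply: linear_tactl.
- exact: linear_ev2.
rewrite ev2_pure !char_ltr.
apply: (ltr_pure (F := act a) (G := act b) (linear_tactr _)) => u v.
exact: tact_pure.
Qed.

Lemma char_tensor M N : character (tensor M N) = character M * character N.
Proof. by apply: dual_ext => a; rewrite char_ltr dualM_ev2 -ltr_tact. Qed.

Lemma char_unit : character (unit_repn H) = 1.
Proof.
apply: dual_ext => a; rewrite (char_scalar (c := counit a)) // dual1.
have -> : dim (k^o : vectType k) = 1%N by [].
by rewrite mulr1.
Qed.

Definition chireg : dualv H := character (reg_repn H).

Lemma chiregE a : chireg a = ltr (fun x : H => a * x).
Proof. exact: char_ltr. Qed.

Section RegTensor.
Variable M : repn H.
Let Am := tens H M.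
Let W (t : Am) : Am :=
  \tsum_(x, m <- t) \tsum_(x1, x2 <- comul x) (x1 \ox act x2 m).
Let V (t : Am) : Am :=
  \tsum_(x, m <- t) \tsum_(x1, x2 <- comul x) (x1 \ox act (antipode x2) m).
Let bW : bilin (fun (x : H) (m : M) => \tsum_(x1, x2 <- comul x) (x1 \ox act x2 m)).
Proof.
split=> [m|x]; first exact: linear_comp (linear_tlift _) (@linear_comul k H).
by apply: linear_in_tlift => x1 x2 c m m'; rewrite act_linr pureDr.
Qed.
Let bV : bilin (fun (x : H) (m : M) => \tsum_(x1, x2 <- comul x) (x1 \ox act (antipode x2) m)).
Proof.
split=> [m|x]; first exact: linear_comp (linear_tlift _) (@linear_comul k H).
by apply: linear_in_tlift => x1 x2 c m m'; rewrite act_linr pureDr.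
Qed.
Let bp (m : M) (F : H -> H) : linear F -> bilin (fun x y : H => x \ox act (F y) m).
Proof.
move=> lF; split=> [y|x]; first exact: linear_purel.
by apply: linear_comp (linear_purer _) (linear_comp (act_linl m) lF).
Qed.

Let WV t : W (V t) = t.
Proof.
move: t; apply: (tens_ext (f := fun t => W (V t)) (g := id)) => // [|x m].
  exact: linear_comp (linear_tlift _) (linear_tlift _).
rewrite /V tliftE // /W (tlift_lin _ _ (linear_tlift _)).
under eq_tlift => x1 x2 do rewrite tliftE //.
rewrite (comul_coassocE (F := fun x y z => x \ox act y (act (antipode z) m))); first last.
- move=> u v; apply: linear_comp (linear_purer _) (linear_comp (act_linr v) _).
  exact: linear_comp (act_linl m) (@linear_antipode k H).
- by move=> u v; apply: linear_comp (linear_purer _) (act_linl _).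
- by move=> u v; apply: linear_purel.
transitivity (\tsum_(x1, x2 <- comul x) (counit x2 *: (x1 \ox m))).
  apply: eq_tlift => x1 x2.
  under eq_tlift => y1 y2 do rewrite -actMm.
  have lf : linear (fun h : H => x1 \ox act h m).
    exact: linear_comp (linear_purer _) (act_linl m).
  rewrite -(tlift_lin _ _ lf) antipoder /= actZl act1m.
  exact: linfZ (linear_purer _).
by rewrite (counitrE (F := fun y => y \ox m)) //; apply: linear_purel.
Qed.

Let VW t : V (W t) = t.
Proof.
move: t; apply: (tens_ext (f := fun t => V (W t)) (g := id)) => // [|x m].
  exact: linear_comp (linear_tlift _) (linear_tlift _).
rewrite /W tliftE // /V (tlift_lin _ _ (linear_tlift _)).
under eq_tlift => x1 x2 do rewrite tliftE //.
rewrite (comul_coassocE (F := fun x y z => x \ox act (antipode y) (act z m))); first last.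
- by move=> u v; apply: linear_comp (linear_purer _) (linear_comp (act_linr _) (act_linl m)).
- move=> u v; apply: linear_comp (linear_purer _) _.
  exact: linear_comp (act_linl _) (@linear_antipode k H).
- by move=> u v; apply: linear_purel.
transitivity (\tsum_(x1, x2 <- comul x) (counit x2 *: (x1 \ox m))).
  apply: eq_tlift => x1 x2.
  under eq_tlift => y1 y2 do rewrite -actMm.
  have lf : linear (fun h : H => x1 \ox act h m).
    exact: linear_comp (linear_purer _) (act_linl m).
  rewrite -(tlift_lin _ _ lf) antipodel /= actZl act1m.
  exact: linfZ (linear_purer _).
by rewrite (counitrE (F := fun y => y \ox m)) //; apply: linear_purel.
Qed.

(* [H (x) M] is a sum of copies of [H], through [x (x) m |-> x1 (x) x2 m]. *)
Lemma chireg_char : chireg * character M = (dim M)%:R *: chireg.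
Proof.
apply: dual_ext => a; rewrite scale_lfunE dualM_ev2 -ltr_tact.
pose L := tact (M := reg_repn H) (N := M).
have LW t : L (comul a) (W t) = W (L (a \ox 1) t).
  move: t; apply: (tens_ext (f := fun t => L (comul a) (W t))
    (g := fun t => W (L (a \ox 1) t))) => [||x m].
  - by apply: (linear_comp (f := L (comul a)) (g := W));
    [apply: linear_tactr | apply: linear_tlift].
  - by apply: (linear_comp (f := W) (g := L (a \ox 1)));
    [apply: linear_tlift | apply: linear_tactr].
  rewrite /L tact_pure act1m /W !tliftE // (tlift_lin _ _ (linear_tactr _)) comulME; last first.
    exact: (bp m (F := id)).
  rewrite -[comul a in LHS]tens_sum.
  under eq_tlift => x1 x2 do rewrite (tlift_lin _ _ (linear_tactl _)).
  rewrite tlift_exch; apply: eq_tlift => y1 y2; apply: eq_tlift => x1 x2.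
  by rewrite tact_pure actMm.
rewrite (eq_ltr (G := W \o (L (a \ox 1) \o V))); last by move=> t /=; rewrite -LW WV.
have lLV : linear (L (a \ox 1) \o V).
  by apply: (linear_comp (f := L (a \ox 1)) (g := V));
    [apply: linear_tactr | apply: linear_tlift].
rewrite (ltrC (F := W) (linear_tlift _) lLV).
rewrite (eq_ltr (G := L (a \ox 1))); last by move=> t /=; rewrite VW.
rewrite ltr_tact ev2_pure char1; exact: mulrC.
Qed.
End RegTensor.

Lemma chireg_sq : chireg * chireg = (dim H)%:R *: chireg.
Proof. exact: chireg_char. Qed.

End HopfCharacters.

(** * Integrals and the Larson-Radford theorem *)

Section Involution.
Variables (k : fieldType) (char0 : [pchar k] =i pred0).

Lemma char0_natr_inj m n : m%:R = n%:R :> k -> m = n.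
Proof.
wlog le_mn : m n / (m <= n)%N => [H E|E].
  by case/orP: (leq_total m n) => le; [apply: H | apply/esym/H].
apply/eqP; rewrite eqn_leq le_mn -subn_eq0 -((pcharf0P k).1 char0) natrB // E.
by rewrite subrr eqxx.
Qed.

Lemma ltr_tlift (U W V : vectType k) (t : tens U W) (g : U -> W -> V -> k)
    (v : U -> W -> V) (F : V -> V) :
  (forall p q, linear (g p q : V -> k^o)) ->
  (forall x, F x = \tsum_(p, q <- t) (g p q x *: v p q)) ->
  ltr F = \tsum_(p, q <- t) (g p q (v p q) : k^o).
Proof.
move=> lg FE; rewrite (ltrE (I := ('I_(dim U) * 'I_(dim W))%type)
  (g := fun p x => (t : 'M_(_, _)) p.1 p.2 * g (bas p.1) (bas p.2) x)
  (v := fun p => v (bas p.1) (bas p.2))).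
- by rewrite tlift_pair.
- by move=> p c x y; rewrite lg mulrDr; congr (_ + _); apply: mulrCA.
- by move=> x; rewrite FE tlift_pair; apply: eq_bigr => p _; rewrite scalerA.
Qed.

Section Half.
Variables (V : vectType k) (s T : V -> V).
Hypotheses (ls : linear s) (lT : linear T) (ss : forall x, s (s x) = x).
Hypotheses (TT : forall x, T (T x) = T x) (sT : forall x, s (T x) = T (s x)).

Let n2 : 2%:R != 0 :> k. Proof. by rewrite ((pcharf0P k).1 char0). Qed.

(** The projection onto the fixed space of the involution [s]; its trace counts the eigenvalue 1. *)
Definition half (x : V) := 2%:R^-1 *: (x + s x).

Lemma linear_half : linear half.
Proof.
move=> c x y; by rewrite /half ls addrACA -scalerDr [LHS]scalerDr scalerA mulrC -scalerA.
Qed.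

Lemma half_id x : s x = x -> half x = x.
Proof. by move=> sx; rewrite /half sx -mulr2n -scaler_nat scalerA mulVf // scale1r. Qed.

Lemma s_half x : s (half x) = half x.
Proof.
rewrite /half (linfZ _ _ ls); congr (_ *: _).
by have := ls 1 x (s x); rewrite !scale1r ss addrC => ->; rewrite addrC.
Qed.

Lemma half_idem x : half (half x) = half x.
Proof. exact/half_id/s_half. Qed.

Lemma half_trace : exists2 n, (dim V)%:R + ltr s = 2%:R * n%:R &
  n = 0%N -> forall x, half x = 0.
Proof.
have [n En n0] := ltr_idem linear_half half_idem; exists n => //.
by rewrite -En /half ltrZ ltrD ltr_id mulrA divff // mul1r.
Qed.

Lemma half_trace_comp : exists n, ltr T + ltr (s \o T) = 2%:R * n%:R.
Proof.
have [||n En _] := @ltr_idem _ V (half \o T).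
- exact: linear_comp linear_half lT.
- move=> x /=; rewrite {2}/half (linfZ _ _ lT).
  have := lT 1 (T x) (s (T x)); rewrite !scale1r => ->.
  by rewrite TT -sT TT -/(half (T x)) half_idem.
exists n; rewrite -En /half /= ltrZ ltrD mulrA divff // mul1r.
by [].
Qed.
End Half.

(* With [p] and [q] the multiplicities of the eigenvalues 1 and -1 of [s], and
   [p'] and [q'] those of its restriction to the image of [T], the hypothesis
   reads [p - q = (p + q) (p' - q')]. *)
Lemma involution_trace_id (V : vectType k) (s T : V -> V) :
  linear s -> linear T -> (forall x, s (s x) = x) ->
  (forall x, T (T x) = T x) -> (forall x, s (T x) = T (s x)) ->
  ltr s = (dim V)%:R * ltr (s \o T) -> ltr s != 0 ->
  (exists2 v, v != 0 & s v = v) -> forall x, s x = x.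
Proof.
move=> ls lT ss TT sT trE tr0 [v v0 sv]; pose s' x := - s x.
have ls' : linear s' by move=> c x y; rewrite /s' ls opprD scalerN.
have sN x : s (- x) = - s x by rewrite -scaleN1r (linfZ _ _ ls) scaleN1r.
have ss' x : s' (s' x) = x by rewrite /s' sN opprK.
have TN x : T (- x) = - T x by rewrite -scaleN1r (linfZ _ _ lT) scaleN1r.
have sT' x : s' (T x) = T (s' x) by rewrite /s' sT TN.
have [p Ep p0] := half_trace ls ss; have [q Eq q0] := half_trace ls' ss'.
have [p' Ep'] := half_trace_comp ls lT ss TT sT.
have [q' Eq'] := half_trace_comp ls' lT ss' TT sT'.
have n2 : 2%:R != 0 :> k by rewrite ((pcharf0P k).1 char0).
have trN : ltr s' = - ltr s by apply: ltrN.
have trN' : ltr (s' \o T) = - ltr (s \o T) by apply: ltrN.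
rewrite trN in Eq; rewrite trN' in Eq'.
have Epq : (p + q = dim V)%N.
  apply: char0_natr_inj; apply: (mulfI n2); rewrite natrD mulrDr -Ep -Eq.
  by rewrite addrACA subrr addr0 -mulr2n mulr_natl.
have Ed : ltr s = p%:R - q%:R.
  apply: (mulfI n2); rewrite mulrBr -Ep -Eq opprB addrC addrA subrK.
  by rewrite mulr_natl.
have Ed' : ltr (s \o T) = p'%:R - q'%:R.
  apply: (mulfI n2); rewrite mulrBr -Ep' -Eq' opprB addrC addrA subrK.
  by rewrite mulr_natl.
have pq : (p + dim V * q' = q + dim V * p')%N.
  apply: char0_natr_inj; apply/eqP; rewrite !natrD !natrM -subr_eq0 opprD addrACA.
  by rewrite -mulrBr -[q'%:R - _]opprB mulrN -Ed -Ed' trE subrr.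
have pq0 : p <> q by move=> E; rewrite Ed E subrr eqxx in tr0.
have p1 : (0 < p)%N.
  rewrite lt0n; apply: contraNneq v0 => /p0/(_ v).
  by rewrite half_id // => ->.
(* By [pq], [p - q] is a nonzero multiple of [p + q], which forces one of [p] and [q] to vanish, and
   [p] is positive. *)
have q1 : q = 0%N.
  rewrite -Epq in pq; have [le|lt] := leqP p' q'.
    have [t Et] : exists t, q' = (p' + t)%N by exists (q' - p')%N; rewrite subnKC.
    by case: t Et => [|t] Et; subst q'; nia.
  have [t Et] : exists t, p' = (q' + t.+1)%N by exists (p' - q').-1; lia.
  by subst p'; nia.
move=> x; have := q0 q1 x; rewrite /half => /eqP.
by rewrite scaler_eq0 invr_eq0 (negPf n2) subr_eq0 => /eqP.
Qed.
End Involution.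

Section Antipode.
Variables (k : fieldType) (H : hopfType k).
Implicit Types (f g : dualv H) (a b x y : H).
Local Notation S := (@antipode k H).

Lemma tens_ev2 (s t : tens H H) : (forall f g, ev2 f g s = ev2 f g t) -> s = t.
Proof.
have E (i j : 'I_(dim H)) (r : tens H H) :
    ev2 (dual_bas i) (dual_bas j) r = (r : 'M_(_, _)) i j.
  rewrite /ev2 tlift_pair (bigD1 (i, j)) //= !dual_basE !v2r_bas !eqxx big1 => [|[i' j']].
    by rewrite addr0; apply: etrans (mulr1 _); congr (_ * _); apply: mulr1.
  rewrite xpair_eqE negb_and !dual_basE !v2r_bas /= => /orP[]/negPf->.
    by rewrite mul0r; apply: mulr0.
  by rewrite mulr0; apply: mulr0.
by move=> st; apply/matrixP=> i j; rewrite -!E st.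
Qed.

(** This is [antipodeM] in the dual Hopf algebra, tested against the functionals f (x) g. *)
Lemma comul_antipode (W : lmodType k) (F : H -> H -> W) a : bilin F ->
  \tsum_(x, y <- comul (S a)) F x y = \tsum_(x, y <- comul a) F (S y) (S x).
Proof.
move=> bF; have -> : comul (S a) = \tsum_(x, y <- comul a) (S y \ox S x).
  apply: tens_ev2 => f g; rewrite -dualM_ev2 (tlift_lin _ _ (linear_ev2 f g)).
  rewrite -[(f * g) _]dual_antipodeE -[dual_antipode (f * g)]/(antipode (f * g)).
  rewrite antipodeM dualM; apply: (eq_tlift (W := k^o)) => x y.
  rewrite ev2_pure; apply: etrans (mulrC _ _).
  by congr (_ * _); apply: dual_antipodeE.
by rewrite (tlift_lin _ _ (linear_tlift F)); apply: eq_tlift => x y; rewrite tliftE.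
Qed.

Lemma counit_antipode a : counit (S a) = counit a.
Proof.
rewrite -{1}[a]counitr (tlift_lin _ _ (@linear_antipode k H)).
have lc : linear (@counit k H : H -> k^o) by move=> c x y; rewrite linearP.
have := congr1 (@counit k H) (antipodel a).
rewrite (linfZ _ _ lc) counit1 => E; rewrite (tlift_lin _ _ lc).
move: E; rewrite (tlift_lin _ _ lc) => E.
transitivity (counit a *: (1 : k^o)); last exact: mulr1.
rewrite -E; apply: (eq_tlift (W := k^o)) => x y; rewrite (linfZ _ _ (@linear_antipode k H)).
by rewrite (linfZ _ _ lc) counitM; apply: mulrC.
Qed.

End Antipode.

(** * One-sided integrals on a Hopf algebra *)

Section Integral.
Variables (k : fieldType) (H : hopfType k).
Implicit Types (f g : dualv H) (a b x y : H).
Local Notation S := (@antipode k H).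
Let lS := @linear_antipode k H.

Variable lam : dualv H.
Let ll b : linear (fun y => lam (b * y) : k^o).
Proof. exact: linear_comp (linear_dual lam) (linear_mull b). Qed.
Let lr b : linear (fun y => lam (y * b) : k^o).
Proof. exact: linear_comp (linear_dual lam) (linear_mulr b). Qed.

Lemma linear_scalev (V W : vectType k) (F : V -> k) (w : W) :
  linear (F : V -> k^o) -> linear (fun v => F v *: w).
Proof. by move=> lF c x y; rewrite lF scalerDl -scalerA. Qed.

Lemma left_integralE a : (forall f, f * lam = f 1 *: lam) ->
  \tsum_(x, y <- comul a) ((lam y : k) *: x) = (lam a : k)%:A.
Proof.
move=> L; apply: dual_sep => f; rewrite (tlift_lin _ _ (linear_dual f)).
have := congr1 (fun g : dualv H => g a) (L f).
rewrite dualM scale_lfunE (linfZ _ _ (linear_dual f)) => E.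
transitivity (f 1 * lam a); last exact: mulrC.
rewrite -[RHS]E; apply: (eq_tlift (W := k^o)) => x y.
by rewrite (linfZ _ _ (linear_dual f)); apply: mulrC.
Qed.

Lemma right_integralE a : (forall f, lam * f = f 1 *: lam) ->
  \tsum_(x, y <- comul a) ((lam x : k) *: y) = (lam a : k)%:A.
Proof.
move=> L; apply: dual_sep => f; rewrite (tlift_lin _ _ (linear_dual f)).
have := congr1 (fun g : dualv H => g a) (L f).
rewrite dualM scale_lfunE (linfZ _ _ (linear_dual f)) => E.
transitivity (f 1 * lam a); last exact: mulrC.
rewrite -[RHS]E; apply: (eq_tlift (W := k^o)) => x y.
by rewrite (linfZ _ _ (linear_dual f)).
Qed.

Section Left.
Hypothesis L : forall f, f * lam = f 1 *: lam.

(** Replace [lam (a2 * b)] by the sum of [lam (a3 * b2) *: (a2 * b1)], which the integral property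
    allows, and cancel [S a1] against [a2]. *)
Lemma left_integral_shift a b :
  \tsum_(x, y <- comul a) ((lam (y * b) : k) *: S x) = \tsum_(x, y <- comul b)
    ((lam (a * y) : k) *: x).
Proof.
transitivity (\tsum_(x, y <- comul a) \tsum_(u, v <- comul y)
    \tsum_(p, q <- comul b) ((lam (v * q) : k) *: (S x * (u * p)))).
  apply: eq_tlift => x y; rewrite -[S x in LHS]mulr1 scalerAr -left_integralE //.
  rewrite (tlift_lin _ _ (linear_mull _)) comulME.
    apply: eq_tlift => u v; apply: eq_tlift => p q.
    by rewrite -scalerAr.
  split=> [v|u]; last exact: linear_comp (linear_mull _) (linear_scalev _ (linear_dual lam)).
  exact: linear_comp (linear_mull _) (scale_linear _).
rewrite -(comul_coassocE (F := fun x u v => \tsum_(p, q <- comul b)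
  ((lam (v * q) : k) *: (S x * (u * p))))).
- rewrite -[RHS](counitlE (F := fun a => \tsum_(x, y <- comul b)
  ((lam (a * y) : k) *: x))); last first.
    by apply: linear_in_tlift => x y; apply: linear_scalev.
  apply: eq_tlift => x y; rewrite tlift_exch (tlift_lin _ _ (scale_linear _)).
  apply: eq_tlift => p q; under eq_tlift => u v do rewrite mulrA.
  have lF : linear (fun z => (lam (y * q) : k) *: (z * p)).
    exact: linear_comp (scale_linear _) (linear_mulr p).
  by rewrite -(tlift_lin _ _ lF) antipodel mulr_algl !scalerA mulrC.
- move=> y z; apply: linear_in_tlift => p q.
  by apply: linear_comp (scale_linear _) (linear_comp (linear_mulr _) lS).
- move=> x z; apply: linear_in_tlift => p q.
  by apply: linear_comp (scale_linear _) (linear_comp (linear_mull _) (linear_mulr _)).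
- by move=> x y; apply: linear_in_tlift => p q; apply: linear_scalev.
Qed.

(** Expanding [F x] in a basis allows the fixed multiplier [b] to be replaced by one that depends
    linearly on the first leg. *)
Lemma tlift_left_kernel (t : tens H H) (F : H -> H) : linear F ->
  (forall b, \tsum_(x, y <- t) ((lam (b * y) : k) *: x) = 0) ->
  \tsum_(x, y <- t) (lam (F x * y) : k^o) = 0.
Proof.
move=> lF E.
transitivity (\tsum_(x, y <- t) \sum_i (v2r (F x) 0 i * lam (bas i * y) : k^o)).
  apply: (eq_tlift (W := k^o)) => x y; rewrite {1}[F x]bas_sum mulr_suml.
  rewrite (linf_sum (linear_dual lam)); apply: eq_bigr => i _.
  by rewrite -scalerAl (linfZ _ _ (linear_dual lam)).
transitivity (\sum_i \tsum_(x, y <- t) (v2r (F x) 0 i * lam (bas i * y) : k^o)).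
  rewrite tlift_pair; under [RHS]eq_bigr do rewrite tlift_pair.
  by rewrite exchange_big; apply: eq_bigr => p _; rewrite scaler_sumr.
apply: big1 => i _; have lG : linear (fun x => v2r (F x) 0 i : k^o).
  exact: linear_comp (linear_v2r i) lF.
have := congr1 (fun x => v2r (F x) 0 i) (E (bas i)).
rewrite (tlift_lin _ _ lG) (linf0 lG) => E'; rewrite -[RHS]E'.
by apply: eq_tlift => x y; rewrite (linfZ _ _ lG) mulrC.
Qed.

(** The left kernel of [lam] lies in the kernel of the counit, because the sum of [lam (S a1 * a2)]
    is [counit a]. As it also contains every sum of [f a1 *: a2], whose counit is [f a], all
    functionals vanish on it. *)
Lemma left_integral_nondegenerate a : lam 1 = 1 -> (forall b, lam (b * a) = 0) -> a = 0.
Proof.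
move=> lam1 Ea.
have shift0 x : (forall b, lam (b * x) = 0) ->
    forall b, \tsum_(u, v <- comul x) ((lam (b * v) : k) *: u) = 0.
  move=> Ex b; rewrite -left_integral_shift
    -[RHS](linf0 (linear_tlift (fun _ _ => 0) (U := H) (V := H))).
  rewrite (eq_tlift (b' := fun _ _ => 0)) => [|u v]; last by rewrite Ex scale0r.
  by rewrite !tlift_pair !big1 // => p _; rewrite scaler0.
have eps0 x : (forall b, lam (b * x) = 0) -> counit x = 0.
  move=> Ex; have := tlift_left_kernel lS (shift0 x Ex).
  rewrite -(tlift_lin _ _ (linear_dual lam)) antipodel (linfZ _ _ (linear_dual lam)).
  by rewrite lam1 => <-; rewrite -[LHS]mulr1.
apply: dual_sep => f; rewrite (linf0 (linear_dual f)).
have lc : linear (@counit k H : H -> k^o) by move=> c x y; rewrite linearP.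
pose y := \tsum_(u, v <- comul a) (f u *: v).
have <- : counit y = f a.
  rewrite /y (tlift_lin _ _ lc) -[RHS](counitrE _ (linear_dual f)).
  by apply: (eq_tlift (W := k^o)) => u v; rewrite (linfZ _ _ lc); apply: mulrC.
apply: eps0 => b; rewrite /y (tlift_lin _ _ (ll b)).
have := congr1 f (shift0 a Ea b); rewrite (linf0 (linear_dual f)) => <-.
rewrite (tlift_lin _ _ (linear_dual f)); apply: (eq_tlift (W := k^o)) => u v.
by rewrite (linfZ _ _ (ll b)) (linfZ _ _ (linear_dual f)); apply: mulrC.
Qed.
End Left.

Lemma right_integral_shift a b : (forall f, lam * f = f 1 *: lam) ->
  \tsum_(x, y <- comul a) ((lam (b * x) : k) *: S y) = \tsum_(x, y <- comul b)
    ((lam (x * a) : k) *: y).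
Proof.
move=> R.
transitivity (\tsum_(x, y <- comul a) \tsum_(u, v <- comul x)
    \tsum_(p, q <- comul b) ((lam (p * u) : k) *: ((q * v) * S y))).
  apply: eq_tlift => x y; rewrite -[S y in LHS]mul1r scalerAl -right_integralE //.
  rewrite (tlift_lin _ _ (linear_mulr _)) comulME.
    rewrite tlift_exch; apply: eq_tlift => u v; apply: eq_tlift => p q.
    by rewrite -scalerAl.
  split=> [v|u]; first exact: linear_comp (linear_mulr _) (linear_scalev _ (linear_dual lam)).
  exact: linear_comp (linear_mulr _) (scale_linear _).
rewrite (comul_coassocE (F := fun u v y => \tsum_(p, q <- comul b)
  ((lam (p * u) : k) *: ((q * v) * S y)))).
- rewrite -[RHS](counitrE (F := fun a => \tsum_(x, y <- comul b)
  ((lam (x * a) : k) *: y))); last first.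
    by apply: linear_in_tlift => x y; apply: linear_scalev.
  apply: eq_tlift => x y; rewrite tlift_exch (tlift_lin _ _ (scale_linear _)).
  apply: eq_tlift => p q; under eq_tlift => u v do rewrite -mulrA.
  have lF : linear (fun z => (lam (p * x) : k) *: (q * z)).
    exact: linear_comp (scale_linear _) (linear_mull q).
  by rewrite -(tlift_lin _ _ lF) antipoder mulr_algr !scalerA mulrC.
- by move=> y z; apply: linear_in_tlift => p q; apply: linear_scalev.
- move=> x z; apply: linear_in_tlift => p q.
  by apply: linear_comp (scale_linear _) (linear_comp (linear_mulr _) (linear_mull _)).
- move=> x y; apply: linear_in_tlift => p q.
  by apply: linear_comp (scale_linear _) (linear_comp (linear_mull _) lS).
Qed.

End Integral.

(** * Two normalized integrals and the square of the antipode *)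

Section LarsonRadford.
Variables (k : fieldType) (char0 : [pchar k] =i pred0) (H : hopfType k).
Implicit Types (f g : dualv H) (a b x y : H).
Local Notation S := (@antipode k H).
Let lS := @linear_antipode k H.

Variables (lam : dualv H) (Lam : H).
Hypotheses (L : forall f, f * lam = f 1 *: lam) (lam1 : lam 1 = 1).
Hypotheses (Laml : forall a, a * Lam = counit a *: Lam).
Hypotheses (Lamr : forall a, Lam * a = counit a *: Lam) (eLam : counit Lam = 1).

Let ll b : linear (fun y => lam (b * y) : k^o).
Proof. exact: linear_comp (linear_dual lam) (linear_mull b). Qed.
Let lr b : linear (fun y => lam (y * b) : k^o).
Proof. exact: linear_comp (linear_dual lam) (linear_mulr b). Qed.
Let lc : linear (@counit k H : H -> k^o).
Proof. by move=> c x y; rewrite linearP. Qed.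

Let c0 : k := lam Lam.

Lemma integral_pairing_neq0 : c0 != 0.
Proof.
apply/eqP=> c00; have Lam0 : Lam = 0.
  apply: left_integral_nondegenerate L _ lam1 _ => b.
  by rewrite Laml (linfZ _ _ (linear_dual lam)) -/c0 c00 scaler0.
by have := eLam; rewrite Lam0 linear0 => /eqP; rewrite eq_sym oner_eq0.
Qed.

(** Up to the factor [c0], the coproduct of [Lam] provides dual bases. Both the bijectivity of the
    antipode and the trace formula [integral_trace] rest on them. *)
Lemma integral_dual_basis b :
  \tsum_(x, y <- comul Lam) ((lam (y * b) : k) *: S x) = c0 *: b.
Proof.
rewrite left_integral_shift // -[RHS](counitrE (F := fun b => c0 *: b)); last first.
  exact: scale_linear.
apply: eq_tlift => x y; rewrite Lamr (linfZ _ _ (linear_dual lam)) -/c0.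
by rewrite [RHS]scalerA.
Qed.

Lemma antipode_surj b : exists a, S a = b.
Proof.
exists (c0^-1 *: \tsum_(x, y <- comul Lam) ((lam (y * b) : k) *: x)).
rewrite (linfZ _ _ lS) (tlift_lin _ _ lS) -[RHS]scale1r -(mulVf integral_pairing_neq0).
rewrite -scalerA -integral_dual_basis; congr (_ *: _); apply: eq_tlift => x y.
by rewrite (linfZ _ _ lS).
Qed.

Lemma antipode_inj : injective S.
Proof.
pose h := linfun S; have hE a : h a = S a by rewrite lfunE.
suff /lker0P hI : lker h == 0%VS by move=> a b E; apply: hI; rewrite !hE.
have := limg_ker_dim h fullv; rewrite capfv (_ : limg h = fullv) => [/eqP|].
  by rewrite -[X in _ == X]add0n eqn_add2r dimv_eq0.
apply/vspaceP=> b; rewrite memvf; have [a <-] := antipode_surj b.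
by rewrite -hE memv_img ?memvf.
Qed.

Lemma dual_antipode_surj f : exists g, antipode g = f.
Proof.
have bS : bijective S by apply: inj_surj_bij; [apply: antipode_inj | apply: antipode_surj].
case: bS => T ST TS; have lT := linear_can lS ST TS.
exists (dual_of (f \o T)); apply: dual_ext => a.
have lfT : linear (f \o T : H -> k^o) by apply: linear_comp lT; apply: linear_dual.
apply: etrans (dual_antipodeE _ _) _.
by rewrite (dual_ofE lfT) /= ST.
Qed.

(** [antipode lam] is a right integral and [lam] a left one; their product, computed with either
    property, is each of the two. *)
Lemma antipode_lam : antipode lam = lam.
Proof.
have E1 f : antipode f 1 = f 1 by rewrite [LHS]dual_antipodeE antipode1.
have R f : antipode lam * antipode f = f 1 *: antipode lam.
  by rewrite -antipodeM L linearZ.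
have [f Ef] := dual_antipode_surj lam.
have := R f; rewrite Ef L E1 lam1 -[f 1]E1 Ef lam1 !scale1r.
by [].
Qed.

Lemma lamS a : lam (S a) = lam a.
Proof. by rewrite -[in RHS]antipode_lam [RHS]dual_antipodeE. Qed.

Lemma right_integral f : lam * f = f 1 *: lam.
Proof.
have [g <-] := dual_antipode_surj f; rewrite -[in LHS]antipode_lam -antipodeM L linearZ.
by rewrite /= antipode_lam [in RHS]dual_antipodeE antipode1.
Qed.

Lemma right_dual_basis b :
  \tsum_(x, y <- comul Lam) ((lam (b * x) : k) *: S y) = c0 *: b.
Proof.
rewrite right_integral_shift; last exact: right_integral.
rewrite -[RHS](counitlE (F := fun b => c0 *: b)); last exact: scale_linear.
apply: eq_tlift => x y; rewrite Laml (linfZ _ _ (linear_dual lam)) -/c0.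
by rewrite [RHS]scalerA.
Qed.

(* Both sides are computed from \sum lam(a Lam1) lam(Lam2 b). *)
Lemma lam_antipode_sym a b : lam (b * S a) = lam (S b * a).
Proof.
apply: (mulfI integral_pairing_neq0).
transitivity (\tsum_(x, y <- comul Lam) (lam (a * x) * lam (y * b) : k^o)).
  have := congr1 (fun z => lam (z * S a)) (integral_dual_basis b).
  rewrite /= -scalerAl (linfZ _ _ (linear_dual lam)) => E; apply: etrans (esym E) _.
  rewrite (tlift_lin _ _ (lr (S a))); apply: (eq_tlift (W := k^o)) => x y.
  rewrite (linfZ _ _ (lr (S a))) -antipodeM lamS; exact: mulrC.
have := congr1 (fun z => lam (S b * z)) (right_dual_basis a).
rewrite /= -scalerAr (linfZ _ _ (linear_dual lam)) => E; apply: etrans _ E.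
rewrite (tlift_lin _ _ (ll (S b))); apply: (eq_tlift (W := k^o)) => x y.
by rewrite (linfZ _ _ (ll (S b))) -antipodeM lamS.
Qed.

(** The square of the antipode is a Nakayama automorphism of the form defined by [lam]; it can be
    put on either factor, in this lemma and the next. *)
Lemma lam_Nakayama_l a b : lam (a * b) = lam (S (S b) * a).
Proof. by rewrite -lamS antipodeM lam_antipode_sym. Qed.

Lemma lam_Nakayama_r a b : lam (a * b) = lam (b * S (S a)).
Proof. by rewrite -lamS antipodeM -lam_antipode_sym. Qed.

(** [lam (b * S (S a))] equals both [lam (a * b)] and [lam (S (S (S (S a))) * b)]. Injectivity of
    [S] is used twice beforehand so that the difference appears on the right of [b], where
    nondegeneracy applies. *)
Lemma antipode4 a : S (S (S (S a))) = a.
Proof.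
apply: antipode_inj; apply: antipode_inj; apply/eqP; rewrite -subr_eq0; apply/eqP.
apply: left_integral_nondegenerate L _ lam1 _ => b.
rewrite mulrBr -scaleN1r addrC (linear_dual lam) -!lam_Nakayama_r.
by rewrite -(lam_Nakayama_l b (S (S a))) -lam_Nakayama_r scaleN1r addNr.
Qed.

Lemma integral_trace (F : H -> H) : linear F ->
  c0 * ltr F = \tsum_(x, y <- comul Lam) (lam (y * F (S x)) : k^o).
Proof.
move=> lF; rewrite (ltr_tlift (t := comul Lam)
  (g := fun x y z => c0^-1 * lam (y * z)) (v := fun x y => F (S x))).
- rewrite (tlift_lin _ _ (linear_mull (A := k^o) c0)); apply: (eq_tlift (W := k^o)) => x y.
  by rewrite mulrA divff ?mul1r // integral_pairing_neq0.
- move=> x y; apply: linear_comp (linear_mull (A := k^o) c0^-1) (ll y).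
- move=> z; rewrite -[z in LHS]scale1r -(mulVf integral_pairing_neq0) -scalerA.
  rewrite -integral_dual_basis (linfZ _ _ lF) (tlift_lin _ _ lF) (tlift_lin _ _ (scale_linear _)).
  by apply: eq_tlift => x y; rewrite (linfZ _ _ lF) scalerA.
Qed.

Lemma integral_trace_S2 : c0 * ltr (S \o S) = 1.
Proof.
rewrite integral_trace; last exact: linear_comp lS lS.
transitivity (\tsum_(x, y <- comul Lam) (lam (S x * y) : k^o)).
  by apply: (eq_tlift (W := k^o)) => x y; rewrite -lam_Nakayama_r.
rewrite -(tlift_lin _ _ (linear_dual lam)) antipodel (linfZ _ _ (linear_dual lam)).
by rewrite eLam lam1 scale1r.
Qed.

Lemma antipode_Lam : S Lam = Lam.
Proof.
have E : S Lam * Lam = S Lam.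
  have [a Ea] := antipode_surj Lam.
  by rewrite -[X in _ * X]Ea -antipodeM Laml -counit_antipode Ea eLam scale1r.
by rewrite -E Laml counit_antipode eLam scale1r.
Qed.

Lemma chireg_Lam : chireg H Lam = 1.
Proof.
rewrite chiregE (ltrE (I := unit) (g := fun _ => @counit k H) (v := fun=> Lam)) //.
  by rewrite (big_pred1 tt) // => -[].
by move=> x; rewrite (big_pred1 tt) => [|[]].
Qed.

Let n : k := (dim H)%:R.

Lemma dim_neq0 : n != 0.
Proof.
apply: contraNneq (oner_neq0 H) => /eqP; rewrite ((pcharf0P k).1 char0) -dimvf dimv_eq0.
by move=> /eqP H0; have := memvf (1 : H); rewrite H0 memv0.
Qed.

Let e : dualv H := n^-1 *: chireg H.
Let T a := \tsum_(x, y <- comul a) ((e y : k) *: x).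

Lemma chireg_S2 a : chireg H (S (S a)) = chireg H a.
Proof.
pose F x := S (S (a * S (S x))).
rewrite !chiregE (eq_ltr (G := (S \o S) \o (fun x => a * S (S x)))) => [|x /=]; last first.
  by rewrite !antipodeM antipode4.
rewrite ltrC; first last.
- exact: linear_comp (linear_mull a) (linear_comp lS lS).
- exact: linear_comp lS lS.
by apply: eq_ltr => x /=; rewrite antipode4.
Qed.

(* [Tr(S^2) = dim H * Tr(S^2 T)] for the projection [T a = \sum e(a2) a1]
   defined by the idempotent [e] of [H*], so that [Tr(S^2)], which is not zero,
   is a multiple of [dim H]. *)
Theorem Larson_Radford a : S (S a) = a.
Proof.
have ee : e * e = e.
  rewrite /e -scalerAl -scalerAr chireg_sq -/n; congr (_ *: _).
  by rewrite scalerA mulVf ?dim_neq0 // scale1r.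
have lT : linear T.
  exact: linear_comp (linear_tlift _) (@linear_comul k H).
have eS x : e (S (S x)) = e x by rewrite /e !scale_lfunE chireg_S2.
have bT : bilin (fun x y => (e y : k) *: x).
  by split=> z; [apply: scale_linear | apply: linear_scalev; apply: linear_dual].
have bT' : bilin (fun x y => (e (S x) : k) *: S y).
  split=> z; first by apply: linear_scalev; apply: linear_comp (linear_dual e) lS.
  exact: linear_comp (scale_linear _) lS.
apply: (@involution_trace_id k char0 H (S \o S) T) => [||x|x|x|||].
- exact: linear_comp lS lS.
- exact: lT.
- exact: antipode4.
- rewrite /T (tlift_lin _ _ (@linear_comul k H)) (tlift_lin _ _ (linear_tlift _)).
  transitivity (\tsum_(a, b <- comul x) \tsum_(a1, a2 <- comul a)
     (((e a2 : k) * e b) *: a1)).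
    apply: eq_tlift => u v; rewrite (linfZ _ _ (@linear_comul k H)) (linfZ _ _ (linear_tlift _)).
    rewrite (tlift_lin _ _ (scale_linear _)); apply: eq_tlift => u1 u2.
    by rewrite scalerA mulrC.
  rewrite (comul_coassocE (F := fun u v w => ((e v : k) * e w) *: u)).
  - apply: eq_tlift => u v; rewrite -[in RHS]ee dualM.
    by rewrite (tlift_lin _ _ (scale_linearl u)).
  - by move=> y z; apply: scale_linear.
  - move=> u w; apply: linear_scalev.
    by apply: linear_comp (linear_mulr (A := k^o) _) (linear_dual e).
  - move=> u w; apply: linear_scalev.
    by apply: linear_comp (linear_mull (A := k^o) _) (linear_dual e).
- rewrite /T /= comul_antipode // comul_antipode //.
  by rewrite !(tlift_lin _ _ lS); apply: eq_tlift => u v; rewrite eS !(linfZ _ _ lS).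
(* Multiplied by [c0], the left side is 1. On the right, coassociativity brings [S u * v] together
   and reduces the trace to [e Lam], which is the inverse of [n]. *)
- apply: (mulfI integral_pairing_neq0); rewrite integral_trace_S2 mulrCA integral_trace; last first.
    exact: linear_comp (linear_comp lS lS) lT.
  have -> : \tsum_(x, y <- comul Lam) (lam (y * ((S \o S) \o T) (S x)) : k^o) = e Lam.
    transitivity (\tsum_(x, y <- comul Lam) \tsum_(u, v <- comul x)
        (e (S u) * lam (S v * y) : k^o)).
      apply: (eq_tlift (W := k^o)) => x y; rewrite /T /= comul_antipode //.
      rewrite !(tlift_lin _ _ lS) (tlift_lin _ _ (ll y)).
      apply: (eq_tlift (W := k^o)) => u v; rewrite !(linfZ _ _ lS) (linfZ _ _ (ll y)).
      by rewrite -lam_Nakayama_r.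
    have leS : linear (e \o S : H -> k^o) by exact: linear_comp (linear_dual e) lS.
    transitivity (\tsum_(x, y <- comul Lam) \tsum_(u, v <- comul y)
        (e (S x) * lam (S u * v) : k^o)).
      apply: (comul_coassocE (F := fun u v y => e (S u) * lam (S v * y) : k^o)).
      - by move=> v y; apply: linear_comp (linear_mulr (A := k^o) _) leS.
      - move=> u y; apply: linear_comp (linear_mull (A := k^o) _) _.
        exact: linear_comp (lr y) lS.
      - by move=> u v; apply: linear_comp (linear_mull (A := k^o) _) (ll _).
    rewrite -[in RHS]antipode_Lam -[RHS](counitrE Lam leS).
    apply: (eq_tlift (W := k^o)) => x y.
    rewrite -(tlift_lin _ _ (linear_mull (A := k^o) (e (S x)))).
    rewrite -(tlift_lin _ _ (linear_dual lam)) antipodel (linfZ _ _ (linear_dual lam)).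
    by rewrite lam1; apply: etrans (mulrC _ _) _; congr (_ * _); apply: mulr1.
  by rewrite /e scale_lfunE chireg_Lam -[n^-1 *: _]/(n^-1 * 1) mulr1 divff ?dim_neq0.
- apply: contraTneq (oner_neq0 k) => E; have := integral_trace_S2.
  by rewrite E mulr0 => <-; rewrite eqxx.
- by exists 1; rewrite ?oner_neq0 //= !antipode1.
Qed.

Lemma lam_sym a b : lam (a * b) = lam (b * a).
Proof. by rewrite lam_Nakayama_r Larson_Radford. Qed.

(** The trace formula for left multiplication by [a], with the arguments of [lam] permuted
    cyclically, collapses to [lam a]; evaluating at 1 gives [c0 * n = 1]. *)
Lemma chireg_lam : chireg H = n *: lam.
Proof.
have E a : c0 * chireg H a = lam a.
  rewrite chiregE integral_trace; last exact: linear_mull.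
  transitivity (\tsum_(x, y <- comul Lam) (lam (a * (S x * y)) : k^o)).
    by apply: (eq_tlift (W := k^o)) => x y; rewrite [LHS]lam_sym -mulrA.
  rewrite -(tlift_lin (fun x y => S x * y) _ (ll a)) antipodel (linfZ _ _ (ll a)) mulr1 eLam.
  exact: mul1r.
have En : c0 * n = 1 by rewrite -lam1 -E /chireg char1.
apply: dual_ext => a; rewrite scale_lfunE -E -[RHS]/(n * (c0 * _)).
by rewrite mulrA [n * _]mulrC En mul1r.
Qed.

End LarsonRadford.

(** * The Drinfeld map and the double braiding *)

Section Quasitriangular.
Variables (k : fieldType) (H : hopfType k) (R : tens H H).
Implicit Types (f g : dualv H) (a b x y : H) (s t : tens H H).
Hypothesis qtR : quasitriangular R.
Local Notation S := (@antipode k H).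
Let lS := @linear_antipode k H.
Let lc : linear (@counit k H : H -> k^o).
Proof. by move=> c x y; rewrite linearP. Qed.

Let Q := tswap R * R.
Local Notation phi := (drinfeld R).

Lemma bilin_swap (U V W : vectType k) (b : U -> V -> W) :
  bilin b -> bilin (fun v u => b u v).
Proof. by case. Qed.

Lemma tswap_pure (U V : vectType k) (u : U) (v : V) : tswap (u \ox v) = v \ox u.
Proof. by rewrite /tswap tliftE //; apply: bilin_swap (bilin_pure _ _). Qed.

Lemma linear_tswap (U V : vectType k) : linear (@tswap k U V).
Proof. exact: linear_tlift. Qed.

Lemma tswapK (U V : vectType k) (t : tens U V) : tswap (tswap t) = t.
Proof.
move: t; apply: (tens_ext (f := fun t : tens U V => tswap (tswap t)) (g := id)) => // [|u v].
  exact: linear_comp (@linear_tswap _ _) (@linear_tswap _ _).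
by rewrite !tswap_pure.
Qed.

Lemma tswapM s t : tswap (s * t) = tswap s * tswap t.
Proof.
move: s; apply: (tens_ext (f := fun s : tens H H => tswap (s * t))
  (g := fun s : tens H H => tswap s * tswap t)).
- exact: linear_comp (@linear_tswap _ _) (linear_mulr t).
- exact: linear_comp (linear_mulr _) (@linear_tswap _ _).
move=> a b; move: t; apply: (tens_ext (f := fun t : tens H H => tswap ((a \ox b) * t))
  (g := fun t : tens H H => tswap (a \ox b) * tswap t)).
- exact: linear_comp (@linear_tswap _ _) (linear_mull _).
- exact: linear_comp (linear_mull _) (@linear_tswap _ _).
by move=> a' b'; rewrite pureM !tswap_pure pureM.
Qed.

Lemma Q_comul a : Q * comul a = comul a * Q.
Proof.
have [_ Rc _ _] := qtR; rewrite /Q -mulrA -Rc !mulrA; congr (_ * _).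
by have := congr1 (@tswap k H H) (Rc a); rewrite !tswapM tswapK.
Qed.

Lemma tlift_mul (W : lmodType k) (F : H -> H -> W) s t : bilin F ->
  \tsum_(x, y <- s * t) F x y = \tsum_(x, y <- s) \tsum_(u, v <- t) F (x * u) (y * v).
Proof.
move=> bF; rewrite tmulE (tlift_lin _ _ (linear_tlift F)).
apply: eq_tlift => x y; rewrite (tlift_lin _ _ (linear_tlift F)).
by apply: eq_tlift => u v; rewrite tliftE.
Qed.

Lemma tlift_swap (U V : vectType k) (W : lmodType k) (F : V -> U -> W) (t : tens U V) : bilin F ->
  \tsum_(x, y <- tswap t) F x y = \tsum_(x, y <- t) F y x.
Proof.
move=> bF; rewrite (tlift_lin _ _ (linear_tlift F)).
by apply: eq_tlift => x y; rewrite tliftE.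
Qed.

Lemma tlift_Q (W : lmodType k) (F : H -> H -> W) : bilin F ->
  \tsum_(x, y <- Q) F x y = \tsum_(x, y <- R) \tsum_(u, v <- R) F (y * u) (x * v).
Proof.
move=> bF; rewrite tlift_mul // tlift_swap //.
by have [F1 F2] := bF; split=> z; apply: linear_in_tlift => u v;
  [apply: linear_comp (F1 _) (linear_mulr u) | apply: linear_comp (F2 _) (linear_mulr v)].
Qed.

Section Hexagons.
Variables (W : lmodType k) (F : H -> H -> H -> W).
Hypotheses (F1 : forall y z, linear (fun x => F x y z))
  (F2 : forall x z, linear (fun y => F x y z)) (F3 : forall x y, linear (fun z => F x y z)).

Lemma hexagonl : \tsum_(x, y <- R) \tsum_(x1, x2 <- comul x) F x1 x2 y
  = \tsum_(x, y <- R) \tsum_(u, v <- R) F x u (y * v).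
Proof.
pose G (t : tens H H) (y : H) := \tsum_(x1, x2 <- t) F x1 x2 y.
have bG : bilin G.
  by split=> [y|t]; [apply: linear_tlift | apply: linear_in_tlift].
have [_ _ E _] := qtR; have := congr1 (tlift G) E.
rewrite (tlift_lin _ _ (linear_tlift G)).
under eq_tlift => x y do rewrite tliftE //.
move=> ->; rewrite tmulE (tlift_lin _ _ (linear_tlift G)).
have bE (W' : lmodType k) (B : tens H H -> H -> W') (h : H -> tens H H) : bilin B -> linear h ->
    \tsum_(x, y <- \tsum_(x, y <- R) (h x \ox y)) B x y = \tsum_(x, y <- R) B (h x) y.
  move=> bB lh; rewrite (tlift_lin _ _ (linear_tlift B)).
  by apply: eq_tlift => x y; rewrite tliftE.
rewrite bE; last 2 first.
- split=> z; last first.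
    apply: linear_comp (linear_tlift _) _; apply: linear_in_tlift => x y.
    exact: linear_comp (linear_purer _) (linear_mulr _).
  apply: linear_comp (linear_tlift _) _; apply: linear_in_tlift => x y.
  exact: linear_comp (linear_purel _) (linear_mulr _).
- exact: linear_purel.
apply: eq_tlift => x y; rewrite (tlift_lin _ _ (linear_tlift G)) bE; last 2 first.
- split=> z; apply: linear_comp (linear_tlift _) _.
    exact: linear_comp (linear_purel _) (linear_mull _).
  exact: linear_comp (linear_purer _) (linear_mull _).
- exact: linear_purer.
apply: eq_tlift => u v; rewrite tliftE // pureM mulr1 mul1r /G tliftE //.
Qed.

Lemma hexagonr : \tsum_(x, y <- R) \tsum_(y1, y2 <- comul y) F x y1 y2
  = \tsum_(x, y <- R) \tsum_(u, v <- R) F (x * u) v y.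
Proof.
pose G (x : H) (t : tens H H) := \tsum_(y1, y2 <- t) F x y1 y2.
have bG : bilin G.
  by split=> [t|x]; [apply: linear_in_tlift | apply: linear_tlift].
have [_ _ _ E] := qtR; have := congr1 (tlift G) E.
rewrite (tlift_lin _ _ (linear_tlift G)).
under eq_tlift => x y do rewrite tliftE //.
move=> ->; rewrite tmulE (tlift_lin _ _ (linear_tlift G)).
have bE (W' : lmodType k) (B : H -> tens H H -> W') (h : H -> tens H H) : bilin B -> linear h ->
    \tsum_(x, y <- \tsum_(x, y <- R) (x \ox h y)) B x y = \tsum_(x, y <- R) B x (h y).
  move=> bB lh; rewrite (tlift_lin _ _ (linear_tlift B)).
  by apply: eq_tlift => x y; rewrite tliftE.
rewrite bE; last 2 first.
- split=> z; last first.
    apply: linear_comp (linear_tlift _) _; apply: linear_in_tlift => x y.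
    exact: linear_comp (linear_purer _) (linear_mulr _).
  apply: linear_comp (linear_tlift _) _; apply: linear_in_tlift => x y.
  exact: linear_comp (linear_purel _) (linear_mulr _).
- exact: linear_purer.
apply: eq_tlift => x y; rewrite (tlift_lin _ _ (linear_tlift G)) bE; last 2 first.
- split=> z; apply: linear_comp (linear_tlift _) _.
    exact: linear_comp (linear_purel _) (linear_mull _).
  exact: linear_comp (linear_purer _) (linear_mull _).
- exact: linear_purel.
apply: eq_tlift => u v; rewrite tliftE // pureM mulr1 mul1r /G tliftE //.
Qed.
End Hexagons.

(** The counit on the first leg of the first hexagon axiom yields [(1 \ox r) * R = R], and [R] is
    invertible. *)
Lemma counit_R : \tsum_(x, y <- R) (counit x *: y) = 1 :> H.
Proof.
set r := LHS; have [uR _ _ _] := qtR.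
have E : (1 \ox r) * R = 1 * R.
  rewrite mul1r -[RHS]tens_sum; symmetry.
  transitivity (\tsum_(x, y <- R) \tsum_(x1, x2 <- comul x) (counit x1 *: (x2 \ox y))).
    apply: eq_tlift => x y; rewrite (counitlE (F := fun x => x \ox y)) //.
    exact: linear_purel.
  rewrite (hexagonl (F := fun x1 x2 y => counit x1 *: (x2 \ox y))); first last.
  - by move=> u v; apply: linear_comp (scale_linear _) (linear_purer _).
  - by move=> u v; apply: linear_comp (scale_linear _) (linear_purel _).
  - by move=> u v; apply: linear_scalev.
  rewrite -[R in (1 \ox r) * R]tens_sum (tlift_lin _ _ (linear_mull (1 \ox r))) tlift_exch.
  apply: eq_tlift => u v; rewrite pureM mul1r.
  have lF : linear (fun z => u \ox (z * v)).
    exact: linear_comp (linear_purer _) (linear_mulr _).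
  by rewrite (tlift_lin _ _ lF); apply: eq_tlift => x y; rewrite (linfZ _ _ lF).
have {}E : 1 \ox r = 1 :> tens H H by apply: (mulIr uR).
have := congr1 (tlift (fun x y : H => counit x *: y)) E; rewrite -pure11.
have bF : bilin (fun x y : H => counit x *: y) by apply: bilinl.
by rewrite !tliftE // counit1 !scale1r.
Qed.

Lemma counit_Rr : \tsum_(x, y <- R) (counit y *: x) = 1 :> H.
Proof.
set r := LHS; have [uR _ _ _] := qtR.
have E : R * (r \ox 1) = R * 1.
  rewrite mulr1 -[RHS]tens_sum; symmetry.
  transitivity (\tsum_(x, y <- R) \tsum_(y1, y2 <- comul y) (counit y1 *: (x \ox y2))).
    apply: eq_tlift => x y; rewrite (counitlE (F := fun y => x \ox y)) //.
    exact: linear_purer.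
  rewrite (hexagonr (F := fun x y1 y2 => counit y1 *: (x \ox y2))); first last.
  - by move=> u v; apply: linear_comp (scale_linear _) (linear_purer _).
  - by move=> u v; apply: linear_scalev.
  - by move=> u v; apply: linear_comp (scale_linear _) (linear_purel _).
  rewrite -[R in R * (r \ox 1)]tens_sum (tlift_lin _ _ (linear_mulr (r \ox 1))).
  apply: eq_tlift => u v; rewrite pureM mulr1.
  have lF : linear (fun z => (u * z) \ox v).
    exact: linear_comp (linear_purel _) (linear_mull _).
  by rewrite (tlift_lin _ _ lF); apply: eq_tlift => x y; rewrite (linfZ _ _ lF).
have {}E : r \ox 1 = 1 :> tens H H by apply: (mulrI uR).
have := congr1 (tlift (fun x y : H => counit y *: x)) E; rewrite -pure11.
have bF : bilin (fun x y : H => counit y *: x) by apply: bilinr.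
by rewrite !tliftE // counit1 !scale1r.
Qed.

Lemma counit_drinfeld f : counit (phi f) = f 1.
Proof.
rewrite drinfeldE /drinfeld_fun (tlift_lin _ _ lc).
transitivity (\tsum_(x, y <- Q) (f y * counit x : k^o)).
  by apply: (eq_tlift (W := k^o)) => x y; rewrite (linfZ _ _ lc).
rewrite tlift_Q; last first.
  split=> z; first exact: linear_comp (linear_mull (A := k^o) _) lc.
  exact: linear_comp (linear_mulr (A := k^o) _) (linear_dual f).
transitivity (\tsum_(x, y <- R) (counit y * f x : k^o)).
  apply: (eq_tlift (W := k^o)) => x y.
  have lF : linear (fun z => counit y * f (x * z) : k^o).
    by apply: linear_comp (linear_mull (A := k^o) _) (linear_comp (linear_dual f) (linear_mull x)).
  rewrite -[x in RHS]mulr1 -counit_R (tlift_lin _ _ lF); apply: eq_tlift => u v.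
  rewrite (linfZ _ _ lF) counitM; apply: etrans (mulrC _ _) _.
  by rewrite -[RHS]/(counit u * _) mulrA [counit u * _]mulrC.
rewrite -[in RHS]counit_Rr (tlift_lin _ _ (linear_dual f)); apply: (eq_tlift (W := k^o)) => x y.
by rewrite (linfZ _ _ (linear_dual f)).
Qed.

(** The two hexagons nest one copy of R21 R inside the other: [phi (f * g)] is the sum of
    [f (x * v) *: (y * phi g * u)], and a central [phi g] can be pulled out. *)
Lemma drinfeldM f g : central (phi g) -> phi (f * g) = phi f * phi g.
Proof.
move=> cg; rewrite [in LHS]drinfeldE /drinfeld_fun.
have bF (h : dualv H) : bilin (fun x y : H => (h y : k) *: x) by split=> z;
  [apply: scale_linear | exact: (linear_scalev z (linear_dual h))].
rewrite tlift_Q //.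
pose G x1 x2 y u v1 v2 : H := ((f (x1 * v1) : k) * g (x2 * v2)) *: (y * u).
have G1 x2 y u v1 v2 : linear (fun x1 => G x1 x2 y u v1 v2).
  apply: linear_scalev; apply: linear_comp (linear_mulr (A := k^o) _) _.
  exact: linear_comp (linear_dual f) (linear_mulr _).
have G2 x1 y u v1 v2 : linear (fun x2 => G x1 x2 y u v1 v2).
  apply: linear_scalev; apply: linear_comp (linear_mull (A := k^o) _) _.
  exact: linear_comp (linear_dual g) (linear_mulr _).
have G3 x1 x2 u v1 v2 : linear (fun y => G x1 x2 y u v1 v2).
  exact: linear_comp (scale_linear _) (linear_mulr _).
have G4 x1 x2 y v1 v2 : linear (fun u => G x1 x2 y u v1 v2).
  exact: linear_comp (scale_linear _) (linear_mull _).
have G5 x1 x2 y u v2 : linear (fun v1 => G x1 x2 y u v1 v2).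
  apply: linear_scalev; apply: linear_comp (linear_mulr (A := k^o) _) _.
  exact: linear_comp (linear_dual f) (linear_mull _).
have G6 x1 x2 y u v1 : linear (fun v2 => G x1 x2 y u v1 v2).
  apply: linear_scalev; apply: linear_comp (linear_mull (A := k^o) _) _.
  exact: linear_comp (linear_dual g) (linear_mull _).
transitivity (\tsum_(x, y <- R) \tsum_(x1, x2 <- comul x)
    \tsum_(u, v <- R) \tsum_(v1, v2 <- comul v) G x1 x2 y u v1 v2).
  apply: eq_tlift => x y; rewrite tlift_exch; apply: eq_tlift => u v.
  rewrite dualM comulME; last exact: bilin_conv.
  rewrite (tlift_lin _ _ (scale_linearl (y * u))); apply: eq_tlift => x1 x2.
  by rewrite (tlift_lin _ _ (scale_linearl (y * u))).
rewrite (hexagonl (F := fun x1 x2 y => \tsum_(u, v <- R)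
  \tsum_(v1, v2 <- comul v) G x1 x2 y u v1 v2));
  try by move=> ? ?; do 2![apply: linear_in_tlift => ? ?].
under eq_tlift => x y do under eq_tlift => x' y' do rewrite hexagonr //.
transitivity (\tsum_(x, y <- R) \tsum_(u, v <- R) ((f (x * v) : k) *: (y * phi g * u))).
  apply: eq_tlift => x y.
  transitivity (\tsum_(u', v' <- R) \tsum_(x', y' <- R) \tsum_(u, v <- R)
     G x x' (y * y') (u * u') v' v).
    by rewrite [RHS]tlift_exch; apply: eq_tlift => x' y'; rewrite tlift_exch.
  apply: eq_tlift => u' v'.
  have lF : linear (fun z => (f (x * v') : k) *: (y * z * u')).
    by apply: linear_comp (scale_linear _) (linear_comp (linear_mulr _) (linear_mull _)).
  rewrite drinfeldE /drinfeld_fun (tlift_lin _ _ lF) -/Q tlift_Q; last first.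
    split=> z; first exact: linear_comp lF (scale_linear _).
    exact: linear_comp lF (linear_scalev _ (linear_dual g)).
  apply: eq_tlift => x' y'; apply: eq_tlift => u v.
  by rewrite (linfZ _ _ lF) scalerA mulrC /G !mulrA.
rewrite [in RHS]drinfeldE /drinfeld_fun (tlift_lin _ _ (linear_mulr (phi g)))
  -/Q tlift_Q; last first.
  split=> z; first exact: linear_comp (linear_mulr _) (scale_linear _).
  exact: linear_comp (linear_mulr _) (linear_scalev _ (linear_dual f)).
apply: eq_tlift => x y; apply: eq_tlift => u v.
by rewrite -scalerAl -!mulrA cg.
Qed.


Definition tracelike f := forall a b, f (a * b) = f (b * a).

(** Conjugation by [a] passes through R21 R, which commutes with coproducts. The remaining terms
    cancel through [S c2 * c1], which sums to the counit because the antipode is an involution. *)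
Lemma drinfeld_central f : (forall a, S (S a) = a) -> tracelike f -> central (phi f).
Proof.
move=> SS tf a; rewrite drinfeldE /drinfeld_fun -/Q; symmetry.
have Sr b : \tsum_(x, y <- comul b) (S y * x) = (counit b)%:A.
  have := congr1 S (antipodel b).
  rewrite (linfZ _ _ lS) antipode1 (tlift_lin _ _ lS) => <-; apply: eq_tlift => x y.
  by rewrite antipodeM SS.
pose F (u p q : H) : H := ((f (q * u) : k) *: p).
have bF u : bilin (F u).
  split=> z; first exact: scale_linear.
  by apply: linear_scalev; apply: linear_comp (linear_dual f) (linear_mulr u).
have lF p q : linear (fun u => F u p q).
  by apply: linear_scalev; apply: linear_comp (linear_dual f) (linear_mull q).
have lfp (q w : H) : linear (fun z => (f (q * z) : k) *: w).
  by apply: linear_scalev; apply: linear_comp (linear_dual f) (linear_mull q).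
have bR (w : H -> H) (lw : linear w) : bilin (fun x y : H => (f y : k) *: w x).
  split=> z; last exact: linear_scalev (linear_dual f).
  exact: linear_comp (scale_linear _) lw.
transitivity (\tsum_(b, c <- comul a) \tsum_(p, q <- comul b * Q) F (S c) p q).
  transitivity (\tsum_(p, q <- Q) \tsum_(b, c <- comul a) \tsum_(b1, b2 <- comul b)
      F (S c) (b1 * p) (b2 * q)); last first.
    rewrite tlift_exch; apply: eq_tlift => b c.
    by rewrite tlift_mul // tlift_exch.
  rewrite (tlift_lin _ _ (linear_mull a)); apply: eq_tlift => p q.
  rewrite (comul_coassocE (F := fun b1 b2 c => F (S c) (b1 * p) (b2 * q))); first last.
  - by move=> u v; apply: linear_comp (lF _ _) lS.
  - by move=> u v; apply: linear_comp ((bF _).2 _) (linear_mulr _).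
  - by move=> u v; apply: linear_comp ((bF _).1 _) (linear_mulr _).
  rewrite -[LHS](counitrE (F := fun b => b * ((f q : k) *: p))); last exact: linear_mulr.
  apply: eq_tlift => b c; rewrite -scalerAr.
  transitivity (\tsum_(c1, c2 <- comul c) ((f (q * (S c2 * c1)) : k) *: (b * p))).
    rewrite -(tlift_lin (fun c1 c2 => S c2 * c1) _ (lfp q (b * p))) Sr (linfZ _ _ (lfp q _)).
    by rewrite mulr1.
  by apply: eq_tlift => c1 c2; rewrite /F mulrA tf !mulrA.
transitivity (\tsum_(p, q <- Q) \tsum_(b, c <- comul a) \tsum_(b1, b2 <- comul b)
    F (S c) (p * b1) (q * b2)).
  rewrite [RHS]tlift_exch; apply: eq_tlift => b c.
  by rewrite -Q_comul tlift_mul.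
rewrite (tlift_lin _ _ (linear_mulr a)); apply: eq_tlift => p q.
rewrite (comul_coassocE (F := fun b1 b2 c => F (S c) (p * b1) (q * b2))); first last.
- by move=> u v; apply: linear_comp (lF _ _) lS.
- by move=> u v; apply: linear_comp ((bF _).2 _) (linear_mull _).
- by move=> u v; apply: linear_comp ((bF _).1 _) (linear_mull _).
rewrite -[RHS](counitrE (F := fun b => ((f q : k) *: p) * b)); last exact: linear_mull.
apply: eq_tlift => b c; rewrite -scalerAl.
transitivity (\tsum_(c1, c2 <- comul c) ((f (q * (c1 * S c2)) : k) *: (p * b))).
  by apply: eq_tlift => c1 c2; rewrite /F mulrA.
rewrite -(tlift_lin (fun c1 c2 => c1 * S c2) _ (lfp q (p * b))) antipoder (linfZ _ _ (lfp q _)).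
by rewrite mulr1.
Qed.

Lemma ev2_tracelike f g s t : tracelike f -> tracelike g -> ev2 f g (s * t) = ev2 f g (t * s).
Proof.
move=> tf tg; move: s; apply: (tens_ext (Z := k^o) (f := fun s : tens H H => ev2 f g (s * t))
  (g := fun s : tens H H => ev2 f g (t * s))).
- exact: linear_comp (linear_ev2 f g) (linear_mulr t).
- exact: linear_comp (linear_ev2 f g) (linear_mull t).
move=> a b; move: t; apply: (tens_ext (Z := k^o)
  (f := fun t : tens H H => ev2 f g ((a \ox b) * t))
  (g := fun t : tens H H => ev2 f g (t * (a \ox b)))).
- exact: linear_comp (linear_ev2 f g) (linear_mull _).
- exact: linear_comp (linear_ev2 f g) (linear_mulr _).
by move=> a' b'; rewrite !pureM !ev2_pure tf tg.
Qed.

Lemma tracelikeM f g : tracelike f -> tracelike g -> tracelike (f * g).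
Proof. by move=> tf tg a b; rewrite !dualM_ev2 !comulM ev2_tracelike. Qed.

(** Flipping the legs turns R21 R into R R21, which trace-like functionals do not distinguish. *)
Lemma drinfeld_sym f g : tracelike f -> tracelike g -> f (phi g) = g (phi f).
Proof.
have E (h h' : dualv H) : h (phi h') = ev2 h h' Q.
  rewrite drinfeldE /drinfeld_fun (tlift_lin _ _ (linear_dual h)).
  apply: (eq_tlift (W := k^o)) => x y; rewrite (linfZ _ _ (linear_dual h)).
  exact: mulrC.
move=> tf tg; rewrite !E.
transitivity (ev2 g f (tswap Q)).
  rewrite /ev2 tlift_swap; last exact: bilin_conv.
  by apply: (eq_tlift (W := k^o)) => x y; apply: mulrC.
by rewrite /Q tswapM tswapK ev2_tracelike.
Qed.

Lemma tswap_tact (X Y : repn H) (s : tens H H) (t : tens X Y)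
  : tswap (tact s t) = tact (tswap s) (tswap t).
Proof.
move: t; apply: (tens_ext (f := fun t : tens X Y => tswap (tact s t))
  (g := fun t : tens X Y => tact (tswap s) (tswap t))).
- exact: linear_comp (@linear_tswap _ _) (linear_tactr s).
- exact: linear_comp (linear_tactr _) (@linear_tswap _ _).
move=> x y; move: s; apply: (tens_ext (f := fun s : tens H H => tswap (tact s (x \ox y)))
  (g := fun s : tens H H => tact (tswap s) (tswap (x \ox y)))).
- exact: linear_comp (@linear_tswap _ _) (linear_tactl _).
- exact: linear_comp (linear_tactl _) (@linear_tswap _ _).
by move=> a b; rewrite tact_pure !tswap_pure tact_pure.
Qed.

Section Braiding.
Variables X Y : repn H.

Lemma double_braiding (t : tens X Y) : braiding R (braiding R t) = tact Q t.
Proof. by rewrite /braiding tswap_tact !tswapK -tactM. Qed.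

Lemma tens_sepr (U V : vectType k) (s t : tens U V) :
  (forall f : dualv V, \tsum_(x, y <- s) ((f y : k) *: x)
    = \tsum_(x, y <- t) ((f y : k) *: x)) -> s = t.
Proof.
move=> E; rewrite [s]tens_basr [t]tens_basr; apply: eq_bigr => i _.
congr (_ \ox _); have := E (dual_bas i).
by under eq_tlift do rewrite dual_basE; under [in RHS]eq_tlift do rewrite dual_basE.
Qed.

(** The double braiding is the action of R21 R; contracting its second leg with [f] leaves the
    action of [phi] of a matrix coefficient of [Y]. *)
Lemma double_braiding_id :
  (forall t : tens X Y, braiding R (braiding R t) = t) <->
  (forall (f : dualv Y) (y : Y) (x : X), act (phi (mcoef f y)) x = (f y : k) *: x).
Proof.
have E (f : dualv Y) (y : Y) (x : X) :
    \tsum_(x', y' <- tact Q (x \ox y)) ((f y' : k) *: x') = act (phi (mcoef f y)) x.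
  rewrite drinfeldE /drinfeld_fun -/Q.
  rewrite (tlift_lin _ _ (act_linl x)) -[Q in LHS]tens_sum.
  rewrite (tlift_lin _ _ (linear_tactl (x \ox y))) (tlift_lin _ _ (linear_tlift _)).
  apply: eq_tlift => a b; rewrite tact_pure tliftE ?actZl ?mcoefE //.
  by split=> z; [apply: scale_linear | apply: linear_scalev; apply: linear_dual].
have bf (f : dualv Y) : bilin (fun (x : X) (y : Y) => (f y : k) *: x).
  by split=> z; [apply: scale_linear | apply: linear_scalev; apply: linear_dual].
split=> [H1 f y x|H1 t].
  by rewrite -E -double_braiding H1 tliftE.
rewrite double_braiding; move: t; apply: (tens_ext (f := tact Q) (g := id)) => //.
  exact: linear_tactr.
by move=> x y; apply: tens_sepr => f; rewrite E H1 tliftE.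
Qed.
End Braiding.
End Quasitriangular.

(** * Central idempotents closed under tensor products *)

Section QuotientIdempotent.
Variables (k : fieldType) (char0 : [pchar k] =i pred0) (H : hopfType k).
Implicit Types (f g : dualv H) (a b x y : H).
Local Notation S := (@antipode k H).
Let lS := @linear_antipode k H.
Hypothesis SS : forall a, S (S a) = a.
Local Notation chi := (chireg H).
Hypothesis chir : forall f, chi * f = f 1 *: chi.
Hypothesis chiS : forall a, chi (S a) = chi a.

Variable e : H.
Hypotheses (cie : central_idem e) (ee1 : counit e = 1).
Hypothesis De : comul e * (e \ox e) = e \ox e.

Let ce : central e := cie.1.
Let ee : e * e = e := cie.2.

Lemma chireg_tracelike : tracelike chi.
Proof. by move=> a b; apply: charM. Qed.

Let lml f g (c : tens H H) : linear (fun s : tens H H => ev2 f g (c * s) : k^o).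
Proof. exact: (linear_comp (linear_ev2 f g) (linear_mull c)). Qed.

Let lmr f g (c : tens H H) : linear (fun s : tens H H => ev2 f g (s * c) : k^o).
Proof. exact: (linear_comp (linear_ev2 f g) (linear_mulr c)). Qed.

(* [D(e)(1 (x) e) - e (x) e] is an idempotent of trace 0. *)
Lemma comul_idem_r : comul e * (1 \ox e) = e \ox e.
Proof.
set G := comul e * (1 \ox e) - e \ox e.
have c1e (s : tens H H) : s * (1 \ox e) = (1 \ox e) * s.
  move: s; apply: (tens_ext (f := fun s : tens H H => s * (1 \ox e))
    (g := fun s : tens H H => (1 \ox e) * s)).
  - exact: linear_mulr.
  - exact: linear_mull.
  by move=> a b; rewrite !pureM mulr1 mul1r ce.
have cee (s : tens H H) : s * (e \ox e) = (e \ox e) * s.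
  move: s; apply: (tens_ext (f := fun s : tens H H => s * (e \ox e))
    (g := fun s : tens H H => (e \ox e) * s)).
  - exact: linear_mulr.
  - exact: linear_mull.
  by move=> a b; rewrite !pureM !ce.
have E1 : (1 \ox e) * (e \ox e) = e \ox e :> tens H H by rewrite pureM mul1r ee.
have DD : comul e * (1 \ox e) * (comul e * (1 \ox e)) = comul e * (1 \ox e).
  by rewrite -mulrA (mulrA (1 \ox e)) -c1e -mulrA pureM mul1r ee mulrA -comulM ee.
have Dee : comul e * (1 \ox e) * (e \ox e) = e \ox e by rewrite -mulrA E1.
have GG : G * G = G.
  rewrite /G mulrBr !mulrBl DD -cee Dee pureM ee.
  by rewrite subrr subr0.
have trG : ltr (fun t : tens H H => G * t) = 0.
  have -> : ltr (fun t : tens H H => G * t) = ev2 chi chi G.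
    by rewrite -ltr_tact.
  have lev := linear_ev2 chi chi.
  rewrite /G addrC -scaleN1r lev ev2_pure.
  suff -> : ev2 chi chi (comul e * (1 \ox e)) = chi e * chi e by rewrite scaleN1r addNr.
  (* Moving [1 \ox e] into the second functional gives [(chi * shl e chi) e], which the integral
     property of [chi] evaluates. *)
  transitivity (ev2 chi (shl e chi) (comul e)).
    rewrite c1e; move: (comul e).
    apply: (tens_ext (Z := k^o) (f := fun s : tens H H => ev2 chi chi ((1 \ox e) * s))
      (g := fun s : tens H H => ev2 chi (shl e chi) s)).
    - exact: lml.
    - exact: linear_ev2.
    by move=> a b; rewrite pureM !ev2_pure shlE mul1r.
  rewrite -dualM_ev2 chir shlE mulr1 scale_lfunE.
  by [].
apply/eqP; rewrite -subr_eq0 -/G; apply/eqP; rewrite -[G]mulr1.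
apply: (ltr_idem_eq0 (F := fun t : tens H H => G * t) char0) => //.
- exact: linear_mull.
- by move=> t; rewrite mulrA GG.
Qed.

(** Applying [x \ox y |-> x * S y] to [comul_idem_r] gives [S e = e * S e], and applying [S] to this
    gives the converse absorption. For modules this is closure under duals. *)
Lemma antipode_idem : S e = e.
Proof.
have cSe : central (S e) by move=> a; rewrite -[a]SS -!antipodeM ce.
have SeE : e * S e = S e.
  have bF : bilin (fun x y => x * S y).
    by split=> z; [apply: linear_mulr | apply: linear_comp (linear_mull z) lS].
  have := congr1 (tlift (fun x y => x * S y)) comul_idem_r.
  rewrite [RHS]tliftE // => <-; rewrite tlift_mul //.
  transitivity (\tsum_(x, y <- comul e) (x * S y * S e)).
    apply: eq_tlift => x y; rewrite tliftE ?mulr1 ?antipodeM ?cSe ?mulrA //.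
    by have [F1 F2] := bF; split=> z; [apply: linear_comp (F1 _) (linear_mull x)
      | apply: linear_comp (F2 _) (linear_mull y)].
  by rewrite -(tlift_lin (fun x y => x * S y) _ (linear_mulr (S e))) antipoder ee1 scale1r mul1r.
by rewrite -{1}SeE -{1}[e]SS -antipodeM SeE SS.
Qed.

(** The functionals that factor through the quotient algebra [H e]; matrix coefficients of modules
    on which [e] acts as the identity are of this kind. *)
Definition idem_invariant f := forall a, f (a * e) = f a.

Lemma invariantl f a : idem_invariant f -> f (e * a) = f a.
Proof. by move=> If; rewrite ce If. Qed.

Lemma invariant_antipode f : idem_invariant f -> idem_invariant (antipode f).
Proof.
move=> If a; apply: etrans (dual_antipodeE _ _) _; rewrite antipodeM antipode_idem invariantl //.
exact: esym (dual_antipodeE _ _).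
Qed.

(** The regular character of [H e], which is shown to be a two-sided integral for the invariant
    functionals. *)
Definition regquot : dualv H := shl e chi.

Lemma regquot_l f : idem_invariant f -> regquot * f = f 1 *: regquot.
Proof.
move=> If; apply: dual_ext => a; rewrite scale_lfunE.
have := congr1 (fun g : dualv H => g (a * e)) (chir f); rewrite /= scale_lfunE.
rewrite shlE ce => <-; rewrite !dualM_ev2 comulM.
transitivity (ev2 chi f (comul a * (e \ox e))).
  move: (comul a); apply: (tens_ext (Z := k^o) (f := ev2 regquot f)
      (g := fun s : tens H H => ev2 chi f (s * (e \ox e)))).
  - exact: linear_ev2.
  - exact: lmr.
  by move=> x y; rewrite pureM !ev2_pure shlE If ce.
rewrite -comul_idem_r mulrA; move: (comul a * comul e).
apply: (tens_ext (Z := k^o) (f := fun s : tens H H => ev2 chi f (s * (1 \ox e)))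
  (g := ev2 chi f)).
- exact: lmr.
- exact: linear_ev2.
by move=> x y; rewrite pureM !ev2_pure mulr1 If.
Qed.

Lemma regquot_invariant : idem_invariant regquot.
Proof. by move=> a; rewrite !shlE -ce mulrA ee. Qed.

Lemma regquot_antipode : antipode regquot = regquot.
Proof.
apply: dual_ext => a; apply: etrans (dual_antipodeE _ _) _.
by rewrite !shlE -[e in LHS]antipode_idem -antipodeM chiS ce.
Qed.

Lemma regquot_r f : idem_invariant f -> f * regquot = f 1 *: regquot.
Proof.
move=> If; have := regquot_l (invariant_antipode If) => /(congr1 antipode).
have SSf g : antipode (antipode g) = g.
  apply: dual_ext => a; apply: etrans (dual_antipodeE _ _) _.
  by apply: etrans (dual_antipodeE _ _) _; rewrite SS.
rewrite antipodeM SSf regquot_antipode => ->; rewrite linearZ /= regquot_antipode.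
congr (_ *: _); apply: etrans (dual_antipodeE _ _) _.
by rewrite antipode1.
Qed.

Lemma regquot1 : regquot 1 = chi e.
Proof. by rewrite shlE mulr1. Qed.

Lemma regquot_tracelike : tracelike regquot.
Proof. by move=> a b; rewrite !shlE !ce -mulrA chireg_tracelike -mulrA ce mulrA. Qed.

(** The dual of the quotient Hopf algebra [H e]: [De] gives closure under products, centrality of
    [e] closure under the coproduct, and [antipode_idem] closure under the antipode. *)
Lemma invariant_hopfsub : exists P : hopfsub (dualv H), forall f, f \in P <-> idem_invariant f.
Proof.
have [||U UP] := @vspace_of_pred k (dualv H) idem_invariant.
- by move=> a; rewrite !zero_lfunE.
- by move=> c f g If Ig a; rewrite !dualD If Ig.
have U1 : 1 \in U by apply/UP => a; rewrite !dual1 counitM ee1 mulr1.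
have UM f g : f \in U -> g \in U -> f * g \in U.
  move=> /UP If /UP Ig; apply/UP => a.
  transitivity (ev2 f g (comul a * comul e * (e \ox e))).
    rewrite dualM_ev2 comulM; move: (comul a * comul e).
    apply: (tens_ext (Z := k^o) (f := ev2 f g)
      (g := fun s : tens H H => ev2 f g (s * (e \ox e)))).
    - exact: linear_ev2.
    - exact: lmr.
    by move=> x y; rewrite pureM !ev2_pure If Ig.
  rewrite -mulrA De dualM_ev2; move: (comul a).
  apply: (tens_ext (Z := k^o) (g := ev2 f g)
    (f := fun s : tens H H => ev2 f g (s * (e \ox e)))).
  - exact: lmr.
  - exact: linear_ev2.
  by move=> x y; rewrite pureM !ev2_pure If Ig.
have aU : is_aspace U.
  apply/andP; split; first by apply: has_algid1.
  by apply/prodvP => f g fU gU; apply: UM.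
pose B : {aspace dualv H} := ASpace aU.
have pB g : shl e g \in B.
  by apply/UP => a; rewrite !shlE -ce mulrA ee.
have h2 : {in B, forall f, comul f \in tensv B B}.
  move=> f /UP If; have lp : linear (shl e).
    by move=> c g h; apply: dual_ext => a; rewrite dualD !shlE dualD.
  have -> : comul f = \tsum_(g, h <- comul f) (shl e g \ox shl e h).
    apply: tens_sep => u; rewrite (dual_comul_contract _ _ (fun _ _ _ => erefl)).
    rewrite (tlift_lin _ _ (linear_contract u)).
    transitivity (\tsum_(g, h <- comul f) ((g : dualv H) (e * u) *: shl e h)).
      rewrite (dual_comul_contract _ _ lp); apply: dual_ext => b.
      by rewrite !shlE -mulrA invariantl // mulrA -ce -mulrA invariantl.
    apply: eq_tlift => g h; rewrite tliftE ?shlE //; exact: bilin_contract.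
  rewrite tlift_pair; apply: memv_suml => p _; rewrite memvZ //.
  by apply: tensv_pure; apply: pB.
have h3 : {in B, forall f, antipode f \in B}.
  by move=> f /UP If; apply/UP; apply: invariant_antipode.
by exists (HopfSub (U1 : 1 \in B) h2 h3).
Qed.

End QuotientIdempotent.

(** * Matrix coefficients and quotient Hopf algebras *)

Section Coefficients.
Variables (k : fieldType) (A : falgType k).
Implicit Types (M N : repn A).

Lemma bilin_mcoef M : bilin (@mcoef k A M).
Proof.
split=> [m c f g|f c m n]; apply: dual_ext => a; rewrite dualD !mcoefE ?dualD //.
by rewrite act_linr; apply: linear_dual.
Qed.

Lemma coef_spaceP M (U : {vspace dualv A}) :
  (coef_space M <= U)%VS <-> forall (f : dualv M) m, mcoef f m \in U.
Proof.
split=> [sMU f m|E]; last first.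
  by apply/span_subvP => _ /allpairsP[[f m] [_ _ ->]].
apply: (subvP sMU); have [b1 b2] := bilin_mcoef M.
rewrite (coord_vbasis (memvf f)) (linf_sum (b1 m)); apply: memv_suml => i _.
rewrite (linfZ _ _ (b1 m)) memvZ //.
rewrite (coord_vbasis (memvf m)) (linf_sum (b2 _)); apply: memv_suml => j _.
rewrite (linfZ _ _ (b2 _)) memvZ // memv_span //; apply/allpairsP.
by exists ((vbasis {:dualv M})`_i, (vbasis {:M})`_j); rewrite !mem_nth ?size_tuple.
Qed.

Lemma char_mcoef M : character M = \sum_i mcoef (dual_bas i) (bas i : M).
Proof.
apply: dual_ext => a; rewrite char_ltr (linf_sum (linear_eval a)).
by apply: eq_bigr => i _; rewrite mcoefE dual_basE.
Qed.

Lemma bidual (V : vectType k) (F : dualv V -> k) :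
  linear (F : dualv V -> k^o) -> exists v : V, forall f, F f = f v.
Proof.
move=> lF; exists (\sum_i F (dual_bas i) *: bas i) => f.
rewrite (linf_sum (linear_dual f)) [f in LHS]dual_sum (linf_sum lF).
apply: eq_bigr => i _; rewrite (linfZ _ _ lF) (linfZ _ _ (linear_dual f)).
exact: mulrC.
Qed.
End Coefficients.

Section RepDualSub.
Variables (k : fieldType) (H : hopfType k) (P : hopfsub (dualv H)).
Implicit Types (M N : repn H).

Lemma linear_bidual_proj : linear (bidual_proj P).
Proof.
move=> c a b; apply: dual_ext => f; rewrite dualD !bidual_projE.
exact: (linear_dual (hval f)).
Qed.

Lemma bidual_proj_surj (xi : dualv (hsub P)) : exists a, bidual_proj P a = xi.
Proof.
have lx : linear (fun f : dualv H => xi (hproj P f) : k^o).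
  exact: linear_comp (linear_dual xi) (@linear_hproj _ _ P).
have [a Ea] := bidual lx; exists a; apply: dual_ext => f.
by rewrite bidual_projE -Ea hvalK.
Qed.

Lemma rep_dual_sub_coef M : rep_dual_sub P M ->
  forall (f : dualv M) m, mcoef f m \in P.
Proof.
move=> [N [h [lh [h' hK h'K] hE]]] f m.
have lF : linear (fun xi : dualv (hsub P) => f (h (act xi (h' m))) : k^o).
  exact: linear_comp (linear_dual f) (linear_comp lh (act_linl _)).
have [p Ep] := bidual lF.
suff -> : mcoef f m = hval p by apply: hvalP.
apply: dual_ext => a; rewrite mcoefE -bidual_projE -Ep hE h'K.
by [].
Qed.

Section Coaction.
Variable M : repn H.
Hypothesis coefP : forall (f : dualv M) m, mcoef f m \in P.

(** The projection [hproj] makes the formula meaningful for every coefficient; under [coefP] it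
    changes nothing. Since every [xi] comes from an element of [H], the module laws are inherited
    from [M]. *)
Definition coact (xi : dualv (hsub P)) (m : M) : M :=
  \sum_i (xi (hproj P (mcoef (dual_bas i) m)) : k) *: bas i.

Lemma coactE a m : coact (bidual_proj P a) m = act a m.
Proof.
rewrite [RHS]bas_sum; apply: eq_bigr => i _; rewrite bidual_projE.
by rewrite hprojK ?coefP // mcoefE dual_basE.
Qed.

Fact coact_linl m : linear (fun xi => coact xi m).
Proof.
move=> c xi xi'; have [a <-] := bidual_proj_surj xi; have [b <-] := bidual_proj_surj xi'.
by rewrite -linear_bidual_proj !coactE act_linl.
Qed.

Fact coact_linr xi : linear (coact xi).
Proof.
by move=> c m n; have [a <-] := bidual_proj_surj xi; rewrite !coactE act_linr.
Qed.

Fact coact1 m : coact 1 m = m.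
Proof. by rewrite -bidual_proj1 coactE act1m. Qed.

Fact coactM xi xi' m : coact (xi * xi') m = coact xi (coact xi' m).
Proof.
have [a <-] := bidual_proj_surj xi; have [b <-] := bidual_proj_surj xi'.
by rewrite -bidual_projM !coactE actMm.
Qed.

Lemma coef_rep_dual_sub : rep_dual_sub P M.
Proof.
exists (Repn (repn_sort := M) coact_linl coact_linr coact1 coactM), id; split=> //.
  by exists id.
by move=> a n; apply: coactE.
Qed.
End Coaction.
End RepDualSub.

(** * Fusion subcategories *)

Section FusionSubcategories.
Variables (k : fieldType) (H : hopfType k).
Implicit Types (M N : repn H) (G : repn H -> Prop).

Lemma fusion_gen_subcat G : fusion_subcat (fusion_gen G).
Proof.
split.
- by move=> M N iMN gM K fK GK; have [Kiso _ _ _ _] := fK; apply: Kiso iMN _; apply: gM.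
- move=> M N; split=> [gMN|[gM gN] K fK GK].
    by split=> K fK GK; have [_ Kd _ _ _] := fK; have [KM KN] := (Kd M N).1 (gMN K fK GK).
  by have [_ Kd _ _ _] := fK; apply/Kd; split; [apply: gM | apply: gN].
- by move=> K [].
- by move=> M N gM gN K fK GK; have [_ _ _ Kt _] := fK; apply: Kt; [apply: gM | apply: gN].
- by move=> M gM K fK GK; have [_ _ _ _ Kd] := fK; apply: Kd; apply: gM.
Qed.

Lemma fusion_gen_sub G G' : (forall M, G M -> fusion_gen G' M) ->
  forall M, fusion_gen G M -> fusion_gen G' M.
Proof. by move=> GG' M gM; apply: gM GG'; apply: fusion_gen_subcat. Qed.

Lemma fusion_gen_gen G M : G M -> fusion_gen G M.
Proof. by move=> GM K _ GK; apply: GK. Qed.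

Lemma fusion_dim0 K N : fusion_subcat K -> dim N = 0%N -> K N.
Proof.
case=> Kiso Kd Ku _ _ d0; suff /Kd[] : K (dsum (unit_repn H) N) by [].
apply: Kiso Ku; apply: repn_iso_sym; exists (fun p => p.1); split=> //.
by exists (fun x => (x, 0)) => [[x n]|//]; rewrite [n]dim0_eq0.
Qed.

Lemma unit_irreducible : irreducible (unit_repn H).
Proof.
have d1 : \dim {:(unit_repn H : vectType k)} = 1%N by rewrite dimvf.
split=> [|U _]; first by rewrite -dimv_eq0 d1.
have := dimvS (subvf U); rewrite d1; case dU: (\dim U) => [|[|//]] _.
  by left; apply/eqP; rewrite -dimv_eq0 dU.
by right; apply/eqP; rewrite eqEdim subvf d1 dU.
Qed.

(** It is enough to test the tensor square of the submodule [e H] of the regular module, on the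
    vector [e \ox e]. *)
Lemma comul_idem_tensor (e : H) : central_idem e ->
  (forall M N, (forall m : M, act e m = m) -> (forall n : N, act e n = n) ->
     forall t : tensor M N, act e t = t) ->
  comul e * (e \ox e) = e \ox e.
Proof.
move=> [ce ee] eMN; have [||U UP] := @vspace_of_pred k H (fun x => e * x = x).
- by rewrite mulr0.
- by move=> c x y Ex Ey; rewrite mulrDr -scalerAr Ex Ey.
have sU : stable (M := reg_repn H) U.
  by move=> a x /UP Ex; apply/UP; rewrite /= mulrA ce -mulrA Ex.
have eU : e \in U by apply/UP.
pose N := sub_repn sU.
have eN (n : N) : act e n = n.
  by apply: subvs_inj; rewrite (sub_actE sU); apply: (UP (vsval n)).1 (subvsP n).
pose iota (t : tens N N) : tens H H := \tsum_(x, y <- t) (vsval x \ox vsval y).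
have bi : bilin (fun x y : N => vsval x \ox vsval y : tens H H).
  split=> z; first exact: linear_comp (linear_purel _) (fun _ _ _ => erefl).
  exact: linear_comp (linear_purer _) (fun _ _ _ => erefl).
have iE (s : tens H H) (t : tens N N) : iota (tact s t) = s * iota t.
  move: s; apply: (tens_ext (f := fun s : tens H H => iota (tact s t))
    (g := fun s : tens H H => s * iota t)).
  - exact: linear_comp (linear_tlift _) (linear_tactl t).
  - exact: linear_mulr.
  move=> a b; move: t; apply: (tens_ext (f := fun t : tens N N => iota (tact (a \ox b) t))
    (g := fun t : tens N N => (a \ox b) * iota t)).
  - exact: linear_comp (linear_tlift _) (linear_tactr _).
  - exact: linear_comp (linear_mull _) (linear_tlift _).
  move=> x y; rewrite tact_pure /iota !tliftE // !(sub_actE sU).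
  exact: esym (@pureM k H H _ _ _ _).
pose x0 : N := vsproj U e.
have ix0 : iota (x0 \ox x0) = e \ox e by rewrite /iota tliftE // vsprojK.
by rewrite -ix0 -iE; congr iota; apply: (eMN N N eN eN).
Qed.

End FusionSubcategories.

Section CharShift.
Variables (k : fieldType) (A : falgType k).
Implicit Types M : repn A.

Lemma char_mul_id M a x : (forall m : M, act a m = m) -> character M (x * a) = character M x.
Proof. by move=> E; rewrite !char_ltr; apply: eq_ltr => m; rewrite actMm E. Qed.

Lemma char_mul_eq0 M a x : (forall m : M, act a m = 0) -> character M (x * a) = 0.
Proof. by move=> E; apply: char_eq0 => m; rewrite actMm E act0. Qed.
End CharShift.

(** * The centralizer of the Hopf kernel *)

Section Factorizable.
Variables (k : closedFieldType) (char0 : [pchar k] =i pred0).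
Variables (A : hopfType k) (R : tens A A).
Hypotheses (ssA : semisimple_alg A) (factA : factorizable R).
Variables (s : nat) (chi : 'I_s -> dualv A) (chi_inj : injective chi).
Hypothesis chi_irr : forall x : dualv A, irr_char x <-> exists j, x = chi j.
Variables (e : 'I_s -> A) (e_chi : forall j, central_idem_of (chi j) (e j)).

Local Notation phi := (drinfeld R).
Local Notation S := (@antipode k A).
Definition idemE (j : 'I_s) : dualv A := (phi^-1)%VF (e j).
Local Notation E := idemE.

Let qtR : quasitriangular R := factA.1.

Lemma drinfeld_inj : injective phi.
Proof. by case: factA => _ /bij_inj. Qed.

Lemma drinfeld_invK a : phi ((phi^-1)%VF a) = a.
Proof.
case: factA => _ [g fK gK]; apply: limg_lfunVK.
by rewrite -[a]gK memv_img ?memvf.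
Qed.

Lemma unit_index : exists o, chi o = 1.
Proof.
have [o Eo] := irr_chi chi_irr (unit_irreducible A).
by exists o; rewrite -Eo char_unit.
Qed.

(** The integral is the central idempotent of the trivial module. *)
Lemma haar_integral : exists Lam : A, [/\ central Lam, counit Lam = 1 &
  forall a, a * Lam = counit a *: Lam].
Proof.
have [o Eo] := unit_index; exists (e o).
have Eo' : character (unit_repn A) = chi o by rewrite char_unit.
have eo := e_act char0 ssA chi_inj chi_irr e_chi o (unit_irreducible A) Eo'.
split; first exact: (e_idem e_chi o).1.
  have := eo (1 : k^o); rewrite eqxx /= => E1.
  by rewrite -[LHS]mulr1; apply: E1.
move=> a; apply: (act_inj ssA) => M irrM m; have [l El] := irr_chi chi_irr irrM.
rewrite actMm actZl !(e_act char0 ssA chi_inj chi_irr e_chi _ irrM El).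
have [ol|_] := eqVneq o l; last by rewrite act0 scaler0.
have [|f [lf bf fE]] := irr_iso ssA chi_irr e_chi irrM (unit_irreducible A).
  by rewrite El -ol Eo'.
by apply: (bij_inj bf); rewrite fE (linfZ _ _ lf).
Qed.

(** [phi (f * lam) = phi f * Lam = counit (phi f) *: Lam], and the counit of [phi f] is [f 1].
    Idempotence of [Lam] then fixes the normalization. *)
Lemma dual_haar_integral Lam : central Lam -> counit Lam = 1 ->
  (forall a, a * Lam = counit a *: Lam) ->
  exists lam : dualv A, [/\ phi lam = Lam, lam 1 = 1 & forall f, f * lam = f 1 *: lam].
Proof.
move=> cL eL La; pose lam := (phi^-1)%VF Lam; exists lam.
have pl : phi lam = Lam by apply: drinfeld_invK.
have L f : f * lam = f 1 *: lam.
  apply: drinfeld_inj; rewrite (drinfeldM qtR) pl //.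
  by rewrite La (counit_drinfeld qtR) linearZ /= pl.
split=> //; have ll : lam * lam = lam.
  by apply: drinfeld_inj; rewrite (drinfeldM qtR) pl // La eL scale1r.
have /eqP : (lam 1 - 1) *: lam = 0 by rewrite scalerBl scale1r -L ll subrr.
rewrite scaler_eq0 subr_eq0 => /orP[/eqP //|/eqP lam0].
have := eL; rewrite -pl lam0 linear0 linear0 => /eqP.
by rewrite eq_sym oner_eq0.
Qed.

Lemma haar_data : exists (Lam : A) (lam : dualv A),
  [/\ [/\ central Lam, counit Lam = 1 & forall a, a * Lam = counit a *: Lam],
      [/\ phi lam = Lam, lam 1 = 1 & chireg A = (dim A)%:R *: lam],
      (forall a, S (S a) = a), (forall a, lam (S a) = lam a) &
      forall f, lam * f = f 1 *: lam].
Proof.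
have [Lam [cL eL La]] := haar_integral.
have [lam [pl l1 L]] := dual_haar_integral cL eL La; exists Lam, lam.
have Lr a : Lam * a = counit a *: Lam by rewrite cL.
split=> //.
- by split=> //; apply: (chireg_lam char0 L l1 La Lr eL).
- exact: (Larson_Radford char0 L l1 La Lr eL).
- exact: (lamS L l1 La Lr eL).
- exact: (right_integral L l1 La Lr eL).
Qed.

Lemma antipodeK a : S (S a) = a.
Proof. by have [Lam [lam [_ _ ->]]] := haar_data. Qed.

Lemma chireg_integral f : chireg A * f = f 1 *: chireg A.
Proof.
have [Lam [lam [_ [_ _ ->] _ _ rl]]] := haar_data.
by rewrite -scalerAl rl !scalerA mulrC.
Qed.

Lemma chireg_antipode a : chireg A (S a) = chireg A a.
Proof.
have [Lam [lam [_ [_ _ ->] _ lS _]]] := haar_data.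
by rewrite !scale_lfunE lS.
Qed.

Lemma char_tracelike M : tracelike (character M : dualv A).
Proof. by move=> a b; apply: charM. Qed.

Lemma chi_tracelike j : tracelike (chi j).
Proof. by have [M _ <-] := chiP chi_irr j; apply: char_tracelike. Qed.

Lemma phi_central f : tracelike f -> central (phi f).
Proof. exact: (drinfeld_central qtR antipodeK). Qed.

Lemma phiE j : phi (E j) = e j.
Proof. exact: drinfeld_invK. Qed.

Lemma e_central j : central (e j).
Proof. exact: (e_idem e_chi j).1. Qed.

Lemma E_idem j : E j * E j = E j.
Proof.
apply: drinfeld_inj; rewrite (drinfeldM qtR) !phiE ?(e_idem e_chi j).2 //.
exact: e_central.
Qed.

Lemma E_neq0 j : E j != 0.
Proof.
apply/eqP=> E0; have := e_neq0 e_chi j; rewrite -phiE E0 linear0.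
by rewrite eqxx.
Qed.

Lemma phi1 : phi 1 = 1.
Proof.
have p1 := drinfeld_invK 1; have := drinfeldM qtR 1 (g := (phi^-1)%VF 1).
rewrite p1 mul1r p1 mulr1 => <- //.
exact: central1.
Qed.

Lemma sum_E : \sum_j E j = 1.
Proof.
apply: drinfeld_inj; rewrite phi1 linear_sum -(sum_e char0 ssA chi_inj chi_irr e_chi).
by apply: eq_bigr => j _; apply: phiE.
Qed.

(** For trace-like [f], the scalar by which the central element [phi f] acts on the simple module of
    index [j]; on these functionals [psi j] is multiplicative. *)
Definition psi j (f : dualv A) : k := chi j (phi f) / chi j 1.

Lemma psi_linear j : linear (psi j : dualv A -> k^o).
Proof.
by move=> c f g; rewrite /psi linearP (linear_dual (chi j)) mulrDl -mulrA.
Qed.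

Lemma degree_neq0 j : chi j 1 != 0.
Proof. exact: (chi1_neq0 char0 chi_irr). Qed.

Lemma phi_e f j : tracelike f -> phi f * e j = psi j f *: e j.
Proof.
by move=> tf; apply: (central_e char0 ssA chi_inj chi_irr e_chi); apply: phi_central.
Qed.

Lemma mulE f j : tracelike f -> f * E j = psi j f *: E j.
Proof.
move=> tf; apply: drinfeld_inj; rewrite (drinfeldM qtR) phiE ?phi_e // ?linearZ /= ?phiE //.
exact: e_central.
Qed.

Lemma psiM j f g : tracelike f -> tracelike g -> psi j (f * g) = psi j f * psi j g.
Proof.
move=> tf tg; have := mulE j (tracelikeM tf tg); rewrite -mulrA (mulE _ tg).
rewrite -scalerAr (mulE _ tf) scalerA => /eqP; rewrite -subr_eq0 -scalerBl.
by rewrite scaler_eq0 (negPf (E_neq0 j)) orbF subr_eq0 mulrC => /eqP.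
Qed.

Lemma psi1 j : psi j 1 = 1.
Proof. by rewrite /psi phi1 divff ?degree_neq0. Qed.

Lemma chi_dim j : exists n, (0 < n)%N && (chi j 1 == n%:R).
Proof.
have [M irrM <-] := chiP chi_irr j; exists (dim M).
by rewrite char1 eqxx irr_dim.
Qed.

Definition chidim j : nat := xchoose (chi_dim j).

Lemma chidim_gt0 j : (0 < chidim j)%N.
Proof. by case/andP: (xchooseP (chi_dim j)). Qed.

Lemma chi1E j : chi j 1 = (chidim j)%:R.
Proof. by case/andP: (xchooseP (chi_dim j)) => _ /eqP. Qed.

Lemma dual_mul1 (f g : dualv A) : (f * g) 1 = f 1 * g 1.
Proof. exact: (@counitM k (dualv A) f g). Qed.

(** The matrix is that of multiplication by [chi i] on irreducible characters. The algebra character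
    [psi j] gives one eigenvector, the degrees give the positive one. *)
Lemma psi_dominated i j : dominated (chidim i) (psi j (chi i)).
Proof.
have dec l : exists n : 'I_s -> nat, chi i * chi l = \sum_m (n m)%:R *: chi m.
  have [M _ <-] := chiP chi_irr i; have [N _ <-] := chiP chi_irr l.
  rewrite -char_tensor; apply: (char_decomp ssA chi_irr).
pose N l := sval (boolp.cid (dec l)).
have NE l : chi i * chi l = \sum_m (N l m)%:R *: chi m := svalP (boolp.cid (dec l)).
exists s, N, chidim, (fun l => psi j (chi l)); split.
- by have [o Eo] := unit_index; exists o; rewrite Eo psi1 oner_neq0.
- exact: chidim_gt0.
- move=> l; apply: (char0_natr_inj char0); rewrite natrM -!chi1E -dual_mul1 NE.
  rewrite (linf_sum (linear_eval 1)) natr_sum; apply: eq_bigr => m _.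
  by rewrite scale_lfunE natrM chi1E.
- move=> l; rewrite -psiM ?NE; try exact: chi_tracelike.
  rewrite (linf_sum (psi_linear j)); apply: eq_bigr => m _.
  by rewrite (linfZ _ _ (psi_linear j)).
Qed.

(** * Sets of simple modules and their central idempotents *)

Definition esum (P : pred 'I_s) : A := \sum_(i | P i) e i.

Lemma esum_idem P : central_idem (esum P).
Proof. exact: (central_sum_e char0 ssA chi_inj chi_irr e_chi). Qed.

Lemma esum_act P M j : irreducible M -> character M = chi j ->
  forall m : M, act (esum P) m = if P j then m else 0.
Proof. exact: (sum_e_act char0 ssA chi_inj chi_irr e_chi P). Qed.

Lemma chi_esum P i a : chi i (a * esum P) = if P i then chi i a else 0.
Proof.
have [M irrM EM] := chiP chi_irr i; have := esum_act P irrM EM; rewrite -EM.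
case: (P i) => E1; first exact: char_mul_id.
exact: char_mul_eq0.
Qed.

(** The trace of the idempotent [1 - esum P] on [M] is the total dimension of the constituents
    outside [P]. *)
Lemma esum_id P M (n : 'I_s -> nat) : character M = \sum_i (n i)%:R *: chi i ->
  (forall m : M, act (esum P) m = m) <-> forall i, n i != 0%N -> P i.
Proof.
move=> EM; have [cP PP] := esum_idem P.
have EcM a : character M a = \sum_i (n i)%:R * chi i a.
  rewrite EM (linf_sum (linear_eval a)); apply: eq_bigr => i _.
  by rewrite scale_lfunE.
have trM : character M (1 - esum P) = (\sum_(i | ~~ P i) n i * chidim i)%:R.
  rewrite EcM natr_sum [RHS]big_mkcond; apply: eq_bigr => i _.
  rewrite -[esum P]mul1r raddfB /= chi_esum natrM -chi1E.
  by case: (P i) => /=; rewrite ?subrr ?subr0 ?mulr0.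
split=> [idM i|nP m].
  have : character M (1 - esum P) = 0.
    by apply: char_eq0 => m; rewrite actBl act1m idM subrr.
  rewrite trM => /eqP; rewrite (natr_eq0 char0) sum_nat_eq0 => /forall_inP E0.
  apply: contraTT => /E0; rewrite muln_eq0 => /orP[->//|].
  by rewrite eqn0Ngt chidim_gt0.
have tr0 : character M (1 - esum P) = 0.
  rewrite trM big1 // => i nPi; apply/eqP; rewrite muln_eq0.
  by apply/orP; left; apply: contraNT nPi => /nP.
have [_ QQ] := central_idem_compl (esum_idem P).
have := ltr_idem_eq0 char0 (act_linr (1 - esum P) (r := M)).
rewrite -char_ltr => H0; apply/eqP; rewrite -subr_eq0 -oppr_eq0 opprB.
rewrite -{1}[m]act1m -actBl; apply/eqP; apply: H0 => // x.
by rewrite -actMm QQ.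
Qed.

Lemma psi_char j M (n : 'I_s -> nat) : character M = \sum_i (n i)%:R *: chi i ->
  psi j (character M) = \sum_i (n i)%:R * psi j (chi i) /\
  (dim M)%:R = \sum_i (n i)%:R * (chidim i)%:R :> k.
Proof.
move=> EM; split.
  rewrite EM (linf_sum (psi_linear j)); apply: eq_bigr => i _.
  by rewrite (linfZ _ _ (psi_linear j)).
rewrite -char1 EM (linf_sum (linear_eval 1)); apply: eq_bigr => i _.
by rewrite scale_lfunE chi1E.
Qed.

Definition trivial_on j : pred 'I_s := fun i => psi j (chi i) == (chidim i)%:R.

(** By [dominated_rigid], [psi j] attains the dimension on [M] only if it does so on every
    constituent. A condition on constituents thus becomes one equation, visibly compatible with
    tensor products. *)
Lemma psi_dim_act j M : psi j (character M) = (dim M)%:R <->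
  forall m : M, act (esum (trivial_on j)) m = m.
Proof.
have [n En] := char_decomp ssA chi_irr M; have [E1 E2] := psi_char j En.
split=> [psiM|/(esum_id _ En) nP].
  apply/(esum_id _ En) => i ni; apply/eqP.
  apply: (dominated_rigid char0 (m := n) (fun i => psi_dominated i j)) ni.
  under eq_bigr do rewrite mulrBr.
  by rewrite sumrB -E1 -E2 psiM subrr.
rewrite E1 E2; apply: eq_bigr => i _; have [->|/nP/eqP->//] := eqVneq (n i) 0%N.
by rewrite !mul0r.
Qed.

(* What is used of a fusion subcategory of [Rep A] with set of simple objects [P]. *)
Definition fusion_idem (P : pred 'I_s) :=
  counit (esum P) = 1 /\ comul (esum P) * (esum P \ox esum P) = esum P \ox esum P.

Lemma trivial_on_fusion j : fusion_idem (trivial_on j).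
Proof.
split.
  have /psi_dim_act/(_ (1 : k^o)) E1 : psi j (character (unit_repn A)) = (dim (unit_repn A))%:R.
    by rewrite char_unit psi1 -char1 char_unit dual1 counit1.
  by rewrite -[LHS]mulr1; apply: E1.
apply: comul_idem_tensor; first exact: esum_idem.
move=> M N /psi_dim_act EM /psi_dim_act EN; apply/psi_dim_act.
rewrite char_tensor psiM; try exact: char_tracelike.
by rewrite EM EN -!char1 -dual_mul1 -char_tensor.
Qed.

Section FusionIdem.
Variables (P : pred 'I_s) (fP : fusion_idem P).
Local Notation r := (regquot (esum P)).

Lemma regquot_degree_neq0 : r 1 != 0.
Proof.
rewrite regquot1; have [cP PP] := esum_idem P; apply/eqP; rewrite chiregE => tr0.
have := ltr_idem_eq0 char0 (linear_mull (esum P)) _ tr0 1; rewrite mulr1 => E0.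
have := fP.1; rewrite E0 ?linear0 => [/eqP|x]; last by rewrite mulrA PP.
by rewrite eq_sym oner_eq0.
Qed.

Lemma regquot_mulr f : idem_invariant (esum P) f -> f * r = f 1 *: r.
Proof.
exact: (regquot_r char0 antipodeK chireg_integral chireg_antipode (esum_idem P) fP.1 fP.2).
Qed.

Lemma regquot_trace : tracelike r.
Proof. exact: regquot_tracelike (esum_idem P). Qed.

Lemma chireg_decomp : exists n : 'I_s -> nat, chireg A = \sum_i (n i)%:R *: chi i.
Proof. exact: (char_decomp ssA chi_irr (reg_repn A)). Qed.

Lemma regquot_decomp : exists2 n : 'I_s -> nat,
  r = \sum_i (n i)%:R *: chi i & forall i, n i != 0%N -> P i.
Proof.
have [n En] := chireg_decomp; exists (fun i => if P i then n i else 0%N); last first.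
  by move=> i; case: (P i).
apply: dual_ext => a; rewrite shlE (esum_idem P).1 En (linf_sum (linear_eval (a * esum P))).
rewrite (linf_sum (linear_eval a)); apply: eq_bigr => i _; rewrite !scale_lfunE chi_esum.
by case: (P i); rewrite ?scale0r // scaler0.
Qed.

Lemma esum_invariant (M : repn A) : (forall m : M, act (esum P) m = m) ->
  forall (f : dualv M) m, idem_invariant (esum P) (mcoef f m).
Proof. by move=> idM f m a; rewrite !mcoefE actMm idM. Qed.

Lemma chi_invariant i : P i -> idem_invariant (esum P) (chi i).
Proof. by move=> Pi a; rewrite chi_esum Pi. Qed.

Lemma esum_hopfsub : exists B : hopfsub (dualv A), forall f, f \in B <-> idem_invariant (esum P) f.
Proof.
exact: (invariant_hopfsub char0 antipodeK chireg_integral (esum_idem P) fP.1 fP.2).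
Qed.
End FusionIdem.

(** The integral [r] of the invariant functionals is a sum of characters, hence
    [r * E j = r 1 *: E j]. Computing [f * r * E j] in two ways and cancelling [r 1] extends this to
    [f], which need not be trace-like. *)
Lemma trivial_on_invariant j f : idem_invariant (esum (trivial_on j)) f ->
  phi f * e j = f 1 *: e j.
Proof.
move=> If; have fP := trivial_on_fusion j; set r := regquot (esum (trivial_on j)).
have rE : r * E j = r 1 *: E j.
  rewrite mulE; last exact: regquot_trace.
  have [n En nP] := regquot_decomp (trivial_on j); rewrite /r En; congr (_ *: _).
  rewrite (linf_sum (psi_linear j)) (linf_sum (linear_eval 1)).
  apply: eq_bigr => i _; rewrite (linfZ _ _ (psi_linear j)) scale_lfunE chi1E.
  by have [->|/nP/eqP->//] := eqVneq (n i) 0%N; rewrite !scale0r.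
have fE : f * E j = f 1 *: E j.
  apply: (scalerI (regquot_degree_neq0 fP)); rewrite -/r scalerAr -rE mulrA.
  by rewrite (regquot_mulr fP If) -scalerAl rE !scalerA mulrC.
by rewrite -phiE -(drinfeldM qtR) ?fE ?linearZ //= phiE; apply: e_central.
Qed.

(** * The Hopf kernel of an irreducible character *)

Variable d : A.
Hypothesis d_irr : irr_dual_char d.

Lemma E_mult j : exists m : nat, E j d = m%:R.
Proof.
have [x [M irrM ->] xE] := d_irr.
have [|n En _] := ltr_idem (act_linr (E j) (r := M)).
  by move=> m; rewrite -actMm E_idem.
by exists n; rewrite -En -xE char_ltr.
Qed.

Lemma counit_d : counit d = \sum_j E j d.
Proof. by rewrite -dual1 -sum_E (linf_sum (linear_eval d)). Qed.

Lemma tracelike_d f : tracelike f -> f d = \sum_j psi j f * E j d.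
Proof.
move=> tf; rewrite -[f in LHS]mulr1 -sum_E mulr_sumr (linf_sum (linear_eval d)).
by apply: eq_bigr => j _; rewrite mulE // scale_lfunE.
Qed.

(* [E j d] is a natural number, being the trace of an idempotent, so that
   [chi d = \sum_j psi j chi * E j d] is [chi 1 * counit d] only when
   [psi j chi] has its maximal value [chi 1] for all [j] with [E j d != 0]. *)
Lemma chi_d_trivial i : chi i d = chi i 1 * counit d <->
  forall j, E j d != 0 -> trivial_on j i.
Proof.
pose m j := sval (boolp.cid (E_mult j)).
have mE j : E j d = (m j)%:R := svalP (boolp.cid (E_mult j)).
rewrite tracelike_d; last exact: chi_tracelike.
rewrite counit_d chi1E mulr_sumr; split=> [Ed j|Tj].
  rewrite mE (natr_eq0 char0) => mj; apply/eqP.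
  apply: (dominated_rigid char0 (m := m) (fun j => psi_dominated i j)) mj.
  under eq_bigr => l _ do rewrite mulrBr mulrC [_ * psi _ _]mulrC -mE.
  by rewrite sumrB Ed subrr.
apply: eq_bigr => j _; have [->|/Tj/eqP->//] := eqVneq (E j d) 0.
by rewrite !mulr0.
Qed.

(** The invariant functionals form a Hopf subalgebra, and it contains the generators of [hker d] by
    [chi_d_trivial]. *)
Lemma hker_invariant j f : E j d != 0 -> f \in hker d ->
  idem_invariant (esum (trivial_on j)) f.
Proof.
move=> Ejd fd; have [B BP] := esum_hopfsub (trivial_on_fusion j).
apply/BP; apply: subvP fd; apply: (hopf_genP _).2 => _ [M [irrM Md ->]].
apply/coef_spaceP => g m; apply/BP; apply: esum_invariant => {g}{}m.
have [i Ei] := irr_chi chi_irr irrM; rewrite (esum_act _ irrM Ei).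
by move: Md; rewrite Ei => /chi_d_trivial/(_ _ Ejd) ->.
Qed.

Lemma E_centralizes j X : irreducible X -> character X = chi j -> E j d != 0 ->
  forall Y, rep_dual_sub (hker d) Y ->
  forall t : tens X Y, braiding R (braiding R t) = t.
Proof.
move=> irrX Xj Ejd Y /rep_dual_sub_coef coefY; apply/(double_braiding_id R) => f y x.
have := trivial_on_invariant (hker_invariant Ejd (coefY f y)).
move=> /(congr1 (fun a => act a x)) /=; rewrite actMm actZl mcoefE act1m.
by rewrite (e_act char0 ssA chi_inj chi_irr e_chi _ irrX Xj) eqxx.
Qed.

(** * The double centralizer *)

Definition E_simple (X : repn A) :=
  irreducible X /\ exists2 j, E j d != 0 & character X = chi j.

Definition generated : pred 'I_s := fun i => boolp.asbool
  (forall M : repn A, irreducible M -> character M = chi i -> fusion_gen E_simple M).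

Lemma generated_act (M : repn A) :
  (forall m : M, act (esum generated) m = m) <-> fusion_gen E_simple M.
Proof.
have fG := fusion_gen_subcat E_simple; have [Giso Gd _ _ _] := fG.
split; move: M.
  apply: (@repn_ind _ _ (fun M => (forall m : M, act (esum generated) m = m) ->
    fusion_gen E_simple M) ssA).
  - move=> M N iMN IH idN; apply: (Giso _ _ iMN); apply: IH => m.
    by case: iMN => f [lf bf fE]; apply: (bij_inj bf); rewrite fE idN.
  - by move=> M d0 _; apply: fusion_dim0.
  - move=> M irrM idM; have [i Ei] := irr_chi chi_irr irrM.
    have [m m0] := irr_neq0 irrM; have := idM m; rewrite (esum_act _ irrM Ei).
    case Di: (generated i); last by move=> E0; rewrite -E0 eqxx in m0.
    by move=> _; move/boolp.asboolP: Di => /(_ M irrM Ei).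
  - move=> M N IHM IHN idMN; apply/Gd; split.
      by apply: IHM => m; have /(congr1 fst) := idMN (m, 0).
    by apply: IHN => n; have /(congr1 snd) := idMN (0, n).
apply: (@repn_ind _ _ (fun M => fusion_gen E_simple M ->
    forall m : M, act (esum generated) m = m) ssA).
- move=> M N iMN IH gN; have idM := IH (Giso _ _ (repn_iso_sym iMN) gN).
  by case: iMN => f [lf [g fK gK] fE] n; rewrite -[n]gK -fE idM.
- by move=> M d0 _ m; rewrite [m]dim0_eq0 // act0.
- move=> M irrM gM m; have [i Ei] := irr_chi chi_irr irrM; rewrite (esum_act _ irrM Ei).
  suff -> : generated i by [].
  apply/boolp.asboolP => N irrN Ni; apply: Giso gM.
  by apply: (irr_iso ssA chi_irr e_chi) => //; rewrite Ei Ni.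
- by move=> M N IHM IHN /Gd[gM gN] [m n] /=; rewrite IHM ?IHN.
Qed.

Lemma generated_fusion : fusion_idem generated.
Proof.
have [_ _ Gu Gt _] := fusion_gen_subcat E_simple; split.
  by have := (generated_act _).2 Gu (1 : k^o) => E1; rewrite -[LHS]mulr1; apply: E1.
apply: comul_idem_tensor; first exact: esum_idem.
by move=> M N /generated_act gM /generated_act gN; apply/generated_act; apply: Gt.
Qed.

Lemma E_generated j : E j d != 0 -> generated j.
Proof.
by move=> Ejd; apply/boolp.asboolP => M irrM Mj; apply: fusion_gen_gen; split=> //; exists j.
Qed.

Local Notation r := (regquot (esum generated)).
(* The sum of the [e i] over the simple modules centralizing the [E_simple] ones. *)
Definition cent_idem : A := (r 1)^-1 *: phi r.
Local Notation p := cent_idem.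

Let r1_neq0 : r 1 != 0. Proof. exact: regquot_degree_neq0 generated_fusion. Qed.

Lemma phi_mul_cent_idem f : idem_invariant (esum generated) f -> phi f * p = f 1 *: p.
Proof.
move=> If; rewrite /p -scalerAr -(drinfeldM qtR); last exact/phi_central/regquot_trace.
by rewrite (regquot_mulr generated_fusion If) linearZ !scalerA mulrC.
Qed.

Lemma cent_idem_idem : central_idem p.
Proof.
have cp : central p.
  by move=> a; rewrite /p -scalerAl (phi_central (regquot_trace _)) scalerAr.
split=> //; rewrite {1}/p -scalerAl phi_mul_cent_idem; last exact: regquot_invariant (esum_idem _).
by rewrite scalerA mulVf // scale1r.
Qed.

Lemma cent_idem_neq0 : p != 0.
Proof.
rewrite scaler_eq0 invr_eq0 (negPf r1_neq0) /=; apply/eqP=> pr0.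
have r0 : r = 0 by apply: drinfeld_inj; rewrite pr0 linear0.
by have := r1_neq0; rewrite r0 zero_lfunE eqxx.
Qed.

(** By symmetry of the pairing, the condition on [psi j] of the character of [N] becomes a trace of
    [phi (chi j)] on [N], where [phi (chi j)] acts by [chi j 1]. *)
Lemma cent_idem_rep_dual_sub N : irreducible N -> (forall n : N, act p n = n) ->
  rep_dual_sub (hker d) N.
Proof.
move=> irrN pN; apply: coef_rep_dual_sub; apply/coef_spaceP.
have [i Ni] := irr_chi chi_irr irrN.
apply: (hopf_genP _).1; exists N; split=> //; rewrite Ni; apply/chi_d_trivial => j Ejd.
rewrite /trivial_on /psi -chi1E -Ni -(drinfeld_sym R);
  [|exact: char_tracelike|exact: chi_tracelike].
have pj n : act (phi (chi j)) n = chi j 1 *: (n : N).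
  have Ij : idem_invariant (esum generated) (chi j) by apply/chi_invariant/E_generated.
  by rewrite -[n in LHS]pN -actMm phi_mul_cent_idem // actZl pN.
by rewrite (char_scalar pj) mulrAC divff ?degree_neq0 // mul1r char1.
Qed.

(* The simple modules on which [p] acts as 1 lie in [Rep (hker d)^*], hence are
   centralized by [X]. For [X] outside the subcategory generated by the [E_simple]
   modules, [chi_X(phi(chi_reg(p .)))] would be both [chi_X(1) chi_reg(p) <> 0] and
   a multiple of [(chi_X r)(Lam) = 0]. *)
Lemma centralizes_generated X : irreducible X ->
  (forall Y, rep_dual_sub (hker d) Y -> forall t : tens X Y, braiding R (braiding R t) = t) ->
  fusion_gen E_simple X.
Proof.
move=> irrX centX; have [l Xl] := irr_chi chi_irr irrX.
have [/boolp.asboolP/(_ X irrX Xl)//|nDl] := boolP (generated l).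
have X0 (x : X) : act (esum generated) x = 0.
  by rewrite (esum_act _ irrX Xl) (negPf nDl).
have [cp pp] := cent_idem_idem.
have [n En] := chireg_decomp; pose tau := regquot p.
have tau1 : tau 1 = chireg A p by rewrite shlE mulr1.
have ttau : tracelike tau := regquot_tracelike cent_idem_idem.
have tau1_neq0 : tau 1 != 0.
  rewrite tau1 chiregE; apply/eqP => tr0.
  have := ltr_idem_eq0 char0 (linear_mull p) _ tr0 1; rewrite mulr1 => p0.
  by have := cent_idem_neq0; rewrite p0 ?eqxx // => x; rewrite mulrA pp.
(* Compared constituent by constituent: where [p] acts as 0 both sides vanish; where it acts as 1,
   [X] centralizes the module, so that [phi (chi i)] acts on [X] by [chi i 1]. *)
have E1 : chi l (phi tau) = chi l 1 * tau 1.
  have shlZ i : chi l (phi (shl p (chi i))) = chi l 1 * chi i p.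
    have [N irrN Ni] := chiP chi_irr i.
    have [pN|pN] := central_idem_act char0 irrN (conj cp pp).
      have -> : shl p (chi i) = 0.
        by apply: dual_ext => a; rewrite shlE cp -Ni char_mul_eq0 // zero_lfunE.
      by rewrite -Ni char_eq0 // mulr0 linear0 linear0.
    have -> : shl p (chi i) = chi i.
      by apply: dual_ext => a; rewrite shlE cp -Ni char_mul_id.
    have := (double_braiding_id R X N).1 (centX N (cent_idem_rep_dual_sub irrN pN)) => brN.
    have actN (x : X) : act (phi (chi i)) x = chi i 1 *: x.
      rewrite -Ni char_mcoef linear_sum act_suml (linf_sum (linear_eval 1)) scaler_suml.
      by apply: eq_bigr => b _; rewrite brN mcoefE act1m.
    have -> : chi i p = chi i 1 by rewrite -Ni (char_id pN) char1.
    by rewrite -Xl (char_scalar actN) -char1 mulrC.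
  have tauE : tau = \sum_i (n i)%:R *: shl p (chi i).
    apply: dual_ext => a; rewrite shlE En (linf_sum (linear_eval (p * a))).
    rewrite (linf_sum (linear_eval a)); apply: eq_bigr => i _.
    by rewrite !scale_lfunE shlE.
  rewrite tau1 En (linf_sum (linear_eval p)) mulr_sumr tauE linear_sum.
  rewrite (linf_sum (linear_dual (chi l))); apply: eq_bigr => i _.
  rewrite linearZ (linfZ _ _ (linear_dual (chi l))) shlZ scale_lfunE.
  exact: mulrCA.
(* Symmetry and multiplicativity reduce this to [(chi l * r) Lam], since [chireg] is a multiple of
   [lam] and [lam (phi f) = f (phi lam) = f Lam] for trace-like [f]. *)
have E2 : chi l (phi tau) = 0.
  have tr := regquot_trace generated; have tl := chi_tracelike l.
  rewrite (drinfeld_sym R) // shlE /p -scalerAl (linfZ _ _ (linear_dual _)).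
  rewrite (phi_central tr) -(drinfeldM qtR); last exact: phi_central.
  have [Lam [lam [[cL eL La] [pl l1 lE] _ lS rl]]] := haar_data.
  have tlam : tracelike lam.
    move=> a b; have dn0 : (dim A)%:R != 0 :> k := dim_neq0 char0 A.
    apply: (mulfI dn0); have := char_tracelike (reg_repn A) a b.
    by rewrite -/(chireg A) lE !scale_lfunE.
  rewrite lE scale_lfunE (drinfeld_sym R) ?pl //; last exact: tracelikeM.
  (* [Lam] absorbs [eg], and [comul_idem_r] spreads it over both legs; on the first leg it kills
     [X]. *)
  suff -> : (chi l * r) Lam = 0 by rewrite !scaler0.
  set eg := esum generated.
  have Lame : Lam = Lam * eg.
    by rewrite cL La generated_fusion.1 scale1r.
  rewrite dualM_ev2.
  transitivity (ev2 (chi l) (chireg A) (comul Lam * (1 \ox eg))).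
    move: (comul Lam); apply: (tens_ext (Z := k^o) (f := ev2 (chi l) r)
      (g := fun s : tens A A => ev2 (chi l) (chireg A) (s * (1 \ox eg)))).
    - exact: linear_ev2.
    - exact: (linear_comp (linear_ev2 _ _) (linear_mulr _)).
    by move=> a b; rewrite pureM !ev2_pure shlE mulr1 (esum_idem generated).1.
  rewrite Lame comulM -mulrA.
  rewrite (comul_idem_r char0 chireg_integral (esum_idem _) generated_fusion.2).
  move: (comul Lam); apply: (tens_ext (Z := k^o)
      (f := fun s : tens A A => ev2 (chi l) (chireg A) (s * (eg \ox eg))) (g := fun=> 0)).
  - exact: (linear_comp (linear_ev2 _ _) (linear_mulr _)).
  - by move=> c a b; rewrite scaler0 addr0.
  by move=> a b; rewrite pureM ev2_pure -Xl char_mul_eq0 // mul0r.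
by move/eqP: E1; rewrite E2 eq_sym mulf_eq0 (negPf (degree_neq0 l)) (negPf tau1_neq0).
Qed.

End Factorizable.

Theorem theorem4p8 (k : closedFieldType) (char0 : [pchar k] =i pred0)
  (A : hopfType k) (R : tens A A)
  (ssA : semisimple_alg A) (factA : factorizable R)
  (s : nat) (chi : 'I_s -> dualv A) (chi_inj : injective chi)
  (chi_irr : forall x : dualv A, irr_char x <-> exists j, x = chi j)
  (e : 'I_s -> A) (e_chi : forall j, central_idem_of (chi j) (e j))
  (d : A) (d_irr : irr_dual_char d) :
  let E (j : 'I_s) : dualv A := ((drinfeld R)^-1)%VF (e j) in
  forall M : repn A,
    mueger_centralizer R (rep_dual_sub (hker d)) M <->
    fusion_gen (fun X => irreducible X /\
      exists2 j, E j d != 0 & character X = chi j) M.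
Proof.
(* Both sides are generated by simple modules, so that it suffices to place the generators of each
   in the other. *)
move=> E M; split; apply: fusion_gen_sub => {}M [irrM].
  move=> centM.
  exact: (centralizes_generated char0 ssA factA chi_inj chi_irr e_chi d_irr irrM centM).
case=> j Ejd Mj; apply: fusion_gen_gen; split=> // Y PY t.
exact: (E_centralizes char0 ssA factA chi_inj chi_irr e_chi d_irr irrM Mj Ejd PY).
Qed.
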